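(* Let $g\in L^2(\mathbb{R})$ with $\operatorname{supp}(g)\subseteq[c,d]$ and $d>c$. Furthermore let $a\in[\frac{d-c}{2},d-c[$, $b\in\,]0,\frac1a[$ and $K=\big\lfloor\frac{(d-c-a)b}{1-ab}\big\rfloor$. If the Gabor system $\mathcal{G}(g,a,b)$ is a frame, with frame operator $\mathbf{S}$, the following hold. (i) The inverse frame operator $\mathbf{S}^{-1}$ has a Walnut-like representation of the form $$\mathbf{S}^{-1}f=\sum_{k=-K}^{K}\omega_k\mathbf{T}_{-kb^{-1}}f,$$ with $\operatorname{supp}(\omega_k)\subseteq\bigcup_{n\in\mathbb{Z}}I^{-\operatorname{sgn}(k)}_{n,|k|}$ for all $k\ne0$. (ii) The canonical dual window $\tilde g=\mathbf{S}^{-1}g\in L^2(\mathbb{R})$ satisfies $$\operatorname{supp}(\tilde g)\subseteq I_{0,0}\cup\bigcup_{k=1}^{K}\big(I^-_{-k,k}\cup I^+_{k,k}\big).$$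
   Context: $\mathbb{N}=\{1,2,\dots\}$. $\mathbf{T}_xf(t)=f(t-x)$. $\operatorname{supp}(f)$ denotes the essential support, i.e. the support up to sets of measure zero. $[x,y]=\emptyset$ if $x>y$. The Gabor system $\mathcal{G}(g,a,b)$ is the set of functions $g_{m,n}(t)=g(t-na)e^{2\pi i mbt}$, $m,n\in\mathbb{Z}$. It is a frame if there are $0<A\le B<\infty$ with $A\|f\|^2\le\sum_{m,n}|\langle f,g_{m,n}\rangle|^2\le B\|f\|^2$ for all $f\in L^2(\mathbb{R})$; its frame operator is $\mathbf{S}f=\sum_{m,n}\langle f,g_{m,n}\rangle g_{m,n}$. For $n\in\mathbb{Z}$, $k\in\mathbb{N}$ (translation of intervals: $[x,y]+na=[x+na,y+na]$): $$I_{n,0}=[c,d]+na,\quad I^+_{n,k}=[c-(k-1)a+kb^{-1},\,d]+na,\quad I^-_{n,k}=[c,\,d+(k-1)a-kb^{-1}]+na.$$ $I^{-\operatorname{sgn}(k)}_{n,|k|}$ means $I^-_{n,k}$ if $k>0$ and $I^+_{n,|k|}$ if $k<0$. Walnut-like representation: a bounded linear operator $\mathbf{W}$ on $L^2(\mathbb{R})$ has a Walnut-like representation with weights $(\omega_\lambda)_{\lambda\in\Lambda}\subset L^\infty(\mathbb{R})$ and translation constants $(a_\lambda)_{\lambda\in\Lambda}\subset\mathbb{R}$ ($\Lambda$ countable) if $\mathbf{W}f=\sum_{\lambda\in\Lambda}\omega_\lambda\mathbf{T}_{a_\lambda}f$ for all $f$ in a dense subspace $X$ of $L^2(\mathbb{R})$,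 with the sum unconditionally convergent. *)

(* Defs.v *)
(* MathComp-Analysis, with the complex numbers R[i] of mathcomp-real-closed. *)
From HB Require Import structures.
From mathcomp Require Import all_boot all_order all_algebra finmap.
From mathcomp Require Import all_classical all_reals all_analysis.
From mathcomp Require Import complex.

Set Implicit Arguments.
Unset Strict Implicit.
Unset Printing Implicit Defensive.

Import Order.TTheory GRing.Theory Num.Theory.
Import numFieldNormedType.Exports.

Local Open Scope classical_set_scope.
Local Open Scope ring_scope.

Section L2.
Context {R : realType}.
Local Notation mu := (@lebesgue_measure R).
Implicit Types (f g h : R -> R[i]) (W : (R -> R[i]) -> R -> R[i]).

(* The modulus as an element of R: the norm `|z| of R[i] is valued in R[i]. *)
Definition cmod (z : R[i]) : R := complex.ComplexField.Normc.normc z.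

Definition cmeasurable f : Prop :=
  measurable_fun [set: R] (fun x => complex.Re (f x)) /\
  measurable_fun [set: R] (fun x => complex.Im (f x)).

Definition cLnorm (p : \bar R) f : \bar R :=
  ('N[mu]_p[(fun x => (cmod (f x))%:E)])%E.

(* Elements of the complex L^p(R) are represented by functions; equality in
   L^p(R) is [f = g %[ae mu]]. *)
Definition cLp (p : \bar R) f : Prop :=
  cmeasurable f /\ (cLnorm p f < +oo)%E.

Definition L2 : (R -> R[i]) -> Prop := cLp 2%:E.
Definition Linf : (R -> R[i]) -> Prop := cLp +oo%E.
Definition L2norm : (R -> R[i]) -> \bar R := cLnorm 2%:E.

Definition cintegral f : R[i] :=
  Complex (Rintegral mu setT (fun x => complex.Re (f x)))
          (Rintegral mu setT (fun x => complex.Im (f x))).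

Definition inner f g : R[i] := cintegral (fun x => f x * conjc (g x)).

(* The essential support: the complement of the largest open set on which f
   vanishes almost everywhere. *)
Definition ess_supp f : set R :=
  [set x | forall U : set R, nbhs x U ->
     ~ (\forall y \ae mu, U y -> f y = 0)].

(* Unconditional convergence in L^2(R) of the sum of the u i, i in L, to h:
   convergence along the finite subsets of L directed by inclusion. *)
Definition unconditional_sum (I : choiceType) (L : set I)
    (u : I -> R -> R[i]) h : Prop :=
  forall e : R, 0 < e ->
  exists2 A0 : {fset I}, [set` A0] `<=` L &
  forall A : {fset I}, [set` A0] `<=` [set` A] -> [set` A] `<=` L ->
    (L2norm (fun t => h t - \sum_(i <- A) u i t)%R < e%:E)%E.

Definition bounded_linear W : Prop :=
  [/\ forall f, L2 f -> L2 (W f),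
      forall (z : R[i]) f h, L2 f -> L2 h ->
        W (fun t => z * f t + h t) = (fun t => z * W f t + W h t) %[ae mu]
    & exists M : R, forall f, L2 f -> (L2norm (W f) <= M%:E * L2norm f)%E].

Definition dense_subspace (X : set (R -> R[i])) : Prop :=
  [/\ X `<=` L2,
      forall (z : R[i]) f h, X f -> X h -> X (fun t => z * f t + h t)
    & forall f, L2 f -> forall e : R, 0 < e ->
        exists2 h, X h & (L2norm (fun t => f t - h t)%R < e%:E)%E].

Definition translate (x : R) f : R -> R[i] := fun t => f (t - x).

Definition walnut_like (I : choiceType) (L : set I) W
    (w : I -> R -> R[i]) (s : I -> R) : Prop :=
  [/\ bounded_linear W, countable L, forall i, L i -> Linf (w i)
    & exists2 X, dense_subspace X &
      forall f, X f ->
        unconditional_sum L (fun i t => w i t * translate (s i) f t) (W f)].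

(* The inverse on L^2(R), as a total function with junk value 0 outside the
   range of W. *)
Definition inverse_op W : (R -> R[i]) -> R -> R[i] :=
  fun f => xget (fun=> 0) [set h | L2 h /\ W h = f %[ae mu]].

End L2.

Section Gabor.
Context {R : realType}.
Implicit Types (g f : R -> R[i]) (a b c d : R).

Definition cis (x : R) : R[i] := Complex (cos x) (sin x).

(* The index p is the pair (m, n): modulation by m b, translation by n a. *)
Definition gabor g a b (p : int * int) : R -> R[i] :=
  fun t => g (t - p.2%:~R * a) * cis (2 * pi * p.1%:~R * b * t).

Definition gabor_frame g a b : Prop :=
  exists A B : R, [/\ 0 < A, A <= B &
    forall f, L2 f ->
      let s := (\esum_(p in [set: int * int])
                  ((cmod (inner f (gabor g a b p))) ^+ 2)%:E)%E in
      (A%:E * L2norm f ^+ 2 <= s /\ s <= B%:E * L2norm f ^+ 2)%E].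

(* The sum of the series, with junk value 0 if it diverges. *)
Definition frame_operator g a b : (R -> R[i]) -> R -> R[i] :=
  fun f => xget (fun=> 0) [set h | L2 h /\
    unconditional_sum [set: int * int]
      (fun p t => inner f (gabor g a b p) * gabor g a b p t) h].

Definition I_zero a c d (n : int) : set R :=
  [set` `[c + n%:~R * a, d + n%:~R * a]].

Definition I_plus a b c d (n : int) (k : nat) : set R :=
  [set` `[c - (k%:R - 1) * a + k%:R * b^-1 + n%:~R * a, d + n%:~R * a]].

Definition I_minus a b c d (n : int) (k : nat) : set R :=
  [set` `[c + n%:~R * a, d + (k%:R - 1) * a - k%:R * b^-1 + n%:~R * a]].

(* The interval I^{-sgn k}_{n,|k|}, for k != 0. *)
Definition I_opp_sgn a b c d (n k : int) : set R :=
  if 0 < k then I_minus a b c d n `|k|%N else I_plus a b c d n `|k|%N.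

End Gabor.

(* Main.v *)
Require Import Defs.
From HB Require Import structures.
From mathcomp Require Import all_boot all_order all_algebra finmap.
From mathcomp Require Import all_classical all_reals all_analysis.
From mathcomp Require Import measurable_realfun ess_sup_inf complex.
From mathcomp Require Import ring lra zify.

(** Let h = b^-1, and let n a + pos t with pos t in [c, c + a) be the division
    of t by a, so that n = cell t.

    The frame operator acts on each orbit t + h Z as a Jacobi matrix. As
    a < h, the window g has length at most 2 a < 2 h, so the product of f with
    the conjugate of a translate of g lives on two periods of the modulations.
    Parseval's formula for such products (parseval2), summed over the
    translations (esum_gabor), gives
      sum |<f, g_(m,n)>|^2 = h (|P f + Q f (. + h)|^2 + |S f|^2)
    in the norm of L2, where P, Q and S are conjugates of values of the window
    at pos t, pos t + h and pos t + a. Hence the frame operator is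
    h (L^* L + M^* M) with L f = P f + Q f (. + h) and M f = S f, a matrix on
    each orbit that links only neighbours, and the link between t and t + h is
    h times the product of Q t with the conjugate of P t. That the frame series
    converges to this operator is frame_series_cvg.

    The links break after few steps. If Q t is nonzero then pos t + h < d, and
    therefore t + h lies in the next cell with pos (t + h) = pos t + (h - a)
    (gQ_step). After j consecutive nonzero links the position has grown so much
    that j (h - a) < d - c - a, that is j <= K (chain_le). So the matrix is an
    orthogonal sum of blocks of size at most K + 1.

    The frame bounds are inherited by almost every orbit: the lower one is
    tested on functions that are carried by few translates of a small set, for
    countably many sequences of values (good_ae). Hence the blocks, and likewise
    the finite sections of the matrix to the indices -K, ..., K around a point,
    are invertible with inverse bounded by 1 / A. As such a section contains the
    whole block of its centre, the middle row of its inverse gives the inverse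
    of the frame operator (opVT, opTV). The entries of that row are the 2 K + 1
    weights of the representation.

    The supports are read off from the same chains. The weight of index k > 0
    at t is nonzero only if the k links from t to t + k h are nonzero
    (wgt_right), and then pos t + (k - 1) (h - a) + h < d (chain_lt), which says
    that t lies in the interval I^- of indices cell t and k; for k < 0 the chain
    ends at t and one obtains I^+. For the dual window the far end of the chain
    must moreover lie in the support of g, which leaves only the two cells that
    appear in dual_support.

    A preliminary reduction replaces g by a function that is equal to it almost
    everywhere, is bounded and vanishes off [c, d): the upper frame bound forces
    |g|^2 <= b B almost everywhere (gabor_bounded). *)

Set Implicit Arguments.
Unset Strict Implicit.
Unset Printing Implicit Defensive.

Import Order.TTheory GRing.Theory Num.Theory.
Import numFieldNormedType.Exports.

Local Open Scope classical_set_scope.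
Local Open Scope ring_scope.

(** * Complex numbers in coordinates *)

Section Complex.
Context {R : realType}.
Implicit Types z w : R[i].
Notation Re := complex.Re.
Notation Im := complex.Im.

Lemma cReD z w : Re (z + w) = Re z + Re w. Proof. by case: z w => a b [c d]. Qed.
Lemma cImD z w : Im (z + w) = Im z + Im w. Proof. by case: z w => a b [c d]. Qed.
Lemma cReN z : Re (- z) = - Re z. Proof. by case: z. Qed.
Lemma cImN z : Im (- z) = - Im z. Proof. by case: z. Qed.
Lemma cReM z w : Re (z * w) = Re z * Re w - Im z * Im w.
Proof. by case: z w => a b [c d]. Qed.
Lemma cImM z w : Im (z * w) = Re z * Im w + Im z * Re w.
Proof. by case: z w => a b [c d]. Qed.
Lemma cReJ z : Re (conjc z) = Re z. Proof. by case: z. Qed.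
Lemma cImJ z : Im (conjc z) = - Im z. Proof. by case: z. Qed.
Lemma cRe0 : Re (0 : R[i]) = 0. Proof. by []. Qed.
Lemma cIm0 : Im (0 : R[i]) = 0. Proof. by []. Qed.
Lemma cRe1 : Re (1 : R[i]) = 1. Proof. by []. Qed.
Lemma cIm1 : Im (1 : R[i]) = 0. Proof. by []. Qed.

Definition cE := (cReD, cImD, cReN, cImN, cReM, cImM, cReJ, cImJ, cRe0, cIm0, cRe1, cIm1).

Lemma eqc z w : Re z = Re w -> Im z = Im w -> z = w.
Proof. by case: z w => a b [c d] /= -> ->. Qed.

(** The real inner product of the complex plane. Its square sqc is the squared
    modulus with values in R; working with real inner products reduces every
    estimate below to the real integral and order theory. *)
Definition dotc z w : R := Re z * Re w + Im z * Im w.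
Definition sqc z : R := dotc z z.

Lemma Re_mulJ z w : Re (z * conjc w) = dotc z w.
Proof. rewrite !cE /dotc; ring. Qed.
Lemma Im_mulJ z w : Im (z * conjc w) = dotc z ('i%C * w).
Proof. rewrite !cE /dotc !cE /=; ring. Qed.
Lemma sqc_ge0 z : 0 <= sqc z.
Proof. by rewrite /sqc /dotc addr_ge0// -expr2 sqr_ge0. Qed.
Lemma sqcE z : sqc z = cmod z ^+ 2.
Proof.
case: z => a b; rewrite /sqc /dotc /cmod /= sqr_sqrtr -?expr2//.
by rewrite addr_ge0 ?sqr_ge0.
Qed.
Lemma sqc0 : sqc 0 = 0. Proof. by rewrite /sqc /dotc /= !mulr0 addr0. Qed.
Lemma sqc_eq0 z : sqc z = 0 -> z = 0.
Proof.
rewrite /sqc /dotc -!expr2 => /eqP; rewrite paddr_eq0 ?sqr_ge0// !sqrf_eq0.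
by case/andP => /eqP ? /eqP ?; apply: eqc.
Qed.
Lemma sqcM z w : sqc (z * w) = sqc z * sqc w.
Proof. rewrite /sqc /dotc !cE; ring. Qed.
Lemma sqcJ z : sqc (conjc z) = sqc z.
Proof. rewrite /sqc /dotc !cE; ring. Qed.
Lemma sqcN z : sqc (- z) = sqc z.
Proof. rewrite /sqc /dotc !cE; ring. Qed.
Lemma conjc0E : conjc (0 : R[i]) = 0.
Proof. by apply: eqc; rewrite /= ?oppr0. Qed.
Lemma conjcM z w : conjc (z * w) = conjc z * conjc w.
Proof. by apply: eqc; rewrite !cE; ring. Qed.
Lemma sqcD z w : sqc (z + w) = sqc z + 2 * dotc z w + sqc w.
Proof. rewrite /sqc /dotc !cE; ring. Qed.
Lemma dotcC z w : dotc z w = dotc w z.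
Proof. rewrite /dotc; ring. Qed.
Lemma dotcDl z1 z2 w : dotc (z1 + z2) w = dotc z1 w + dotc z2 w.
Proof. rewrite /dotc !cE; ring. Qed.
Lemma dotcMl x z w : dotc (x * z) w = dotc z (conjc x * w).
Proof. rewrite /dotc !cE; ring. Qed.
Lemma dotcNl z w : dotc (- z) w = - dotc z w.
Proof. rewrite /dotc !cE; ring. Qed.
Lemma dotc0l w : dotc 0 w = 0.
Proof. by rewrite /dotc /= !mul0r addr0. Qed.
Lemma dotc_le z w : `|dotc z w| <= sqc z + sqc w.
Proof.
have h1 := sqc_ge0 (z + w); have h2 := sqc_ge0 (z - w).
have h3 := sqc_ge0 z; have h4 := sqc_ge0 w.
rewrite sqcD in h1; rewrite sqcD sqcN dotcC dotcNl dotcC in h2.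
by rewrite ler_norml; apply/andP; split; lra.
Qed.
Lemma sqcD_le z w : sqc (z + w) <= 2 * (sqc z + sqc w).
Proof.
by have := sqc_ge0 (z - w); rewrite !sqcD sqcN (dotcC z (- w)) dotcNl (dotcC w); lra.
Qed.
Lemma sqc_real (x : R) : sqc (x%:C)%C = x ^+ 2.
Proof. rewrite /sqc /dotc /=; ring. Qed.
Lemma sqc_cis x : sqc (cis x) = 1.
Proof. by rewrite /sqc /dotc /= -!expr2 cos2Dsin2. Qed.
Lemma cisD (x y : R) : cis (x + y) = cis x * cis y.
Proof. by apply: eqc; rewrite !cE /= ?cosD ?sinD//; ring. Qed.
Lemma cisN (x : R) : cis (- x) = conjc (cis x).
Proof. by apply: eqc; rewrite /= ?cosN ?sinN. Qed.
Lemma cis0 : cis 0 = 1 :> R[i].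
Proof. by apply: eqc; rewrite /= ?cos0 ?sin0. Qed.
End Complex.

Section Measurability.
Context {R : realType}.
Implicit Types (f g : R -> R[i]) (k : R -> R).
Notation Re := complex.Re.
Notation Im := complex.Im.
Notation mfun := (measurable_fun [set: R]).

Lemma mfunD k1 k2 : mfun k1 -> mfun k2 -> mfun (fun x => k1 x + k2 x).
Proof. exact: measurable_funD. Qed.
Lemma mfunM k1 k2 : mfun k1 -> mfun k2 -> mfun (fun x => k1 x * k2 x).
Proof. exact: measurable_funM. Qed.

Lemma cmeas_cst z : cmeasurable (fun _ : R => z).
Proof. by split; exact: measurable_cst. Qed.
Lemma cmeasD f g : cmeasurable f -> cmeasurable g ->
  cmeasurable (fun t => f t + g t).
Proof.
move=> [f1 f2] [g1 g2]; split.
  by under eq_fun do rewrite cReD; exact: mfunD.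
by under eq_fun do rewrite cImD; exact: mfunD.
Qed.
Lemma cmeasM f g : cmeasurable f -> cmeasurable g ->
  cmeasurable (fun t => f t * g t).
Proof.
move=> [f1 f2] [g1 g2]; split.
  by under eq_fun do rewrite cReM; apply: measurable_funB; exact: mfunM.
by under eq_fun do rewrite cImM; apply: mfunD; exact: mfunM.
Qed.
Lemma cmeasJ f : cmeasurable f -> cmeasurable (fun t => conjc (f t)).
Proof.
move=> [f1 f2]; split; first by under eq_fun do rewrite cReJ.
by under eq_fun do rewrite cImJ; exact: measurable_funN.
Qed.
Lemma cmeas_real k : mfun k -> cmeasurable (fun t => (k t)%:C%C).
Proof. by split => //; exact: measurable_cst. Qed.
Lemma cmeas_comp f k : mfun k -> cmeasurable f -> cmeasurable (fun t => f (k t)).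
Proof.
move=> mk [f1 f2].
by split; [exact: (measurableT_comp f1)|exact: (measurableT_comp f2)].
Qed.
Lemma cmeas_sum (I : Type) (s : seq I) (F : I -> R -> R[i]) :
  (forall i, cmeasurable (F i)) -> cmeasurable (fun t => \sum_(i <- s) F i t).
Proof.
move=> mF; elim: s => [|i s IH].
  by under eq_fun do rewrite big_nil; exact: cmeas_cst.
by under eq_fun do rewrite big_cons; exact: cmeasD.
Qed.
Lemma cmeas_if (p : R -> bool) f : measurable_fun [set: R] p -> cmeasurable f ->
  cmeasurable (fun t => if p t then f t else 0).
Proof.
move=> mp [f1 f2]; split.
  rewrite (_ : (fun t => _) = (fun t => if p t then Re (f t) else 0)).
    by apply: measurable_fun_ifT => //; exact: measurable_cst.
  by apply/funext => t; case: ifP.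
rewrite (_ : (fun t => _) = (fun t => if p t then Im (f t) else 0)).
  by apply: measurable_fun_ifT => //; exact: measurable_cst.
by apply/funext => t; case: ifP.
Qed.
Lemma measurable_dotc f g : cmeasurable f -> cmeasurable g ->
  mfun (fun t => dotc (f t) (g t)).
Proof. by move=> [f1 f2] [g1 g2]; apply: mfunD; exact: mfunM. Qed.
Lemma measurable_sqc f : cmeasurable f -> mfun (fun t => sqc (f t)).
Proof. by move=> mf; exact: measurable_dotc. Qed.
Lemma measurable_shift (x : R) : mfun (fun t => t + x).
Proof. by apply: mfunD => //; exact: measurable_cst. Qed.
Lemma cmeas_cis (x : R) : cmeasurable (fun t => cis (x * t)).
Proof.
have mx : mfun (fun t => x * t) by apply: mfunM => //; exact: measurable_cst.
by split; apply: measurableT_comp => //;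
  apply: continuous_measurable_fun; [exact: continuous_cos|exact: continuous_sin].
Qed.

End Measurability.

(** * Square-integrable functions on the line *)

Section AlmostEverywhere.
Context {R : realType}.
Local Notation mu := (@lebesgue_measure R).

Lemma ae_imp (P Q : R -> Prop) : (forall x, P x -> Q x) ->
  (\forall x \ae mu, P x) -> \forall x \ae mu, Q x.
Proof. exact: (@filterS _ _ (ae_filter_ringOfSetsType mu)). Qed.
Lemma ae_and (P Q : R -> Prop) : (\forall x \ae mu, P x) ->
  (\forall x \ae mu, Q x) -> \forall x \ae mu, P x /\ Q x.
Proof. exact: (@filterI _ _ (ae_filter_ringOfSetsType mu)). Qed.
Lemma ae_all (P : R -> Prop) : (forall x, P x) -> \forall x \ae mu, P x.
Proof. by move=> ?; exact: (@filterE _ _ (ae_filter_ringOfSetsType mu)). Qed.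
Lemma ae_eqE {T : Type} (f g : R -> T) :
  f = g %[ae mu] <-> \forall x \ae mu, f x = g x.
Proof. by split; apply: ae_imp => x; [exact|move=> -> _]. Qed.
Lemma ae_eq_trans {T : Type} (f g h : R -> T) :
  f = g %[ae mu] -> g = h %[ae mu] -> f = h %[ae mu].
Proof.
move=> /ae_eqE fg /ae_eqE gh; apply/ae_eqE.
by apply: ae_imp (ae_and fg gh) => x [-> ->].
Qed.
Lemma ae_eq_sym {T : Type} (f g : R -> T) :
  f = g %[ae mu] -> g = f %[ae mu].
Proof. by move=> /ae_eqE fg; apply/ae_eqE; apply: ae_imp fg => x ->. Qed.
End AlmostEverywhere.

Section L2theory.
Context {R : realType}.
Local Notation mu := (@lebesgue_measure R).
Local Notation mfun := (measurable_fun [set: R]).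
Local Notation integ F := (mu.-integrable [set: R] (EFin \o F)).
Implicit Types (f g h : R -> R[i]) (F G : R -> R).

Lemma integ_le F G : mfun F -> (forall x, `|F x| <= G x) -> integ G -> integ F.
Proof.
move=> mF FG; apply: le_integrable => //; first exact/measurable_EFinP.
by move=> x _ /=; rewrite lee_fin (le_trans (FG x))// ler_norm.
Qed.

Lemma integD F G : integ F -> integ G -> integ (fun x => F x + G x).
Proof.
move=> iF iG; have := integrableD measurableT iF iG.
by apply: eq_integrable => // x _ /=; rewrite EFinD.
Qed.

Lemma integZ (k : R) F : integ F -> integ (fun x => k * F x).
Proof.
move=> iF; have := integrableZl measurableT k iF.
by apply: eq_integrable => // x _ /=; rewrite EFinM.
Qed.

Lemma poweR2 (x : \bar R) : (0 <= x)%E -> (x `^ 2 = x ^+ 2)%E.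
Proof.
case: x => [x| |] // x0; first by rewrite poweR_EFin powR_mulrn// EFin_expe.
by rewrite poweRyr// expeS expe1 mulyy.
Qed.

Lemma L2norm_sq f : (L2norm f ^+ 2 = \int[mu]_x (sqc (f x))%:E)%E.
Proof.
rewrite -poweR2 ?Lnorm_ge0// /L2norm /cLnorm poweR_Lnorm//.
by apply: eq_integral => x _; rewrite poweR2 ?abse_ge0// sqcE abse_EFin -EFin_expe real_normK ?num_real.
Qed.

(** Square integrability through the real function sqc, the form in which the
    integration theory applies to it. *)
Lemma L2P f : L2 f <-> cmeasurable f /\ integ (fun x => sqc (f x)).
Proof.
split=> -[mf fy]; split=> //.
  apply/integrableP; split.
    by apply/measurable_EFinP; exact: measurable_sqc.
  under eq_integral do rewrite /= ger0_norm ?sqc_ge0//.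
  rewrite -L2norm_sq; move: fy; rewrite /L2norm /cLnorm.
  set N := Lnorm _ _ _; have : (0 <= N)%E by exact: Lnorm_ge0.
  by case: N => // r _ _; rewrite -EFin_expe ltry.
case/integrableP : fy => _.
under eq_integral do rewrite /= ger0_norm ?sqc_ge0//.
rewrite -L2norm_sq /L2norm /cLnorm; set N := Lnorm _ _ _.
have : (0 <= N)%E by exact: Lnorm_ge0.
by case: N => [r| |] // _; rewrite ?ltry// expeS expe1 mulyy.
Qed.

Lemma L2_meas f : L2 f -> cmeasurable f. Proof. by case/L2P. Qed.
Lemma L2_sq f : L2 f -> integ (fun x => sqc (f x)). Proof. by case/L2P. Qed.

Lemma L2_dom f G : cmeasurable f -> integ G -> (forall x, sqc (f x) <= G x) ->
  L2 f.
Proof.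
move=> mf iG fG; apply/L2P; split => //; apply: integ_le iG.
  exact: measurable_sqc.
by move=> x; rewrite ger0_norm ?sqc_ge0.
Qed.

Lemma L2D f g : L2 f -> L2 g -> L2 (fun t => f t + g t).
Proof.
move=> f2 g2; apply: (@L2_dom _ (fun t => 2 * (sqc (f t) + sqc (g t)))).
- by apply: cmeasD; exact: L2_meas.
- by apply: integZ; apply: integD; exact: L2_sq.
- by move=> x; exact: sqcD_le.
Qed.

Lemma L2Mb (C : R) k f : cmeasurable k -> (forall t, sqc (k t) <= C) ->
  L2 f -> L2 (fun t => k t * f t).
Proof.
move=> mk kC f2; apply: (@L2_dom _ (fun t => C * sqc (f t))).
- by apply: cmeasM => //; exact: L2_meas.
- by apply: integZ; exact: L2_sq.
- by move=> x; rewrite sqcM ler_wpM2r ?sqc_ge0.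
Qed.

Lemma L2Z z f : L2 f -> L2 (fun t => z * f t).
Proof. by apply: (@L2Mb (sqc z)); [exact: cmeas_cst|]. Qed.

Lemma L2N f : L2 f -> L2 (fun t => - f t).
Proof. by move=> f2; under eq_fun do rewrite -mulN1r; exact: L2Z. Qed.

Lemma L2B f g : L2 f -> L2 g -> L2 (fun t => f t - g t).
Proof. by move=> f2 g2; apply: L2D => //; exact: L2N. Qed.

Lemma L2_0 : L2 (fun _ : R => 0).
Proof.
apply/L2P; split; first exact: cmeas_cst.
apply: eq_integrable (integrable0 _ _) => // x _ /=.
by rewrite /= sqc0.
Qed.

Lemma L2_sum (I : Type) (s : seq I) (P : pred I) (F : I -> R -> R[i]) :
  (forall i, P i -> L2 (F i)) -> L2 (fun t => \sum_(i <- s | P i) F i t).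
Proof.
move=> F2; elim: s => [|i s IH].
  by under eq_fun do rewrite big_nil; exact: L2_0.
have [Pi|/negPf Pi] := boolP (P i); under eq_fun do rewrite big_cons Pi //.
  by apply: L2D => //; exact: F2.
exact: IH.
Qed.

Lemma integ_dotc f g : L2 f -> L2 g -> integ (fun x => dotc (f x) (g x)).
Proof.
move=> f2 g2; apply: (@integ_le _ (fun x => sqc (f x) + sqc (g x))).
- by apply: measurable_dotc; exact: L2_meas.
- by move=> x; exact: dotc_le.
- by apply: integD; exact: L2_sq.
Qed.

(** The real part of the inner product of L2; the imaginary part is recovered
    by inner_dot from the inner product with a multiple by i. *)
Definition dot f g : R := \int[mu]_x dotc (f x) (g x).
Definition nrm f : R := dot f f.

Lemma dotC f g : dot f g = dot g f.
Proof. by apply: eq_Rintegral => x _; exact: dotcC. Qed.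

Lemma dotDl f g h : L2 f -> L2 g -> L2 h ->
  dot (fun t => f t + g t) h = dot f h + dot g h.
Proof.
move=> f2 g2 h2; rewrite /dot -RintegralD//; try exact: integ_dotc.
by apply: eq_Rintegral => x _; exact: dotcDl.
Qed.

Lemma dotMl (z : R -> R[i]) f g :
  dot (fun t => z t * f t) g = dot f (fun t => conjc (z t) * g t).
Proof. by apply: eq_Rintegral => x _; exact: dotcMl. Qed.

Lemma dotZl (k : R) f g : L2 f -> L2 g ->
  dot (fun t => k%:C%C * f t) g = k * dot f g.
Proof.
move=> f2 g2; rewrite /dot -RintegralZl//; last exact: integ_dotc.
by apply: eq_Rintegral => x _; rewrite /dotc !cE /=; ring.
Qed.

Lemma dotNl f g : L2 f -> L2 g -> dot (fun t => - f t) g = - dot f g.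
Proof.
move=> f2 g2; rewrite -mulN1r -dotZl//; apply: eq_Rintegral => x _.
by rewrite /dotc !cE /=; ring.
Qed.

Lemma dotBl f g h : L2 f -> L2 g -> L2 h ->
  dot (fun t => f t - g t) h = dot f h - dot g h.
Proof. by move=> f2 g2 h2; rewrite dotDl ?dotNl//; exact: L2N. Qed.

Lemma dotDr f g h : L2 f -> L2 g -> L2 h ->
  dot h (fun t => f t + g t) = dot h f + dot h g.
Proof. by move=> *; rewrite dotC dotDl// (dotC f) (dotC g). Qed.
Lemma dotZr (k : R) f g : L2 f -> L2 g ->
  dot g (fun t => k%:C%C * f t) = k * dot g f.
Proof. by move=> *; rewrite dotC dotZl// (dotC f). Qed.
Lemma dotBr f g h : L2 f -> L2 g -> L2 h ->
  dot h (fun t => f t - g t) = dot h f - dot h g.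
Proof. by move=> *; rewrite dotC dotBl// (dotC f) (dotC g). Qed.

Lemma dot0l f : dot (fun=> 0) f = 0.
Proof.
rewrite /dot (@eq_Rintegral _ _ _ _ _ (fun=> 0)); last by move=> x _; exact: dotc0l.
by rewrite /Rintegral integral0.
Qed.

Lemma dot_suml (I : Type) (s : seq I) (F : I -> R -> R[i]) g :
  (forall i, L2 (F i)) -> L2 g ->
  dot (fun t => \sum_(i <- s) F i t) g = \sum_(i <- s) dot (F i) g.
Proof.
move=> F2 g2; elim: s => [|i s IH].
  by rewrite big_nil; under eq_fun do rewrite big_nil; rewrite dot0l.
under eq_fun do rewrite big_cons; rewrite big_cons dotDl ?IH//.
exact: L2_sum.
Qed.

Lemma nrm_ge0 f : 0 <= nrm f.
Proof. by apply: Rintegral_ge0 => x _; exact: sqc_ge0. Qed.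

Lemma nrmE f : L2 f -> (\int[mu]_x (sqc (f x))%:E)%E = (nrm f)%:E.
Proof.
move=> f2; rewrite /nrm /dot /Rintegral fineK//.
by apply: integrable_fin_num => //; exact: L2_sq.
Qed.

Lemma L2normE f : L2 f -> (L2norm f ^+ 2)%E = (nrm f)%:E.
Proof. by move=> f2; rewrite L2norm_sq nrmE. Qed.

Lemma L2norm_lt f (e : R) : L2 f -> 0 < e ->
  (L2norm f < e%:E)%E <-> nrm f < e ^+ 2.
Proof.
move=> f2 e0; have := L2normE f2.
have : (0 <= L2norm f)%E by exact: Lnorm_ge0.
case: (L2norm f) => [r| |]//; rewrite ?lee_fin ?lte_fin.
by rewrite -EFin_expe => r0 [<-]; rewrite ltr_pXn2r ?nnegrE ?(ltW e0).
Qed.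

Lemma nrm_le F f : L2 f -> integ F -> (forall x, sqc (f x) <= F x) ->
  nrm f <= \int[mu]_x F x.
Proof.
move=> f2 iF fF; apply: le_Rintegral => //; first exact: (L2_sq f2).
by move=> x _; exact: fF.
Qed.

Lemma nrmD f g : L2 f -> L2 g ->
  nrm (fun t => f t + g t) = nrm f + 2 * dot f g + nrm g.
Proof.
move=> f2 g2; have fg := L2D f2 g2.
by rewrite {1}/nrm dotDl// !dotDr// (dotC g f) /nrm; ring.
Qed.

Lemma nrmB f g : L2 f -> L2 g ->
  nrm (fun t => f t - g t) = nrm f - 2 * dot f g + nrm g.
Proof.
move=> f2 g2; have fg := L2B f2 g2.
by rewrite {1}/nrm dotBl// !dotBr// (dotC g f) /nrm; ring.
Qed.

Lemma nrmD_le f g : L2 f -> L2 g ->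
  nrm (fun t => f t + g t) <= 2 * (nrm f + nrm g).
Proof.
move=> f2 g2; have := nrm_ge0 (fun t => f t - g t).
have fB := L2B f2 g2; have fD := L2D f2 g2.
rewrite nrmB // nrmD //; lra.
Qed.

Lemma nrmMb (C : R) k f : cmeasurable k -> (forall t, sqc (k t) <= C) ->
  L2 f -> nrm (fun t => k t * f t) <= C * nrm f.
Proof.
move=> mk kC f2; rewrite -RintegralZl//; last exact: (L2_sq f2).
apply: nrm_le; [exact: L2Mb mk kC f2|by apply: integZ; exact: L2_sq|].
by move=> x; rewrite sqcM -/(sqc _) ler_wpM2r ?sqc_ge0.
Qed.

Lemma ae_nrm f g : L2 f -> L2 g -> f = g %[ae mu] <-> nrm (fun t => f t - g t) = 0.
Proof.
move=> f2 g2; have fg2 := L2B f2 g2; split => fg.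
  rewrite /nrm /dot /Rintegral.
  rewrite (ae_eq_integral (fun=> 0%E)) ?integral0//.
    by apply/measurable_EFinP; apply: measurable_sqc; exact: L2_meas.
  apply: (proj2 (ae_eqE _ _)); move/ae_eqE : fg; apply: ae_imp => x ->.
  by rewrite subrr -/(sqc _) sqc0.
have := ae_eq_integral_abs mu measurableT
  (measurable_int _ (L2_sq fg2)).
case=> + _; under eq_integral do rewrite /= ger0_norm ?sqc_ge0//.
rewrite nrmE// fg => /(_ erefl) /ae_eqE h0; apply/ae_eqE; move: h0.
apply: ae_imp => x /= [] /sqc_eq0/eqP.
by rewrite subr_eq0 => /eqP.
Qed.

Lemma eq_ae_dotl f g h : cmeasurable f -> cmeasurable g -> cmeasurable h ->
  f = g %[ae mu] -> dot f h = dot g h.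
Proof.
move=> mf mg mh fg; rewrite /dot /Rintegral; congr fine.
apply: ae_eq_integral => //; try by (apply/measurable_EFinP; exact: measurable_dotc).
by apply: (proj2 (ae_eqE _ _)); move/ae_eqE : fg; apply: ae_imp => x ->.
Qed.

Lemma inner_dot f g : inner f g = Complex (dot f g) (dot f (fun t => 'i%C * g t)).
Proof.
rewrite /inner /cintegral; congr Complex; apply: eq_Rintegral => x _.
  by rewrite Re_mulJ.
by rewrite Im_mulJ.
Qed.

End L2theory.

Section Shift.
Context {R : realType}.
Local Notation mu := (@lebesgue_measure R).
Local Notation integ F := (mu.-integrable [set: R] (EFin \o F)).
Implicit Types (f g : R -> R[i]).

Lemma pushforward_is_measure d1 d2 (X : measurableType d1) (Y : measurableType d2)
    (phi : X -> Y) (m : {measure set X -> \bar R}) : measurable_fun setT phi ->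
  exists nu : {measure set Y -> \bar R}, forall A, nu A = pushforward m phi A.
Proof.
move=> mphi; unshelve eexists [the measure _ _ of pushforward m phi].
  exact: mphi.
by [].
Qed.

(** The image measure agrees with the Lebesgue measure on half-open intervals,
    which determines it. *)
Lemma lebesgue_measure_shift (x : R) (A : set R) : measurable A ->
  pushforward mu (fun t : R => t + x : measurableTypeR R) A = mu A.
Proof.
move=> mA; set phi := (fun t : R => _).
have mphi : measurable_fun [set: measurableTypeR R] phi := measurable_shift x.
have [nu nuE] : exists nu : {measure set (measurableTypeR R) -> \bar R},
    forall A, nu A = mu (phi @^-1` A) :=
  @pushforward_is_measure _ _ (measurableTypeR R) (measurableTypeR R) phi mu mphi.
apply: etrans (esym (nuE A)) _; apply/esym; apply: (@lebesgue_measure_unique R nu) => //= _ [[a b]] _ <-.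
rewrite nuE /pushforward /=.
have -> : phi @^-1` [set` `]a, b]] = [set` `](a - x), (b - x)]].
  by apply/seteqP; split => t /=; rewrite /phi !in_itv/= ltrBlDr lerBrDr.
rewrite !lebesgue_measure_itv/= !lte_fin ltrBlDr subrK.
by congr (if _ then _ else _); congr EFin; lra.
Qed.

Lemma ge0_integral_shift (x : R) (F : R -> \bar R) :
  measurable_fun [set: R] F -> (forall t, 0 <= F t)%E ->
  (\int[mu]_t F (t + x)%R = \int[mu]_t F t)%E.
Proof.
move=> mF F0; pose phi := (fun t : R => t + x : measurableTypeR R).
have mphi : measurable_fun [set: measurableTypeR R] phi := measurable_shift x.
have := @ge0_integral_pushforward _ _ (measurableTypeR R) (measurableTypeR R) _ phi mphi mu setT F measurableT mF
  (fun t _ => F0 t).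
rewrite preimage_setT => <-; apply: eq_measure_integral => // A mA _.
exact: lebesgue_measure_shift.
Qed.

Lemma integ_shift (x : R) (F : R -> R) : integ F -> integ (fun t => F (t + x)).
Proof.
move=> /integrableP[mF Fy]; apply/integrableP; split.
  exact: (measurableT_comp mF (measurable_shift x)).
apply: le_lt_trans Fy; rewrite le_eqVlt; apply/orP; left; apply/eqP.
apply: (@ge0_integral_shift x (fun t => `|(F t)%:E|)%E) => //.
exact: measurableT_comp.
Qed.

Lemma Rintegral_shift (x : R) (F : R -> R) : integ F ->
  \int[mu]_t F (t + x) = \int[mu]_t F t.
Proof.
move=> iF; have mF := measurable_int _ iF.
rewrite /Rintegral [in LHS]integralE [in RHS]integralE; congr fine; congr (_ - _)%E.
  have H := ge0_integral_shift x (measurable_funepos mF).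
  by rewrite -[RHS]H //; apply: eq_integral => t _; rewrite !funeposE.
have H := ge0_integral_shift x (measurable_funeneg mF).
by rewrite -[RHS]H //; apply: eq_integral => t _; rewrite !funenegE.
Qed.

Lemma L2_shift (x : R) f : L2 f -> L2 (fun t => f (t + x)).
Proof.
case/L2P => mf f2; apply/L2P; split; first exact: (cmeas_comp (measurable_shift x)).
exact: (integ_shift x f2).
Qed.

Lemma nrm_shift (x : R) f : L2 f -> nrm (fun t => f (t + x)) = nrm f.
Proof. by move=> f2; exact: (Rintegral_shift x (L2_sq f2)). Qed.

Lemma ae_shift (x : R) (P : R -> Prop) : (\forall t \ae mu, P t) ->
  \forall t \ae mu, P (t + x).
Proof.
move=> [N [mN N0 PN]]; exists ((fun t => t + x) @^-1` N); split.
- rewrite -[_ @^-1` _]setTI; exact: (measurable_shift x).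
- by have := lebesgue_measure_shift x mN; rewrite /pushforward N0.
- by move=> t; exact: PN.
Qed.

End Shift.

(** * Exponentials and trigonometric polynomials *)

Section Trig.
Context {R : realType}.
Local Notation mu := (@lebesgue_measure R).
Local Notation integ F := (mu.-integrable [set: R] (EFin \o F)).

(** The indicator as a complex factor; it cuts a function to a set without
    restricting the domain of integrals. *)
Definition ic (E : set R) : R -> R[i] := fun t => ((\1_E t : R)%:C)%C.

Lemma icE E t : ic E t = if t \in E then 1 else 0.
Proof. by rewrite /ic indicE; case: (t \in E). Qed.

Lemma cmeas_ic E : measurable E -> cmeasurable (ic E).
Proof. by move=> mE; apply: cmeas_real; exact: measurable_indic. Qed.

Lemma sqc_icM E t z : sqc (ic E t * z) = if t \in E then sqc z else 0.
Proof. by rewrite icE; case: ifP; rewrite ?mul1r ?mul0r ?sqc0. Qed.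

Lemma sqc_ic E t : sqc (ic E t) = \1_E t.
Proof. by rewrite /ic sqc_real indicE; case: (t \in E); rewrite ?expr1n ?expr0n. Qed.

Lemma sqc_ic_le E t : sqc (ic E t) <= 1.
Proof. by rewrite sqc_ic indicE; case: (t \in E). Qed.

Lemma L2_icM E f : measurable E -> L2 f -> L2 (fun t => ic E t * f t).
Proof. by move=> mE; apply: L2Mb (sqc_ic_le E); exact: cmeas_ic. Qed.

Lemma integ_ic E : measurable E -> (mu E < +oo)%E -> integ (\1_E : R -> R).
Proof.
move=> mE Ey; apply/integrableP; split.
  by apply/measurable_EFinP; exact: measurable_indic.
rewrite (eq_integral (fun x => (\1_E x)%:E)); last first.
  by move=> t _ /=; rewrite ger0_norm.
by rewrite integral_indic ?setIT.
Qed.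

Lemma L2_ic E : measurable E -> (mu E < +oo)%E -> L2 (ic E).
Proof.
move=> mE Ey; apply: (@L2_dom _ _ (\1_E)); [exact: cmeas_ic|exact: integ_ic|].
by move=> t; rewrite sqc_ic.
Qed.

Lemma L2_icb E (C : R) k : measurable E -> (mu E < +oo)%E ->
  cmeasurable k -> (forall t, sqc (k t) <= C) -> L2 (fun t => ic E t * k t).
Proof.
move=> mE Ey mk kC; under eq_fun do rewrite mulrC.
by apply: L2Mb mk kC _; exact: L2_ic.
Qed.

Section exponentials.
Variable b : R.

(** The modulations of the Gabor system, all of them periodic of period
    b^-1. *)
Definition ee (m : int) (t : R) : R[i] := cis (2 * pi * m%:~R * b * t).

Lemma eeD m n t : ee (m + n) t = ee m t * ee n t.
Proof. by rewrite /ee -cisD intrD; congr cis; ring. Qed.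
Lemma eeN m t : ee (- m) t = conjc (ee m t).
Proof. by rewrite /ee -cisN mulrNz; congr cis; ring. Qed.
Lemma ee0 t : ee 0 t = 1.
Proof. by rewrite /ee mulr0 !mul0r cis0. Qed.
Lemma sqc_ee m t : sqc (ee m t) = 1.
Proof. exact: sqc_cis. Qed.
Lemma cmeas_ee m : cmeasurable (ee m).
Proof. exact: cmeas_cis. Qed.
Lemma cis_2pi (m : int) : cis (2 * pi * m%:~R) = 1 :> R[i].
Proof.
have H (n : nat) : cis (2 * pi * n%:R) = 1 :> R[i].
  elim: n => [|n IH]; first by rewrite mulr0 cis0.
  rewrite (_ : _ * _ = 2 * pi * n%:R + 2 * pi :> R); last by rewrite -natr1; ring.
  rewrite cisD IH mul1r mulr_natl.
  by apply: eqc; rewrite /= ?cos2pi ?sin2pi.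
case: m => n; first exact: H.
by rewrite NegzE mulrNz mulrN cisN H; apply: eqc; rewrite /= ?oppr0.
Qed.
Lemma ee_period m t : b != 0 -> ee m (t + b^-1) = ee m t.
Proof.
move=> b0; rewrite /ee.
have -> : 2 * pi * m%:~R * b * (t + b^-1) = 2 * pi * m%:~R * b * t + 2 * pi * m%:~R.
  by field.
by rewrite cisD cis_2pi mulr1.
Qed.

Definition trigpoly (p : R -> R[i]) :=
  exists s : seq (R[i] * int), forall t, p t = \sum_(x <- s) x.1 * ee x.2 t.

Lemma trig_cst z : trigpoly (fun=> z).
Proof. by exists [:: (z, 0)] => t; rewrite big_seq1 /= ee0 mulr1. Qed.
Lemma trig_ee m : trigpoly (ee m).
Proof. by exists [:: (1, m)] => t; rewrite big_seq1 /= mul1r. Qed.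
Lemma trigD p q : trigpoly p -> trigpoly q -> trigpoly (fun t => p t + q t).
Proof.
move=> [s ps] [s' qs']; exists (s ++ s') => t.
by rewrite big_cat /= -ps -qs'.
Qed.
Lemma trigM p q : trigpoly p -> trigpoly q -> trigpoly (fun t => p t * q t).
Proof.
move=> [s ps] [s' qs'].
exists [seq (x.1 * y.1, x.2 + y.2) | x <- s, y <- s'] => t.
rewrite big_allpairs_dep ps qs' mulr_suml; apply: eq_bigr => x _.
by rewrite mulr_sumr; apply: eq_bigr => y _ /=; rewrite eeD; ring.
Qed.
Lemma trigZ z p : trigpoly p -> trigpoly (fun t => z * p t).
Proof. exact: (trigM (trig_cst z)). Qed.
Lemma trigB p q : trigpoly p -> trigpoly q -> trigpoly (fun t => p t - q t).
Proof.
move=> pp pq; under eq_fun do rewrite -mulN1r.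
by apply: trigD => //; exact: trigZ.
Qed.
Lemma trigX p n : trigpoly p -> trigpoly (fun t => p t ^+ n).
Proof.
move=> pp; elim: n => [|n IH]; first exact: (trig_cst 1).
by under eq_fun do rewrite exprS; exact: trigM.
Qed.
Lemma trig_eq p q : (forall t, p t = q t) -> trigpoly p -> trigpoly q.
Proof. by move=> pq [s ps]; exists s => t; rewrite -pq. Qed.

Lemma trig_meas p : trigpoly p -> cmeasurable p.
Proof.
move=> [s ps]; rewrite (_ : p = fun t => \sum_(x <- s) x.1 * ee x.2 t).
  by apply: cmeas_sum => x; apply: cmeasM; [exact: cmeas_cst|exact: cmeas_ee].
by apply/funext.
Qed.

Lemma trig_bounded p : trigpoly p -> exists C, forall t, sqc (p t) <= C.
Proof.
move=> [s ps].
have [C HC] : exists C, forall t, sqc (\sum_(x <- s) x.1 * ee x.2 t) <= C.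
  elim: s {ps} => [|x s [C IH]].
    by exists 0 => t; rewrite big_nil sqc0.
  exists (2 * (sqc x.1 + C)) => t; rewrite big_cons.
  by rewrite (le_trans (sqcD_le _ _))// ler_wpM2l// lerD// sqcM sqc_ee mulr1.
by exists C => t; rewrite ps.
Qed.

(** Orthogonality applies to distinct frequencies, so the terms of a
    representation are first collected by frequency. *)
Lemma trig_grouped p : trigpoly p -> exists (s : seq int) (z : int -> R[i]),
  uniq s /\ forall t, p t = \sum_(m <- s) z m * ee m t.
Proof.
move=> [s ps]; exists (undup (map snd s)), (fun m => \sum_(x <- s | x.2 == m) x.1).
split; first exact: undup_uniq.
move=> t; rewrite ps; under [RHS]eq_bigr do rewrite big_mkcond mulr_suml.
rewrite exchange_big /= big_seq [RHS]big_seq; apply: eq_bigr => x xs.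
rewrite (bigD1_seq x.2) ?undup_uniq ?mem_undup ?map_f//= eqxx big1 ?addr0//.
by move=> m /negPf; rewrite eq_sym => ->; rewrite mul0r.
Qed.

Variable al : R.
Hypothesis b0 : 0 < b.
Definition J : set R := [set` `[al, al + b^-1[].

Lemma measJ : measurable J. Proof. exact: measurable_itv. Qed.
Lemma muJ : mu J = b^-1%:E.
Proof.
by rewrite /J lebesgue_measure_itv/= lte_fin ltrDl invr_gt0 b0 -EFinB addrAC subrr add0r.
Qed.
Lemma muJ_fin : (mu J < +oo)%E. Proof. by rewrite muJ ltry. Qed.

(** Over a whole number of oscillations the primitives of cosine and sine take
    equal values at both ends. *)
Lemma integ_J_cos_sin (w : R) (m : int) : w != 0 -> w * b^-1 = 2 * pi * m%:~R ->
  \int[mu]_(t in J) cos (w * t) = 0 /\ \int[mu]_(t in J) sin (w * t) = 0.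
Proof.
move=> w0 wm; have ltJ : al < al + b^-1 by rewrite ltrDl invr_gt0.
have cw : continuous (fun t : R => w * t).
  by move=> t; apply: cvgM; [exact: cvg_cst|exact: cvg_id].
have ccos : continuous (fun t : R => cos (w * t)).
  by move=> t; apply: (continuous_comp (cw t)); exact: continuous_cos.
have csin : continuous (fun t : R => sin (w * t)).
  by move=> t; apply: (continuous_comp (cw t)); exact: continuous_sin.
have per : cis (w * (al + b^-1)) = cis (w * al) :> R[i].
  by rewrite mulrDr cisD wm cis_2pi mulr1.
have FTC (f F : R -> R) : continuous f -> (forall t : R, is_derive t (1 : R) F (f t)) ->
    F (al + b^-1) = F al -> \int[mu]_(t in J) f t = 0.
  move=> cf dF Fe; have cF : continuous F.
    move=> t; apply/differentiable_continuous/derivable1_diffP.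
    exact: ex_derive.
  have := @continuous_FTC2 R f F al (al + b^-1) ltJ.
  rewrite /Rintegral /J integral_itv_bndo_bndc//; last first.
    apply/measurable_EFinP; apply: measurable_funS (continuous_measurable_fun cf) => //.
  move=> ->//; first by rewrite Fe subee.
  - exact: continuous_subspaceT.
  - split.
    + by move=> t _; exact: ex_derive.
    + by apply: cvg_at_right_filter; exact: cF.
    + by apply: cvg_at_left_filter; exact: cF.
  - by move=> t _; rewrite derive1E; exact: derive_val.
split.
- apply: (FTC _ (fun t => w^-1 * sin (w * t))) => //.
  + move=> t; apply: is_derive_eq; rewrite !scaler1 /GRing.scale /=.
    by field.
  + by have := congr1 (@complex.Im R) per; rewrite /= => ->.
- apply: (FTC _ (fun t => - w^-1 * cos (w * t))) => //.
  + move=> t; apply: is_derive_eq; rewrite !scaler1 /GRing.scale /=.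
    by field.
  + by have := congr1 (@complex.Re R) per; rewrite /= => ->.
Qed.

End exponentials.
End Trig.

(** * Bessel's inequality and Parseval's formula on one period *)

Section Orthogonality.
Context {R : realType}.
Local Notation mu := (@lebesgue_measure R).
Local Notation mfun := (measurable_fun [set: R]).
Variables (b al : R).
Hypothesis b0 : 0 < b.
Local Notation J := (J b al).
Local Notation ee := (ee b).

Lemma integ_J_bounded (f : R -> R) : mfun f -> (forall t, `|f t| <= 1) ->
  mu.-integrable J (EFin \o f).
Proof.
move=> mf f1; apply: measurable_bounded_integrable.
- exact: measJ.
- exact: muJ_fin.
- exact: measurable_funS mf.
- exists 1; split=> // x x1 y _ /=; exact: le_trans (f1 y) (ltW x1).
Qed.

(** Cutting the exponentials to one period makes them square integrable on the
    line; they are then orthogonal. *)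
Definition ce (z : R[i]) (m : int) : R -> R[i] := fun t => ic J t * (z * ee m t).

Lemma L2_ce z m : L2 (ce z m).
Proof.
apply: (@L2_icb _ _ (sqc z)); [exact: measJ|exact: muJ_fin| |].
  by apply: cmeasM; [exact: cmeas_cst|exact: cmeas_ee].
by move=> t; rewrite sqcM sqc_ee mulr1.
Qed.

Lemma dot_ce z w m n : dot (ce z m) (ce w n) = if m == n then b^-1 * dotc z w else 0.
Proof.
pose om := 2 * pi * (m - n)%:~R * b.
pose u := z * conjc w.
have -> : dot (ce z m) (ce w n) =
    \int[mu]_t ((fun t => complex.Re u * cos (om * t) + (- complex.Im u) * sin (om * t)) \_ J) t.
  apply: eq_Rintegral => t _; rewrite patchE /ce icE; case: ifPn => _; last by rewrite !mul0r dotc0l.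
  rewrite !mul1r -Re_mulJ.
  have -> : z * ee m t * conjc (w * ee n t) = u * ee (m - n) t.
    have -> : conjc (w * ee n t) = conjc w * conjc (ee n t) by apply: eqc; rewrite !cE; ring.
    by rewrite eeD eeN /u; ring.
  by rewrite cReM /ee /cis /=; rewrite /om; ring.
rewrite -Rintegral_mkcond.
have mom : mfun (fun t => om * t) by apply: mfunM => //; exact: measurable_cst.
have mc : mfun (fun t => cos (om * t)).
  apply: measurableT_comp mom; apply: continuous_measurable_fun; exact: continuous_cos.
have ms : mfun (fun t => sin (om * t)).
  apply: measurableT_comp mom; apply: continuous_measurable_fun; exact: continuous_sin.
have icos := integ_J_bounded mc (fun t => cos_max _).
have isin := integ_J_bounded ms (fun t => sin_max _).
have mJ : measurable (J : set (measurableTypeR R)) := measJ b al.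
rewrite RintegralD//; last 2 first.
- have := integrableZl mJ (complex.Re u) icos.
  by apply: eq_integrable => // t _ /=; rewrite EFinM.
- have := integrableZl mJ (- complex.Im u) isin.
  by apply: eq_integrable => // t _ /=; rewrite EFinM.
rewrite !RintegralZl//.
case: eqP => [mn|/eqP mn].
  have om0 : om = 0 by rewrite /om mn subrr mulr0 mul0r.
  under eq_Rintegral do rewrite om0 mul0r cos0.
  under [X in _ + _ * X]eq_Rintegral do rewrite om0 mul0r sin0.
  have -> : \int[mu]_(_ in J) (1 : R) = b^-1.
    by rewrite Rintegral_cst// mul1r; exact: (congr1 fine (muJ al b0)).
  rewrite Rintegral_cst// mul0r mulr0 addr0 mulrC.
  by rewrite Re_mulJ.
have [||-> ->] := @integ_J_cos_sin _ b al b0 om (m - n).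
- by rewrite /om !mulf_neq0 ?pnatr_eq0 ?intr_eq0 ?subr_eq0 ?(gt_eqF (pi_gt0 _)) ?(gt_eqF b0).
- by rewrite /om mulfK ?gt_eqF.
by rewrite !mulr0 addr0.
Qed.

Lemma nrm_trig (s : seq int) (z : int -> R[i]) : uniq s ->
  nrm (fun t => \sum_(m <- s) ce (z m) m t) = \sum_(m <- s) b^-1 * sqc (z m).
Proof.
move=> us; rewrite /nrm dot_suml; [|by move=> m; exact: L2_ce|]; last first.
  by apply: L2_sum => m _; exact: L2_ce.
rewrite big_seq [RHS]big_seq; apply: eq_bigr => m ms.
rewrite dotC dot_suml; [|by move=> n; exact: L2_ce|exact: L2_ce].
rewrite (bigD1_seq m)//= dot_ce eqxx big1 ?addr0// => n nm.
by rewrite dot_ce (negPf nm).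
Qed.

Lemma dot_ce_inner F z m : L2 F -> (forall t, ~ J t -> F t = 0) ->
  dot F (ce z m) = dotc (inner F (ee m)) z.
Proof.
move=> F2 F0.
have aux k : dot F (fun t => k * ee m t) = dot F (ce k m).
  apply: eq_Rintegral => t _; rewrite /ce icE; case: ifPn => [_|tJ]; first by rewrite mul1r.
  by rewrite F0 ?dotc0l//; apply/negP; rewrite notin_setE in tJ; exact/negP.
have -> : inner F (ee m) = Complex (dot F (ce 1 m)) (dot F (ce 'i%C m)).
  rewrite inner_dot -!aux; congr Complex.
  by congr dot; apply/funext => t; rewrite mul1r.
have E1 := dotZr (complex.Re z) (L2_ce 1 m) F2.
have E2 := dotZr (complex.Im z) (L2_ce 'i%C m) F2.
rewrite /dotc /= [X in X + _]mulrC [X in _ + X]mulrC -E1 -E2 -dotDr//;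
  try by apply: L2Z; exact: L2_ce.
congr dot; apply/funext => t; rewrite /ce.
by rewrite {1}(complexE z); ring.
Qed.

(** Completing the square in each coefficient: the distance to a trigonometric
    polynomial splits into the distance to the partial Fourier sum and a
    nonnegative error of the coefficients. This gives both Bessel's inequality
    and the optimality behind Parseval's formula. *)
Lemma nrm_sub_trig F (s : seq int) (z : int -> R[i]) : uniq s -> L2 F ->
  (forall t, ~ J t -> F t = 0) ->
  nrm (fun t => F t - \sum_(m <- s) ce (z m) m t) =
  nrm F - b * \sum_(m <- s) sqc (inner F (ee m))
  + b^-1 * \sum_(m <- s) sqc (z m - b%:C%C * inner F (ee m)).
Proof.
move=> us F2 F0; have S2 : L2 (fun t => \sum_(m <- s) ce (z m) m t).
  by apply: L2_sum => m _; exact: L2_ce.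
rewrite nrmB// nrm_trig// dotC dot_suml//; last by move=> m; exact: L2_ce.
rewrite -!addrA; congr (_ + _).
rewrite !mulr_sumr -sumrN -[in RHS]sumrN -!big_split /=; apply: eq_bigr => m _.
rewrite dotC dot_ce_inner//; case: (inner F (ee m)) (z m) => [c1 c2] [z1 z2].
by rewrite /sqc /dotc !cE /=; field; rewrite gt_eqF.
Qed.

Lemma bessel F (s : seq int) : uniq s -> L2 F -> (forall t, ~ J t -> F t = 0) ->
  \sum_(m <- s) sqc (inner F (ee m)) <= b^-1 * nrm F.
Proof.
move=> us F2 F0.
have := nrm_sub_trig (fun m => b%:C%C * inner F (ee m)) us F2 F0.
rewrite [X in _ + b^-1 * X]big1; last by move=> m _; rewrite subrr sqc0.
rewrite mulr0 addr0 => H.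
have := nrm_ge0 (fun t => F t - \sum_(m <- s) ce (b%:C%C * inner F (ee m)) m t).
by rewrite H subr_ge0 ler_pdivlMl.
Qed.

Definition approximable (F : R -> R[i]) :=
  forall e, 0 < e -> exists2 p, trigpoly b p & nrm (fun t => ic J t * (F t - p t)) < e.

(** One inequality is Bessel's. For the other, a close trigonometric
    polynomial is not closer than the Fourier sum over the same frequencies,
    so finite partial sums come arbitrarily near to the norm. *)
Lemma parseval F : L2 F -> (forall t, ~ J t -> F t = 0) -> approximable F ->
  (\esum_(m in [set: int]) (sqc (inner F (ee m)))%:E = (b^-1 * nrm F)%:E)%E.
Proof.
move=> F2 F0 apF; apply/eqP; rewrite eq_le; apply/andP; split.
  apply: ge_ereal_sup => _ [X [finX _] <-].
  rewrite fsbig_finite//= sumEFin lee_fin bessel//.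
  exact: fset_uniq.
apply/lee_addgt0Pr => e e0.
have be : 0 < e * b by rewrite mulr_gt0.
have [p /trig_grouped [s [z [us ps]]] pe] := apF _ be.
have /(le_lt_trans _) := pe.
have -> : (fun t => ic J t * (F t - p t)) = (fun t => F t - \sum_(m <- s) ce (z m) m t).
  apply/funext => t; rewrite ps /ce -mulr_sumr mulrBr; congr (_ - _).
  rewrite icE; case: ifPn; first by rewrite mul1r.
  by rewrite notin_setE => /F0 ->; rewrite mulr0.
rewrite nrm_sub_trig// => /(_ (nrm F - b * \sum_(m <- s) sqc (inner F (ee m)))).
have H0 : 0 <= b^-1 * \sum_(m <- s) sqc (z m - b%:C%C * inner F (ee m)).
  by rewrite mulr_ge0 ?invr_ge0 ?(ltW b0)// sumr_ge0// => m _; exact: sqc_ge0.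
rewrite lerDl => /(_ H0) H.
apply: (@le_trans _ _ ((\sum_(m <- s) sqc (inner F (ee m)))%:E + e%:E)%E).
  rewrite -EFinD lee_fin ler_pdivrMl// mulrDr -lerBlDl [b * e]mulrC; exact: ltW.
apply: leeD => //; apply: esum_ge.
exists [set` s]; first by split => //; exact: finite_seq.
rewrite fsbig_seq// fsumEFin//; exact: finite_seq.
Qed.

End Orthogonality.

(** * Density of trigonometric polynomials *)

Section Kuhn.
Context {R : realType}.
Implicit Types (x u : R).

Lemma bernoulli_ge u (n : nat) : 0 <= u <= 1 -> 1 - n%:R * u <= (1 - u) ^+ n.
Proof.
move=> /andP[u0 u1]; elim: n => [|n IH]; first by rewrite mul0r subr0 expr0.
rewrite exprS; apply: le_trans (_ : (1 - u) * (1 - n%:R * u) <= _); last first.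
  by rewrite ler_wpM2l// subr_ge0.
rewrite -natr1 -subr_ge0.
rewrite (_ : _ - _ = n%:R * u * u); last by ring.
by rewrite !mulr_ge0.
Qed.

(** Multiply (1 - u)^n by n u <= (1 + u)^n and use 1 - u^2 <= 1. *)
Lemma bernoulli_le u (n : nat) : 0 <= u <= 1 -> (1 - u) ^+ n * (n%:R * u) <= 1.
Proof.
move=> /andP[u0 u1].
have v0 : 0 <= 1 - u by rewrite subr_ge0.
have H : n%:R * u <= (1 + u) ^+ n.
  elim: n => [|n IH]; first by rewrite mul0r expr0.
  have H1 : 1 <= (1 + u) ^+ n by rewrite exprn_ege1// lerDl.
  rewrite exprS mulrDl mul1r -natr1 mulrDl mul1r lerD// ler_peMr//.
apply: (@le_trans _ _ ((1 - u) ^+ n * (1 + u) ^+ n)).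
  by rewrite ler_wpM2l// exprn_ge0.
rewrite -exprMn exprn_ile1//; first by rewrite mulr_ge0// addr_ge0.
rewrite (_ : _ * _ = 1 - u * u); last by ring.
by rewrite gerBl mulr_ge0.
Qed.

(** Kuhn's polynomials from his proof of the Weierstrass theorem: on [0, 1]
    they tend to 1 below 1/2 and to 0 above it, so that a trigonometric
    polynomial with values in [0, 1] yields approximations of the indicator of
    a sublevel set by trigonometric polynomials. *)
Definition kuhn (n : nat) x := (1 - x ^+ n) ^+ (2 ^ n).

Lemma kuhn_itv n x : 0 <= x <= 1 -> 0 <= kuhn n x <= 1.
Proof.
move=> /andP[x0 x1]; have xn1 : x ^+ n <= 1 by exact: exprn_ile1.
have xn0 : 0 <= x ^+ n by exact: exprn_ge0.
by rewrite /kuhn exprn_ge0 ?subr_ge0//= exprn_ile1 ?subr_ge0// gerBl.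
Qed.

(** Bernoulli's inequality bounds kuhn n x below by 1 - (2x)^n. *)
Lemma cvg_kuhn_lt x : 0 <= x -> x < 2^-1 -> kuhn ^~ x @ \oo --> (1 : R).
Proof.
move=> x0 x2; have x1 : x <= 1 by lra.
apply: (@squeeze_cvgr _ _ _ _ (fun n => 1 - (2 * x) ^+ n) (cst 1)).
- apply: nearW => n; have xn1 : x ^+ n <= 1 by exact: exprn_ile1.
  have xn0 : 0 <= x ^+ n by exact: exprn_ge0.
  rewrite (andP (kuhn_itv n _)).2 ?x0 ?x1// andbT.
  by rewrite exprMn -natrX bernoulli_ge// xn0.
- rewrite -[X in _ --> X](subr0 1); apply: cvgB; first exact: cvg_cst.
  by apply: cvg_expr; rewrite ger0_norm; lra.
- exact: cvg_cst.
Qed.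

(** The second form of Bernoulli's inequality bounds kuhn n x above by
    (2x)^-n. *)
Lemma cvg_kuhn_gt x : x <= 1 -> 2^-1 < x -> kuhn ^~ x @ \oo --> (0 : R).
Proof.
move=> x1 x2; have x0 : 0 <= x by lra.
apply: (@squeeze_cvgr _ _ _ _ (cst 0) (fun n => (2 * x)^-1 ^+ n)).
- apply: nearW => n; have xn1 : x ^+ n <= 1 by exact: exprn_ile1.
  have xn0 : 0 <= x ^+ n by exact: exprn_ge0.
  rewrite (andP (kuhn_itv n _)).1 ?x0 ?x1//=.
  have xp : 0 < (2 * x) ^+ n by rewrite exprn_gt0//; lra.
  by rewrite exprVn -[leRHS]mul1r ler_pdivlMr// exprMn -natrX bernoulli_le// xn0.
- exact: cvg_cst.
- apply: cvg_expr; rewrite ger0_norm ?invr_ge0; last lra.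
  by rewrite invf_lt1; lra.
Qed.

End Kuhn.

Section Density.
Context {R : realType}.
Local Notation mu := (@lebesgue_measure R).
Local Notation integ F := (mu.-integrable [set: R] (EFin \o F)).
Variables (b al : R).
Hypothesis b0 : 0 < b.
Local Notation J := (J b al).
Local Notation ee := (ee b).
Local Notation approximable := (approximable b al).

Lemma ae_notin (s : seq R) : \forall t \ae mu, t \notin s.
Proof.
exists [set` s]; split.
- by exact: countable_measurable (finite_set_countable (finite_seq s)).
- by apply: countable_lebesgue_measure0; exact: finite_set_countable (finite_seq s).
- by move=> t /= /negP; rewrite negbK.
Qed.

Lemma L2_J (C : R) k : cmeasurable k -> (forall t, sqc (k t) <= C) ->
  L2 (fun t => ic J t * k t).
Proof. by apply: L2_icb; [exact: measJ|exact: muJ_fin]. Qed.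

Lemma L2_Jtrig p : trigpoly b p -> L2 (fun t => ic J t * p t).
Proof.
move=> tp; have [C pC] := trig_bounded tp.
by apply: L2_J pC; exact: trig_meas tp.
Qed.

Lemma apx_trig p : trigpoly b p -> approximable p.
Proof.
move=> tp e e0; exists p => //.
rewrite (_ : (fun t => _) = fun=> 0); last by apply/funext => t; rewrite subrr mulr0.
by rewrite /nrm dot0l.
Qed.

Lemma L2_Jsub F p : L2 (fun t => ic J t * F t) -> trigpoly b p ->
  L2 (fun t => ic J t * (F t - p t)).
Proof.
move=> F2 tp; under eq_fun do rewrite mulrBr.
by apply: L2B => //; exact: L2_Jtrig.
Qed.

Lemma apxD F G : L2 (fun t => ic J t * F t) -> L2 (fun t => ic J t * G t) ->
  approximable F -> approximable G -> approximable (fun t => F t + G t).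
Proof.
move=> F2 G2 aF aG e e0; have e4 : 0 < e / 4 by rewrite divr_gt0.
have [p tp pe] := aF _ e4; have [q tq qe] := aG _ e4.
exists (fun t => p t + q t); first exact: trigD.
rewrite (_ : (fun t => _) = (fun t => ic J t * (F t - p t) + ic J t * (G t - q t))).
  apply: le_lt_trans (nrmD_le (L2_Jsub F2 tp) (L2_Jsub G2 tq)) _; lra.
by apply/funext => t; ring.
Qed.

Lemma apxZ z F : L2 (fun t => ic J t * F t) ->
  approximable F -> approximable (fun t => z * F t).
Proof.
move=> F2 aF e e0; have sz := sqc_ge0 z.
have e1 : 0 < e / (sqc z + 1) by rewrite divr_gt0//; lra.
have [p tp pe] := aF _ e1; exists (fun t => z * p t); first exact: trigZ.
rewrite (_ : (fun t => _) = (fun t => z * (ic J t * (F t - p t)))); last first.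
  by apply/funext => t; ring.
apply: (@le_lt_trans _ _ (sqc z * nrm (fun t => ic J t * (F t - p t)))).
  by apply: nrmMb => //; exact: L2_Jsub.
move: pe; rewrite ltr_pdivlMr; last by lra.
apply: le_lt_trans; rewrite mulrC ler_wpM2l//; first exact: nrm_ge0.
by lra.
Qed.

(** Dominated limits of approximable functions are approximable; the passages
    from polynomials to rays, to countable unions and to nonnegative functions
    are of this kind. *)
Lemma apx_lim (Fn : nat -> R -> R[i]) F (G : R -> R) :
  (forall n, cmeasurable (Fn n)) -> cmeasurable F ->
  (forall n, L2 (fun t => ic J t * Fn n t)) -> L2 (fun t => ic J t * F t) ->
  integ G -> (forall n t, J t -> sqc (Fn n t - F t) <= G t) -> (forall t, 0 <= G t) ->
  (\forall t \ae mu, J t -> (fun n => sqc (Fn n t - F t)) @ \oo --> (0 : R)) ->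
  (forall n, approximable (Fn n)) -> approximable F.
Proof.
move=> mFn mF Fn2 F2 iG FG G0 cF aF e e0.
have D2 n : L2 (fun t => ic J t * (Fn n t - F t)).
  by under eq_fun do rewrite mulrBr; exact: L2B.
pose fn n x := (sqc (ic J x * (Fn n x - F x)))%:E.
have mfn n : measurable_fun [set: R] (fn n).
  by apply/measurable_EFinP; apply: measurable_sqc; exact: L2_meas.
have c1 : \forall t \ae mu, setT t -> fn ^~ t @ \oo --> (0%:E : \bar R).
  move: cF; apply: ae_imp => t ct _.
  apply: cvg_EFin; first by exact: nearW.
  rewrite /comp /fn /=; under eq_fun do rewrite sqc_icM.
  case: (boolP (t \in J)) => [|_]; last exact: cvg_cst.
  by rewrite inE => /ct.
have c2 : \forall t \ae mu, forall n, setT t -> (`|fn n t| <= (EFin \o G) t)%E.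
  apply: ae_all => t n _; rewrite /fn /= ger0_norm ?sqc_ge0// lee_fin.
  by rewrite sqc_icM; case: ifPn => [|_//]; rewrite inE; exact: FG.
have [_ _ dc] := @dominated_convergence _ _ R mu setT measurableT fn (fun=> 0%E)
  (EFin \o G) mfn (measurable_cst _) c1 iG c2.
have e4 : 0 < e / 4 by rewrite divr_gt0.
have [n en] : exists n, nrm (fun t => ic J t * (Fn n t - F t)) < e / 4.
  move: dc; rewrite integral0 => /fine_cvg /cvgrPdist_lt /(_ _ e4) [n _ /(_ n (leqnn n))].
  rewrite /= sub0r normrN => en; exists n; apply: le_lt_trans en.
  by rewrite /nrm /dot /Rintegral ler_norm.
have [p tp pe] := aF n _ e4; exists p => //.
rewrite (_ : (fun t => _) = (fun t => - (ic J t * (Fn n t - F t)) + ic J t * (Fn n t - p t))).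
  apply: le_lt_trans (nrmD_le (L2N (D2 n)) (L2_Jsub (Fn2 n) tp)) _.
  rewrite (_ : nrm (fun t => - _) = nrm (fun t => ic J t * (Fn n t - F t))); first lra.
  by apply: eq_Rintegral => t _; rewrite -!/(sqc _) sqcN.
by apply/funext => t; ring.
Qed.

(** A sine rescaled to [0, 1] that lies below 1/2 exactly on the half periods
    that follow tau + k b^-1. *)
Definition unit_sine (tau t : R) := (1 - sin (2 * pi * b * (t - tau))) / 2.

Lemma unit_sine_itv tau t : 0 <= unit_sine tau t <= 1.
Proof.
rewrite /unit_sine; have := sin_geN1 (2 * pi * b * (t - tau)).
by have := sin_le1 (2 * pi * b * (t - tau)); lra.
Qed.

Lemma trig_unit_sine tau : trigpoly b (fun t => ((unit_sine tau t)%:C)%C).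
Proof.
pose z : R[i] := cis (- (2 * pi * b * tau)).
pose k : R[i] := Complex 0 (2^-1).
apply: (@trig_eq _ b (fun t => (2^-1)%:C%C * (1 + k *
   (z * ee 1 t - conjc z * ee (-1) t)) )).
  move=> t; have -> : z * ee 1 t = cis (2 * pi * b * (t - tau)).
    by rewrite /z /ee -cisD; congr cis; rewrite mulr1; ring.
  have -> : conjc z * ee (-1) t = conjc (cis (2 * pi * b * (t - tau))).
    rewrite /z /ee -!cisN -cisD; congr cis; rewrite mulrNz; ring.
  by apply: eqc; rewrite !cE /= /unit_sine; field.
apply: trigZ; apply: trigD; first exact: trig_cst.
apply: trigZ; apply: trigB; apply: trigZ; exact: trig_ee.
Qed.

(** Trigonometric polynomials tending to the indicator of the half period that
    starts at tau, extended periodically. *)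
Definition half_arc n tau t := kuhn n (unit_sine tau t).

Lemma half_arc_itv n tau t : 0 <= half_arc n tau t <= 1.
Proof. exact: kuhn_itv (unit_sine_itv tau t). Qed.

Lemma trig_half_arc n tau : trigpoly b (fun t => ((half_arc n tau t)%:C)%C).
Proof.
apply: (@trig_eq _ b (fun t => (1 - ((unit_sine tau t)%:C)%C ^+ n) ^+ (2 ^ n))).
  by move=> t; rewrite /half_arc /kuhn rmorphXn /= rmorphB rmorphXn /=.
by apply: trigX; apply: trigB; [exact: trig_cst|apply: trigX; exact: trig_unit_sine].
Qed.

Lemma cvg_arc_pos tau t : 0 < sin (2 * pi * b * (t - tau)) ->
  (fun n => half_arc n tau t) @ \oo --> (1 : R).
Proof.
move=> s0; apply: cvg_kuhn_lt; first by have /andP[] := unit_sine_itv tau t.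
by rewrite /unit_sine; lra.
Qed.

Lemma cvg_arc_neg tau t : sin (2 * pi * b * (t - tau)) < 0 ->
  (fun n => half_arc n tau t) @ \oo --> (0 : R).
Proof.
move=> s0; apply: cvg_kuhn_gt; first by have /andP[] := unit_sine_itv tau t.
by rewrite /unit_sine; lra.
Qed.

Lemma sin_arc_gt0 (d : R) : 0 < d < b^-1 / 2 -> 0 < sin (2 * pi * b * d).
Proof.
move=> /andP[d0 d1]; apply: sin_gt0_pi; have pi0 := pi_gt0 R.
rewrite !mulr_gt0//=.
rewrite (_ : 2 * pi * b * d = pi * (d * (2 * b))); last by ring.
rewrite -[ltRHS]mulr1 ltr_pM2l// -ltr_pdivlMr ?mulr_gt0// div1r invfM.
by rewrite mulrC.
Qed.

Lemma sin_arc_lt0 (d : R) : - (b^-1 / 2) < d < 0 -> sin (2 * pi * b * d) < 0.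
Proof.
move=> /andP[d0 d1]; rewrite -oppr_gt0 -sinN -mulrN.
by apply: sin_arc_gt0; rewrite oppr_gt0 d1 ltrNl.
Qed.

Lemma sin_arc_half (d : R) : sin (2 * pi * b * (d + b^-1 / 2)) = - sin (2 * pi * b * d).
Proof.
rewrite (_ : _ * _ = 2 * pi * b * d + pi); first by rewrite sinDpi.
by field; rewrite gt_eqF.
Qed.

Lemma cvg_arc_right tau t : tau < t < tau + b^-1 / 2 ->
  (fun n => half_arc n tau t) @ \oo --> (1 : R).
Proof. by move=> H; apply/cvg_arc_pos/sin_arc_gt0; lra. Qed.

Lemma cvg_arc_left tau t : tau - b^-1 / 2 < t < tau ->
  (fun n => half_arc n tau t) @ \oo --> (0 : R).
Proof. by move=> H; apply/cvg_arc_neg/sin_arc_lt0; lra. Qed.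

Lemma cvg_arc_far tau t : tau + b^-1 / 2 < t < tau + b^-1 ->
  (fun n => half_arc n tau t) @ \oo --> (0 : R).
Proof.
move=> H; apply/cvg_arc_neg.
rewrite (_ : t - tau = (t - tau - b^-1 / 2) + b^-1 / 2); last by ring.
by rewrite sin_arc_half oppr_lt0; apply: sin_arc_gt0; lra.
Qed.

Lemma cvg_arc_farleft tau t : tau - b^-1 < t < tau - b^-1 / 2 ->
  (fun n => half_arc n tau t) @ \oo --> (1 : R).
Proof.
move=> H; apply/cvg_arc_pos.
rewrite -[ltRHS]opprK -sin_arc_half oppr_gt0; apply: sin_arc_lt0; lra.
Qed.

Lemma apx_real_lim (q : nat -> R -> R) (E : set R) : measurable E ->
  (forall n, trigpoly b (fun t => (q n t)%:C%C)) ->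
  (forall n t, 0 <= q n t <= 1) ->
  (\forall t \ae mu, J t -> (fun n => q n t) @ \oo --> (\1_E t : R)) ->
  approximable (ic E).
Proof.
move=> mE tq q01 qE.
have E01 t : 0 <= (\1_E t : R) <= 1 by rewrite indicE; case: (t \in E); rewrite /= ?lexx ler01.
apply: (@apx_lim (fun n t => (q n t)%:C%C) _ (\1_J)).
- by move=> n; exact: trig_meas (tq n).
- exact: cmeas_ic.
- by move=> n; exact: L2_Jtrig (tq n).
- by apply: L2_J (sqc_ic_le E); exact: cmeas_ic.
- by apply: integ_ic; [exact: measJ|exact: muJ_fin].
- move=> n t Jt; rewrite indicE mem_set//= /ic -rmorphB sqc_real.
  have /andP[q0 q1] := q01 n t; have /andP[i0 i1] := E01 t.
  have : `|q n t - \1_E t| <= 1 by rewrite ler_norml; apply/andP; split; lra.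
  by rewrite -real_normK ?num_real// => qi; rewrite exprn_ile1.
- by move=> t; rewrite indicE.
- move: qE; apply: ae_imp => t qE Jt.
  have H : (fun n => q n t - \1_E t) @ \oo --> (\1_E t - \1_E t : R).
    by apply: cvgB; [exact: qE|exact: cvg_cst].
  have E2 : (fun n => sqc ((q n t)%:C%C - ic E t)) =
      (fun n => (q n t - \1_E t) * (q n t - \1_E t)).
    by apply/funext => n; rewrite /ic -rmorphB sqc_real expr2.
  by rewrite E2; have := cvgM H H; rewrite subrr mulr0; apply.
- by move=> n; exact: apx_trig (tq n).
Qed.

Lemma eq_apx F G : (forall t, J t -> F t = G t) -> approximable F -> approximable G.
Proof.
move=> FG aF e e0; have [p tp pe] := aF _ e0; exists p => //.
rewrite (_ : (fun t => _) = (fun t => ic J t * (F t - p t))) //.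
apply/funext => t; rewrite icE; case: ifPn => [|_]; last by rewrite !mul0r.
by rewrite inE => /FG ->.
Qed.

(** On the period starting at al, an interval that shares an end with the
    period is a difference of two half arcs. If x lies in the first half, the
    points before x are those in the arc from al but not in the arc from x,
    and the ray is the complement; if x lies in the second half, the points
    after x are those in the arc from x but not in the arc from al. The
    finitely many jump points are excluded as a null set. *)
Lemma apx_ray x : approximable (ic `]x, +oo[).
Proof.
have [xal|xal] := ltP x al.
  apply: (@eq_apx (fun=> 1)); last by apply: apx_trig; exact: trig_cst.
  move=> t; rewrite /J /= in_itv /= => /andP[alt _].
  by rewrite icE mem_set//= in_itv/= (lt_le_trans xal).
have [xbe|xbe] := leP (al + b^-1) x.
  apply: (@eq_apx (fun=> 0)); last by apply: apx_trig; exact: trig_cst.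
  move=> t; rewrite /J /= in_itv /= => /andP[_ tb].
  by rewrite icE memNset//= in_itv/= andbT; apply/negP; rewrite -leNgt; lra.
have h0 : 0 < b^-1 by rewrite invr_gt0.
have mE : measurable (`]x, +oo[%classic : set R) by exact: measurable_itv.
have aeN := ae_notin [:: x; x + b^-1 / 2; x - b^-1 / 2; al; al + b^-1 / 2].
have indE t : (\1_(`]x, +oo[%classic : set R) t : R) = (if x < t then 1 else 0).
  rewrite indicE (_ : (t \in _) = (x < t)); first by case: ifP.
  by apply/idP/idP; rewrite inE /= in_itv /= andbT.
have trig1 q : trigpoly b (fun t => (q t)%:C%C) -> trigpoly b (fun t => (1 - q t)%:C%C).
  move=> tq; apply: (@trig_eq _ b (fun t => 1 - (q t)%:C%C)).
    by move=> t; rewrite rmorphB.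
  by apply: trigB => //; exact: trig_cst.
have trig2 q q' : trigpoly b (fun t => (q t)%:C%C) -> trigpoly b (fun t => (q' t)%:C%C) ->
    trigpoly b (fun t => (q t * q' t)%:C%C).
  move=> tq tq'; apply: (@trig_eq _ b (fun t => (q t)%:C%C * (q' t)%:C%C)).
    by move=> t; rewrite rmorphM.
  exact: trigM.
have P01 (u v : R) : 0 <= u <= 1 -> 0 <= v <= 1 -> 0 <= u * (1 - v) <= 1.
  move=> /andP[u0 u1] /andP[v0 v1].
  by rewrite mulr_ge0 ?subr_ge0//= mulr_ile1 ?subr_ge0// lerBlDl lerDr.
have N01 (u : R) : 0 <= u <= 1 -> 0 <= 1 - u <= 1 by move=> H; lra.
have [xm|xm] := leP x (al + b^-1 / 2).
- apply: (@apx_real_lim (fun n t => 1 - half_arc n al t * (1 - half_arc n x t))) => //.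
  + by move=> n; apply/trig1/trig2; [|apply: trig1]; exact: trig_half_arc.
  + by move=> n t; apply/N01/P01; exact: half_arc_itv.
  move: aeN; apply: ae_imp => t; rewrite !inE !negb_or => /and5P[t1 t2 t3 t4 t5].
  rewrite /J /= in_itv /= => /andP[alt tal]; rewrite indE.
  have [xt|tx] := ltP x t; last first.
    have {}tx : t < x by rewrite lt_neqAle t1.
    have {}alt : al < t by rewrite lt_neqAle eq_sym t4.
    have c1 := @cvg_arc_right al t; have c2 := @cvg_arc_left x t.
    have := cvgB (cvg_cst (1 : R)) (cvgM (c1 _) (cvgB (cvg_cst (1 : R)) (c2 _))).
    rewrite subr0 mulr1 subrr; apply; lra.
  have [tm|tm] := ltP t (x + b^-1 / 2).
    have c2 := @cvg_arc_right x t.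
    have [c1|c1] : (fun n => half_arc n al t) @ \oo --> (1 : R) \/
                   (fun n => half_arc n al t) @ \oo --> (0 : R).
    - have [?|?] := ltP t (al + b^-1 / 2); first by left; apply: cvg_arc_right; lra.
      by right; apply: cvg_arc_far; rewrite tal andbT lt_neqAle eq_sym t5.
    + have := cvgB (cvg_cst (1 : R)) (cvgM c1 (cvgB (cvg_cst (1 : R)) (c2 _))).
      by rewrite subrr mulr0 subr0; apply; lra.
    + have := cvgB (cvg_cst (1 : R)) (cvgM c1 (cvgB (cvg_cst (1 : R)) (c2 _))).
      by rewrite subrr mulr0 subr0; apply; lra.
  have {}tm : x + b^-1 / 2 < t by rewrite lt_neqAle eq_sym t2.
  have c1 := @cvg_arc_far al t; have c2 := @cvg_arc_far x t.
  have := cvgB (cvg_cst (1 : R)) (cvgM (c1 _) (cvgB (cvg_cst (1 : R)) (c2 _))).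
  by rewrite mul0r subr0; apply; lra.
- apply: (@apx_real_lim (fun n t => half_arc n x t * (1 - half_arc n al t))) => //.
  + by move=> n; apply/trig2/trig1; exact: trig_half_arc.
  + by move=> n t; apply/P01; exact: half_arc_itv.
  move: aeN; apply: ae_imp => t; rewrite !inE !negb_or => /and5P[t1 t2 t3 t4 t5].
  rewrite /J /= in_itv /= => /andP[alt tal]; rewrite indE.
  have [xt|tx] := ltP x t.
    have c1 := @cvg_arc_right x t; have c2 := @cvg_arc_far al t.
    have := cvgM (c1 _) (cvgB (cvg_cst (1 : R)) (c2 _)).
    by rewrite subr0 mulr1; apply; lra.
  have {}tx : t < x by rewrite lt_neqAle t1.
  have {}alt : al < t by rewrite lt_neqAle eq_sym t4.
  have [tm|tm] := leP t (x - b^-1 / 2).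
    have {}tm : t < x - b^-1 / 2 by rewrite lt_neqAle t3.
    have c2 := @cvg_arc_right al t.
    have c1 : (fun n => half_arc n x t) @ \oo --> (1 : R).
      by apply: cvg_arc_farleft; lra.
    have := cvgM c1 (cvgB (cvg_cst (1 : R)) (c2 _)).
    by rewrite subrr mulr0; apply; lra.
  have c1 := @cvg_arc_left x t.
  have [c2|c2] : (fun n => half_arc n al t) @ \oo --> (1 : R) \/
                   (fun n => half_arc n al t) @ \oo --> (0 : R).
  - have [?|?] := ltP t (al + b^-1 / 2); first by left; apply: cvg_arc_right; lra.
    by right; apply: cvg_arc_far; rewrite tal andbT lt_neqAle eq_sym t5.
  + have := cvgM (c1 _) (cvgB (cvg_cst (1 : R)) c2).
    by rewrite mul0r; apply; lra.
  + have := cvgM (c1 _) (cvgB (cvg_cst (1 : R)) c2).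
    by rewrite mul0r; apply; lra.
Qed.

End Density.

Import HBNNSimple.

Section DensityL2.
Context {R : realType}.
Local Notation mfun := (measurable_fun [set: R]).
Variables (b al : R).
Hypothesis b0 : 0 < b.
Local Notation J := (J b al).
Local Notation approximable := (approximable b al).

Lemma L2_Jic E : measurable E -> L2 (fun t => ic J t * ic E t).
Proof. by move=> mE; apply: (L2_J al b0) (sqc_ic_le E); exact: cmeas_ic. Qed.

Lemma apx_setC (S : set R) : measurable S -> approximable (ic S) -> approximable (ic (~` S)).
Proof.
move=> mS aS; apply: (@eq_apx _ _ _ (fun t => 1 + (-1) * ic S t)).
  move=> t _; rewrite !icE in_setC; case: (t \in S) => /=; ring.
apply: (apxD b0).
- by apply: (L2_J al b0 (C := sqc 1)) => //; exact: cmeas_cst.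
- apply: (L2_J al b0 (C := 1)).
    by apply: cmeasM; [exact: cmeas_cst|exact: cmeas_ic].
  by move=> t; rewrite mulN1r sqcN sqc_ic_le.
- by apply: apx_trig; exact: trig_cst.
- by apply: (apxZ b0) => //; exact: L2_Jic.
Qed.

Lemma apx_sum (I : Type) (s : seq I) (F : I -> R -> R[i]) :
  (forall i, L2 (fun t => ic J t * F i t)) -> (forall i, approximable (F i)) ->
  approximable (fun t => \sum_(i <- s) F i t).
Proof.
move=> F2 aF; elim: s => [|i s IH].
  apply: (@eq_apx _ _ _ (fun=> 0)); first by move=> t _; rewrite big_nil.
  by apply: apx_trig; exact: trig_cst.
apply: (@eq_apx _ _ _ (fun t => F i t + \sum_(i <- s) F i t)).
  by move=> t _; rewrite big_cons.
apply: (apxD b0) => //.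
under eq_fun do rewrite mulr_sumr; exact: L2_sum.
Qed.

(** The partial sums of the indicators of disjoint sets are indicators of the
    partial unions, dominated by the indicator of the period. *)
Lemma apx_bigcup (F : (set R)^nat) : (forall n, measurable (F n)) ->
  trivIset [set: nat] F -> (forall n, approximable (ic (F n))) ->
  approximable (ic (\bigcup_k F k)).
Proof.
move=> mF tF aF.
have mU : measurable (\bigcup_k F k) by apply: bigcup_measurable.
have sumE n t k : F k t -> \sum_(i < n) ic (F i) t = if (k < n)%N then 1 else 0.
  move=> Fkt; have Fi i : i != k -> ic (F i) t = 0.
    move=> ik; rewrite icE memNset// => Fit.
    by move/eqP: ik; apply; apply: (tF i k) => //; exists t.
  case: ifPn => kn.
    rewrite (bigD1 (Ordinal kn))//= icE mem_set// big1 ?addr0// => i ik.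
    by apply: Fi; apply: contra ik => /eqP ik; apply/eqP/val_inj.
  rewrite big1// => i _; apply: Fi; apply: contra kn => /eqP <-; exact: ltn_ord.
have sum0 n t : ~ (\bigcup_k F k) t -> \sum_(i < n) ic (F i) t = 0.
  move=> nU; rewrite big1// => i _; rewrite icE memNset// => Fit.
  by apply: nU; exists i.
apply: (@apx_lim _ _ al b0 (fun n t => \sum_(i < n) ic (F i) t) _ (\1_J)).
- by move=> n; apply: cmeas_sum => i; exact: cmeas_ic.
- exact: cmeas_ic.
- move=> n; under eq_fun do rewrite mulr_sumr; apply: L2_sum => i _; exact: L2_Jic.
- exact: L2_Jic.
- by apply: integ_ic; [exact: measJ|exact: muJ_fin].
- move=> n t Jt; rewrite indicE mem_set//=.
  have [[k _ Fkt]|nU] := pselect ((\bigcup_k F k) t).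
    rewrite (sumE _ _ k)// icE mem_set; last by exists k.
    case: ifP => _; rewrite ?subrr ?sqc0// sub0r sqcN /sqc /dotc /=.
    by rewrite mulr0 addr0 mulr1.
  by rewrite sum0// icE memNset// subrr sqc0.
- by move=> t; rewrite indicE.
- apply: ae_all => t Jt.
  have [[k _ Fkt]|nU] := pselect ((\bigcup_k F k) t).
    apply: cvg_near_cst; exists k.+1 => // n /= kn.
    rewrite (sumE _ _ k)// kn icE mem_set; last by exists k.
    by rewrite subrr sqc0.
  apply: cvg_near_cst; apply: nearW => n.
  by rewrite sum0// icE memNset// subrr sqc0.
- by move=> n; apply: apx_sum => // i; exact: L2_Jic.
Qed.

(** The sets with approximable indicator form a Dynkin system, and it contains
    the rays, which are stable under intersection and generate the Borel
    sets. *)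
Lemma apx_set (S : set R) : measurable S -> approximable (ic S).
Proof.
pose G := [set A : set R | exists x, A = `]x, +oo[%classic].
have GE : @measurable _ (measurableTypeR R) = <<s G >>.
  exact: (RGenOInfty.measurableE R).
have GI : setI_closed G.
  move=> _ _ [x ->] [y ->]; exists (Num.max x y).
  by apply/seteqP; split => t /=; rewrite !in_itv/= !andbT gt_max; [case=> -> ->|case/andP].
move=> mS; have : <<s G >> S by rewrite -GE.
apply: (@dynkin_induction _ (measurableTypeR R) G (fun S => approximable (ic S)) GE GI).
- apply: (@eq_apx _ _ _ (fun=> 1)); first by move=> t _; rewrite icE mem_set.
  by apply: apx_trig; exact: trig_cst.
- by move=> _ [x ->]; exact: apx_ray.
- by move=> E mE; exact: apx_setC.
- exact: apx_bigcup.
Qed.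

(** Increasing approximation by simple functions, each a combination of
    indicators. *)
Lemma apx_ge0 (f : R -> R) : mfun f -> (forall t, 0 <= f t) ->
  L2 (fun t => (f t)%:C%C) -> approximable (fun t => (f t)%:C%C).
Proof.
move=> mf f0 f2.
have mfe : measurable_fun [set: R] (EFin \o f) by exact/measurable_EFinP.
pose fn := nnsfun_approx measurableT mfe.
have fe0 : forall x, [set: R] x -> (0 <= (EFin \o f) x)%E.
  by move=> x _; rewrite lee_fin.
have cfn t : (fun n => fn n t) @ \oo --> f t.
  have := cvg_nnsfun_approx measurableT mfe fe0 (I : [set: R] t).
  by move/fine_cvg.
have fnf n t : fn n t <= f t.
  have nd : nondecreasing_seq (fun n => fn n t).
    by move=> i j ij; have /lefP := nd_nnsfun_approx measurableT mfe ij; exact.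
  have cv : cvgn (fun n => fn n t) by apply/cvg_ex; exists (f t).
  have := nondecreasing_cvgn_le nd cv n.
  by rewrite (cvg_lim _ (cfn t)).
have fn0 n t : 0 <= fn n t by exact: fun_ge0.
have fn2 n : L2 (fun t => (fn n t)%:C%C).
  apply: (L2_dom _ (L2_sq f2)); first exact: cmeas_real.
  by move=> t; rewrite !sqc_real lerXn2r ?nnegrE.
apply: (@apx_lim _ _ al b0 (fun n t => (fn n t)%:C%C) _ (fun t => sqc (f t)%:C%C)).
- by move=> n; exact: cmeas_real.
- exact: cmeas_real.
- by move=> n; apply: L2_icM => //; exact: measJ.
- by apply: L2_icM => //; exact: measJ.
- exact: L2_sq.
- move=> n t _; rewrite -rmorphB !sqc_real -sqrrN opprB lerXn2r ?nnegrE ?subr_ge0//.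
  by rewrite gerBl.
- by move=> t; exact: sqc_ge0.
- apply: ae_all => t _.
  have -> : (fun n => sqc ((fn n t)%:C%C - (f t)%:C%C)) =
      (fun n => (fn n t - f t) * (fn n t - f t)).
    by apply/funext => n; rewrite -rmorphB sqc_real expr2.
  have H : (fun n => fn n t - f t) @ \oo --> (f t - f t).
    by apply: cvgB; [exact: cfn|exact: cvg_cst].
  by have := cvgM H H; rewrite subrr mulr0; apply.
- move=> n.
  apply: (@eq_apx _ _ _ (fun t => \sum_(y <- fset_set (range (fn n)))
      y%:C%C * ic (fn n @^-1` [set y]) t)).
    move=> t _; rewrite fimfunE fsbig_finite//= rmorph_sum /=.
    by apply: eq_bigr => y _; rewrite rmorphM.
  apply: apx_sum => y.
    apply: (L2_J al b0 (C := sqc y%:C%C)).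
      by apply: cmeasM; [exact: cmeas_cst|exact: cmeas_ic].
    by move=> t; rewrite sqcM ler_piMr ?sqc_ge0// sqc_ic_le.
  by apply: (apxZ b0); [exact: L2_Jic|exact: apx_set].
Qed.

Lemma apx_real (f : R -> R) : mfun f ->
  L2 (fun t => (f t)%:C%C) -> approximable (fun t => (f t)%:C%C).
Proof.
move=> mf f2.
have mJ := measJ b al.
have part (g : R -> R) : mfun g -> (forall t, 0 <= g t) -> (forall t, g t <= `|f t|) ->
    L2 (fun t => (g t)%:C%C).
  move=> mg g0 gf; apply: (L2_dom _ (L2_sq f2)); first exact: cmeas_real.
  by move=> t; rewrite !sqc_real -[leRHS]real_normK ?num_real// lerXn2r ?nnegrE.
have mp : mfun (fun t => Num.max (f t) 0) by exact: measurable_maxr.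
have mn : mfun (fun t => Num.max (- f t) 0).
  by apply: measurable_maxr => //; exact: measurable_funN.
have p2 := part _ mp _ _; have n2 := part _ mn _ _.
have {}p2 : L2 (fun t => (Num.max (f t) 0)%:C%C).
  by apply: p2 => t; rewrite ?le_max ?lexx ?orbT// ge_max ler_norm normr_ge0.
have {}n2 : L2 (fun t => (Num.max (- f t) 0)%:C%C).
  by apply: n2 => t; rewrite ?le_max ?lexx ?orbT// ge_max -normrN ler_norm normr_ge0.
apply: (@eq_apx _ _ _ (fun t => (Num.max (f t) 0)%:C%C + (-1) * (Num.max (- f t) 0)%:C%C)).
  move=> t _; rewrite mulN1r -rmorphB; congr (_%:C%C).
  by rewrite !maxEle oppr_le0; case: (leP (f t) 0); case: (leP 0 (f t)); lra.
apply: (apxD b0).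
- exact: L2_icM.
- by apply: L2_icM => //; exact: L2Z.
- by apply: apx_ge0 => // t; rewrite le_max lexx orbT.
- apply: (apxZ b0); first exact: L2_icM.
  by apply: apx_ge0 => // t; rewrite le_max lexx orbT.
Qed.

Lemma apx_L2 f : L2 f -> approximable f.
Proof.
move=> f2; have [mre mim] := L2_meas f2.
have mJ := measJ b al.
have r2 : L2 (fun t => (complex.Re (f t))%:C%C).
  apply: (L2_dom _ (L2_sq f2)); first exact: cmeas_real.
  by move=> t; rewrite sqc_real /sqc /dotc -!expr2 lerDl sqr_ge0.
have i2 : L2 (fun t => (complex.Im (f t))%:C%C).
  apply: (L2_dom _ (L2_sq f2)); first exact: cmeas_real.
  by move=> t; rewrite sqc_real /sqc /dotc -!expr2 lerDr sqr_ge0.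
apply: (@eq_apx _ _ _ (fun t => (complex.Re (f t))%:C%C + 'i%C * (complex.Im (f t))%:C%C)).
  by move=> t _; rewrite -complexE.
apply: (apxD b0).
- exact: L2_icM.
- by apply: L2_icM => //; exact: L2Z.
- exact: apx_real.
- by apply: (apxZ b0); [exact: L2_icM|exact: apx_real].
Qed.

(** Parseval's formula on a single period: parseval applies because
    trigonometric polynomials are dense. *)
Lemma parseval_J F : L2 F -> (forall t, ~ J t -> F t = 0) ->
  (\esum_(m in [set: int]) (sqc (inner F (ee b m)))%:E = (b^-1 * nrm F)%:E)%E.
Proof. by move=> F2 F0; apply: (parseval (al := al)) => //; exact: apx_L2. Qed.

End DensityL2.

(** * Two periods folded onto one, and the associated quadratic form *)

Section Periodization.
Context {R : realType}.
Local Notation mu := (@lebesgue_measure R).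
Local Notation integ F := (mu.-integrable [set: R] (EFin \o F)).

(** Countable additivity of the integral for a partition indexed by the
    integers, transported along the enumeration of the integers. *)
Lemma int_partition_esum (A : int -> set R) (U : R -> \bar R) :
  (forall n, measurable (A n)) -> (forall t, exists2 n, A n t & forall m, A m t -> m = n) ->
  measurable_fun [set: R] U -> (forall t, 0 <= U t)%E ->
  (\int[mu]_t U t = \esum_(n in [set: int]) \int[mu]_(t in A n) U t)%E.
Proof.
move=> mA pA mU U0.
pose B (k : nat) : set R := if (choice.pickle_inv k : option int) is Some n then A n else set0.
have Bp n : B (choice.pickle n) = A n by rewrite /B choice.pickleK_inv.
have mB k : measurable (B k).
  by rewrite /B; case: choice.pickle_inv => [n|]; [exact: mA|exact: measurable0].
have tB : trivIset [set: nat] B.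
  move=> i j _ _ [t []]; rewrite /B.
  case Ei : (choice.pickle_inv i : option int) => [n|]//; case Ej : (choice.pickle_inv j : option int) => [m|]// An Am.
  have [n0 _ An0] := pA t.
  have nm : n = m by rewrite (An0 n)// (An0 m).
  have := @choice.pickle_invK int i; rewrite /ocancel Ei /= => <-.
  by have := @choice.pickle_invK int j; rewrite /ocancel Ej /= => <-; rewrite nm.
have UB : \bigcup_k B k = setT.
  apply/seteqP; split => // t _; have [n An _] := pA t.
  by apply: (ex_intro2 _ _ (choice.pickle n) I); rewrite Bp.
have /= := @ge0_integral_bigcup _ _ R mu B U mB.
rewrite UB => H; rewrite (H mU (fun t _ => U0 t) tB) => {H}.
rewrite nneseries_esumT; last by move=> k; apply: integral_ge0 => t _; exact: U0.
under [RHS]eq_esum do rewrite -Bp.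
rewrite -(esum_image [set: int] (@choice.pickle int) (fun k => (\int[mu]_(t in B k) U t)%E)); last first.
  by move=> i j _ _; exact: (pcan_inj (@choice.pickleK int)).
rewrite [RHS]esum_mkcond; apply: eq_esum => k _; case: ifPn => //.
rewrite notin_setE => nk; rewrite /B.
case Ek : (choice.pickle_inv k : option int) => [n|]; last by rewrite integral_set0.
exfalso; apply: nk; exists n => //.
by have := @choice.pickle_invK int k; rewrite /ocancel Ek.
Qed.

Variables (b al : R).
Hypothesis b0 : 0 < b.
Local Notation h := (b^-1).
Local Notation J := (J b al).

(** The periodization of a function that lives on two consecutive periods. *)
Definition fold2 (F : R -> R[i]) : R -> R[i] := fun t => ic J t * (F t + F (t + h)).

Lemma L2_fold2 F : L2 F -> L2 (fold2 F).
Proof.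
by move=> F2; apply: L2_icM; [exact: measJ|apply: L2D => //; exact: L2_shift].
Qed.

(** The exponentials are h-periodic, so the second period may be shifted onto
    the first without changing the Fourier coefficients. *)
Lemma inner_fold2 F m : L2 F -> (forall t, ~ (al <= t < al + 2 * h) -> F t = 0) ->
  inner F (ee b m) = inner (fold2 F) (ee b m).
Proof.
move=> F2 F0; have mJ := measJ b al.
suff H z : dot F (fun t => z * ee b m t) = dot (fold2 F) (fun t => z * ee b m t).
  have E1 : ee b m = (fun t => 1 * ee b m t) by apply/funext => t; rewrite mul1r.
  by rewrite !inner_dot H; congr Complex; rewrite E1 H.
have h0 : 0 < h by rewrite invr_gt0.
pose k t := z * ee b m t.
have kper t : k (t + h) = k t by rewrite /k ee_period// gt_eqF.
pose G1 t := dotc (ic J t * F t) (k t).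
pose G2 t := dotc (ic J t * F (t + h)) (k t).
have dce (u : R[i]) t : dotc (ic J t * u) (k t) = dotc (ic J t * u) (ce b al z m t).
  by rewrite /ce icE; case: ifP => _; rewrite ?mul1r// !mul0r !dotc0l.
have iG1 : integ G1.
  rewrite /G1; under eq_fun do rewrite dce.
  by apply: integ_dotc; [exact: L2_icM|exact: L2_ce].
have iG2 : integ G2.
  rewrite /G2; under eq_fun do rewrite dce.
  by apply: integ_dotc; [apply: L2_icM => //; exact: L2_shift|exact: L2_ce].
transitivity (\int[mu]_t (G1 t + G2 (t - h))).
  apply: eq_Rintegral => t _; rewrite /G1 /G2 subrK -(kper (t - h)) subrK -dotcDl -mulrDl.
  have inJ x : (x \in J) = (al <= x < al + h).
    by apply/idP/idP; rewrite inE /J /= in_itv.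
  rewrite /ic !indicE !inJ.
  have [Ft|/F0 ->] := pselect (al <= t < al + 2 * h); last by rewrite mulr0 !dotc0l.
  have -> : (al <= t - h < al + h) = ~~ (al <= t < al + h).
    move: Ft => /andP[F1 F2']; rewrite F1 /=.
    rewrite -leNgt lerBrDr; case: (leP (al + h) t) => //= _; lra.
  by case: (al <= t < al + h); rewrite ?(addr0, add0r) mul1r.
rewrite RintegralD//; last exact: (integ_shift (- h) iG2).
rewrite (Rintegral_shift (- h) iG2) -RintegralD//.
by apply: eq_Rintegral => t _; rewrite /G1 /G2 /fold2 -dotcDl mulrDr.
Qed.

Lemma parseval2 F : L2 F -> (forall t, ~ (al <= t < al + 2 * h) -> F t = 0) ->
  (\esum_(m in [set: int]) (sqc (inner F (ee b m)))%:E = (h * nrm (fold2 F))%:E)%E.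
Proof.
move=> F2 F0; under eq_esum do rewrite inner_fold2//.
apply: (parseval_J (al := al)) => //; first exact: L2_fold2.
by move=> t nJ; rewrite /fold2 icE memNset// mul0r.
Qed.

End Periodization.

Section Form.
Context {R : realType}.
Variables (h C : R) (P Q S : R -> R[i]).
Hypotheses (h0 : 0 < h) (mP : cmeasurable P) (mQ : cmeasurable Q) (mS : cmeasurable S).
Hypotheses (PC : forall t, sqc (P t) <= C) (QC : forall t, sqc (Q t) <= C)
  (SC : forall t, sqc (S t) <= C).

(** The frame operator turns out to be h (L^* L + M^* M), where L couples t
    with t + h and M is a multiplication operator; opT is this product written
    out, and form is its quadratic form. *)
Definition opL f t := P t * f t + Q t * f (t + h).
Definition opM f t := S t * f t.
Definition opT (f : R -> R[i]) t := h%:C%C * (conjc (P t) * opL f t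
  + conjc (Q (t - h)) * opL f (t - h) + conjc (S t) * opM f t).

Lemma L2_opL f : L2 f -> L2 (opL f).
Proof.
move=> f2; apply: L2D; first exact: (L2Mb mP PC).
exact: (L2Mb mQ QC (L2_shift h f2)).
Qed.
Lemma L2_opM f : L2 f -> L2 (opM f).
Proof. by move=> f2; exact: (L2Mb mS SC). Qed.

Lemma L2_opT_parts f : L2 f -> [/\ L2 (fun t => conjc (P t) * opL f t),
  L2 (fun t => conjc (Q (t - h)) * opL f (t - h)) & L2 (fun t => conjc (S t) * opM f t)].
Proof.
move=> f2; have L2f := L2_opL f2.
have mQJ : cmeasurable (fun t => conjc (Q (t - h))).
  by apply: cmeasJ; apply: cmeas_comp mQ; exact: measurable_shift.
split.
- by apply: (L2Mb (C := C) (cmeasJ mP)) => // t; rewrite sqcJ.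
- apply: (L2Mb (C := C) mQJ); last exact: (L2_shift (- h)).
  by move=> t; rewrite sqcJ.
- apply: (L2Mb (C := C) (cmeasJ mS)); last exact: L2_opM.
  by move=> t; rewrite sqcJ.
Qed.

Lemma L2_opT f : L2 f -> L2 (opT f).
Proof. by case/L2_opT_parts => *; apply: L2Z; apply: L2D => //; exact: L2D. Qed.

Definition form f k : R := h * (dot (opL f) (opL k) + dot (opM f) (opM k)).

(** The adjoint of f |-> f (. + h) is the translation by - h. *)
Lemma dot_opT f k : L2 f -> L2 k -> dot (opT f) k = form f k.
Proof.
move=> f2 k2; have [L1 L2' L3] := L2_opT_parts f2.
have Lf := L2_opL f2; have kh := L2_shift h k2.
rewrite /opT dotZl//; last by apply: L2D => //; exact: L2D.
rewrite dotDl//; last exact: L2D.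
rewrite dotDl// /form; congr (h * (_ + _)); last first.
  by rewrite dotMl; congr dot; apply/funext => t; rewrite conjcK.
have -> : dot (fun t => conjc (Q (t - h)) * opL f (t - h)) k =
    dot (opL f) (fun t => Q t * k (t + h)).
  have i1 := integ_dotc L2' k2.
  rewrite /dot -(Rintegral_shift h i1); apply: eq_Rintegral => t _.
  by rewrite /= addrK dotcMl conjcK.
rewrite dotMl /opL -dotDr//.
- by congr dot; apply/funext => t; rewrite conjcK.
- by under eq_fun do rewrite conjcK; exact: (L2Mb mP PC).
- exact: (L2Mb mQ QC).
Qed.

Lemma formC f k : form f k = form k f.
Proof. by rewrite /form (dotC (opL f)) (dotC (opM f)). Qed.

End Form.

(** * The frame sum as a quadratic form *)

Section GaborForm.
Context {R : realType}.
Local Notation mu := (@lebesgue_measure R).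
Local Notation mfun := (measurable_fun [set: R]).
Variables (a c : R).
Hypothesis a0 : 0 < a.

(** Every t is written as pos t + n a with pos t in [c, c + a) and n = cell t:
    for that n the translate of the window by n a is evaluated at t in the
    first interval of length a of its support. *)
Definition cell (t : R) : int := Num.floor ((t - c) / a).
Definition pos (t : R) : R := t - (cell t)%:~R * a.

Lemma cellP (n : int) (t : R) : (cell t == n) = (c + n%:~R * a <= t < c + (n + 1)%:~R * a).
Proof.
have -> : (c + n%:~R * a <= t < c + (n + 1)%:~R * a) =
    (n%:~R <= (t - c) / a < (n + 1)%:~R).
  by rewrite ler_pdivlMr// ltr_pdivrMr// lerBrDl ltrBlDl.
by apply/eqP/idP => [<-|H]; [exact: floor_itv|exact: floor_def].
Qed.

Lemma cell_eq (n : int) (t : R) : c + n%:~R * a <= t -> t < c + (n + 1)%:~R * a -> cell t = n.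
Proof. by move=> t1 t2; apply/eqP; rewrite cellP t1 t2. Qed.

Lemma pos_itv t : c <= pos t < c + a.
Proof.
have := eqxx (cell t); rewrite cellP /pos => /andP[t1 t2].
rewrite lerBrDr t1 /= ltrBlDr; apply: lt_le_trans t2 _.
by rewrite intrD mulrDl mul1r; lra.
Qed.

Lemma measurable_pos : mfun pos.
Proof.
apply: measurable_funB; first exact: measurable_id.
apply: mfunM; last exact: measurable_cst.
apply: nondecreasing_measurable => // x y xy; rewrite ler_int /cell.
by apply: le_floor; rewrite ler_pM2r ?invr_gt0// lerB.
Qed.

Definition cellset (n : int) : set R := [set` `[c + n%:~R * a, c + (n + 1)%:~R * a[].

Lemma cellsetE n t : cellset n t <-> cell t = n.
Proof. by rewrite /cellset /= in_itv /= -cellP; split=> /eqP. Qed.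

Lemma in_cellset n t : (t \in cellset n) = (cell t == n).
Proof. by apply/idP/eqP; rewrite inE => /cellsetE. Qed.

Lemma measurable_cellset n : measurable (cellset n).
Proof. exact: measurable_itv. Qed.

Variables (g : R -> R[i]) (b d C : R).
Hypotheses (b0 : 0 < b) (ab : a < b^-1) (cd2 : d <= c + 2 * a).
Hypotheses (mg : cmeasurable g) (gC : forall t, sqc (g t) <= C)
  (g0 : forall t, ~ (c <= t < d) -> g t = 0).
Local Notation h := (b^-1).

(** The translates of the window that do not vanish at t are evaluated at pos
    t and pos t + a only, as the window has length at most 2 a. P and Q are
    the values of one translate at t and t + h. S is the value at t of the
    previous translate when t still belongs to the first period of length h of
    that translate; the condition in S prevents counting this value a second
    time, as it would otherwise already be a value of Q. *)
Definition gP t := conjc (g (pos t)).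
Definition gQ t := conjc (g (pos t + h)).
Definition gS t := if pos t + a < c + h then conjc (g (pos t + a)) else 0.

Lemma cmeas_gP : cmeasurable gP.
Proof. by apply: cmeasJ; apply: cmeas_comp mg; exact: measurable_pos. Qed.
Lemma cmeas_gQ : cmeasurable gQ.
Proof.
apply: cmeasJ; apply: cmeas_comp mg; apply: mfunD; [exact: measurable_pos|exact: measurable_cst].
Qed.
Lemma cmeas_gS : cmeasurable gS.
Proof.
have mp : mfun (fun t => pos t + a).
  by apply: mfunD; [exact: measurable_pos|exact: measurable_cst].
have mb : measurable_fun setT (fun t => pos t + a < c + h).
  by apply: measurable_fun_ltr => //; exact: measurable_cst.
by apply: cmeas_if => //; apply: cmeasJ; exact: cmeas_comp mg.
Qed.
Lemma gP_le t : sqc (gP t) <= C. Proof. by rewrite /gP sqcJ. Qed.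
Lemma gQ_le t : sqc (gQ t) <= C. Proof. by rewrite /gQ sqcJ. Qed.
Lemma gS_le t : sqc (gS t) <= C.
Proof.
by rewrite /gS; case: ifP => _; rewrite ?sqcJ// sqc0 (le_trans (sqc_ge0 (g 0))).
Qed.

Local Notation gL := (opL h gP gQ).
Local Notation gM := (opM gS).

Definition gF (n : int) (f : R -> R[i]) t := f t * conjc (g (t - n%:~R * a)).

Lemma L2_gF n f : L2 f -> L2 (gF n f).
Proof.
move=> f2; rewrite /gF; under eq_fun do rewrite mulrC.
apply: (L2Mb (C := C)) => //; last by move=> t; rewrite sqcJ.
by apply: cmeasJ; apply: cmeas_comp mg; exact: (measurable_shift (- (n%:~R * a))).
Qed.

(** A Gabor coefficient is the Fourier coefficient of the product of f with
    the conjugate of a translate of the window. *)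
Lemma inner_gabor f m n : inner f (gabor g a b (m, n)) = inner (gF n f) (ee b m).
Proof.
by rewrite /inner /cintegral; congr Complex; apply: eq_Rintegral => t _;
  rewrite /gabor /gF /ee conjcM mulrA.
Qed.

(** The window has length at most 2 a < 2 h, so the product lives on two
    periods. *)
Lemma gF_supp (n : int) (f : R -> R[i]) (t : R) : ~ (c + n%:~R * a <= t < c + n%:~R * a + 2 * h) -> gF n f t = 0.
Proof.
have abh := ab; have cd2a := cd2.
move=> nt; rewrite /gF g0 ?conjc0E ?mulr0//.
by move=> H; apply: nt; lra.
Qed.

(** On the first period of the n-th translate, the points of cell n see the
    window at pos t and at pos t + h. The points of cell n + 1 see it at pos t
    + a only, since a further step of length h leaves [c, d). In the later
    cells the window vanishes. *)
Lemma sqc_fold2_gF (n : int) (f : R -> R[i]) (t : R) : sqc (fold2 b (c + n%:~R * a) (gF n f) t) =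
  (if t \in cellset n then sqc (gL f t) else 0) +
  (if t \in cellset (n + 1) then sqc (gM f t) else 0).
Proof.
have abh := ab; have cd2a := cd2; have a_gt0 := a0.
rewrite /fold2 sqc_icM !in_cellset.
have inJ : (t \in J b (c + n%:~R * a)) = (c + n%:~R * a <= t < c + n%:~R * a + h).
  by apply/idP/idP; rewrite inE /J /= in_itv.
rewrite inJ {inJ}.
have gz x : d <= x -> g x = 0 by move=> dx; apply: g0; lra.
have n1 : (n + 1)%:~R * a = n%:~R * a + a by rewrite intrD mulrDl mul1r.
case: eqP => [tn|tn].
  have -> : (cell t == n + 1) = false by apply/eqP => tn1; move: tn; rewrite tn1; lia.
  rewrite addr0; have /eqP := tn; rewrite cellP n1 => /andP[t1 t2].
  rewrite ifT; last by apply/andP; split => //; lra.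
  rewrite /opL /gP /gQ /gF /pos tn; congr sqc; rewrite mulrC; congr (_ + _).
  by rewrite mulrC (_ : t + h - _ = t - n%:~R * a + h)//; ring.
rewrite add0r; case: eqP => [tn1|tn1].
  have /eqP := tn1; rewrite cellP !intrD !mulrDl !mul1r => /andP[t1 t2].
  have E : pos t + a = t - n%:~R * a by rewrite /pos tn1 n1; ring.
  rewrite /opM /gS E.
  have -> : (t - n%:~R * a < c + h) = (t < c + n%:~R * a + h).
    by apply/idP/idP; lra.
  have -> : (c + n%:~R * a <= t) by lra.
  rewrite andTb; case: ifP => H; last by rewrite /opM mul0r sqc0.
  rewrite /gF [g (t + h - _)]gz; last lra.
  by rewrite conjc0E mulr0 addr0 mulrC.
case: ifP => // /andP[t1 t2].
have t3 : c + n%:~R * a + a <= t.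
  rewrite leNgt; apply/negP => t3; apply: tn; apply: cell_eq => //; rewrite n1; lra.
have t4 : c + n%:~R * a + 2 * a <= t.
  rewrite leNgt; apply/negP => t4; apply: tn1; apply: cell_eq; rewrite !intrD !mulrDl !mul1r; lra.
by rewrite /gF !gz ?conjc0E ?mulr0 ?addr0 ?sqc0//; lra.
Qed.

Lemma L2_gL f : L2 f -> L2 (gL f).
Proof. by apply: L2_opL; [exact: cmeas_gP|exact: cmeas_gQ|exact: gP_le|exact: gQ_le]. Qed.
Lemma L2_gM f : L2 f -> L2 (gM f).
Proof. by apply: L2_opM; [exact: cmeas_gS|exact: gS_le]. Qed.

(** For each translate, Parseval's formula in the modulation index gives the
    integral of a folded product, which is carried by two cells. The cells
    tile the line, so summing over the translations reassembles the integrals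
    over the whole line. *)
Lemma esum_gabor f : L2 f ->
  (\esum_(p in [set: int * int]) ((cmod (inner f (gabor g a b p))) ^+ 2)%:E
   = (form h gP gQ gS f f)%:E)%E.
Proof.
move=> f2; have Lf := L2_gL f2; have Mf := L2_gM f2.
have mhsq (k : R -> R[i]) : L2 k -> measurable_fun setT (fun t => (h * sqc (k t))%:E).
  move=> k2; apply/measurable_EFinP; apply: mfunM; first exact: measurable_cst.
  by apply: measurable_sqc; exact: L2_meas.
have ge0 (k : R -> R[i]) t : (0 <= (h * sqc (k t))%:E)%E.
  by rewrite lee_fin mulr_ge0 ?sqc_ge0 ?invr_ge0 ?(ltW b0).
have hnrm (k : R -> R[i]) : L2 k -> (\int[mu]_t (h * sqc (k t))%:E = (h * nrm k)%:E)%E.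
  move=> k2; rewrite EFinM -nrmE// -ge0_integralZl_EFin ?invr_ge0 ?(ltW b0)//.
  - by move=> t _; rewrite lee_fin sqc_ge0.
  - by apply/measurable_EFinP; apply: measurable_sqc; exact: L2_meas.
have mU := mhsq _ Lf; have mV := mhsq _ Mf.
have pA t : exists2 n, cellset n t & forall m, cellset m t -> m = n.
  by exists (cell t); [exact/cellsetE|move=> m /cellsetE].
rewrite (reindex_esum [set: int * int] _ (fun x => (x.2, x.1))); last first.
  by split=> // [[i j] [k l] _ _ [-> ->]|[i j] _] //; exists (j, i).
have -> : [set: int * int] = [set: int] `*`` (fun=> [set: int]) by apply/seteqP; split.
rewrite -(@esum_esum R _ _ setT (fun=> setT)
  (fun n m => ((cmod (inner f (gabor g a b (m, n)))) ^+ 2)%:E)); last first.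
  by move=> n m _ _; rewrite lee_fin sqr_ge0.
transitivity (\esum_(n in [set: int])
   (\int[mu]_(t in cellset n) (h * sqc (gL f t))%:E
   + \int[mu]_(t in cellset (n + 1)) (h * sqc (gM f t))%:E))%E.
  apply: eq_esum => n _; under eq_esum do rewrite inner_gabor -sqcE.
  rewrite (parseval2 (al := c + n%:~R * a) b0 (L2_gF n f2) (@gF_supp n f)).
  rewrite -hnrm; last exact/L2_fold2/L2_gF.
  rewrite [X in _ = (X + _)%E]integral_mkcond [X in _ = (_ + X)%E]integral_mkcond.
  rewrite -ge0_integralD//; last 4 first.
  - by move=> t _; rewrite patchE; case: ifP => // _; exact: ge0.
  - by apply/(measurable_restrictT _ (measurable_cellset n)); exact: measurable_funTS.
  - by move=> t _; rewrite patchE; case: ifP => // _; exact: ge0.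
  - by apply/(measurable_restrictT _ (measurable_cellset (n + 1))); exact: measurable_funTS.
  apply: eq_integral => t _; rewrite sqc_fold2_gF mulrDr EFinD !patchE.
  by congr (_ + _)%E; case: ifP => // _; rewrite mulr0.
rewrite esumD; last 2 first.
- by move=> n _; apply: integral_ge0 => t _; exact: ge0.
- by move=> n _; apply: integral_ge0 => t _; exact: ge0.
rewrite -(reindex_esum [set: int] [set: int] (fun n => n + 1)
  (fun n => \int[mu]_(t in cellset n) (h * sqc (gM f t))%:E)%E); last first.
  split=> //; first by move=> m n _ _; exact: addIr.
  by move=> n _; exists (n - 1) => //; rewrite subrK.
rewrite -!(int_partition_esum measurable_cellset pA)//.
by rewrite !hnrm// -EFinD -mulrDr.
Qed.

End GaborForm.

(** * Almost everywhere properties of the window *)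

Section Countable.
Context {R : realType}.
Local Notation mu := (@lebesgue_measure R).
Local Notation integ F := (mu.-integrable [set: R] (EFin \o F)).

Lemma ae_forall (I : countType) (Pr : I -> R -> Prop) :
  (forall i, \forall t \ae mu, Pr i t) -> \forall t \ae mu, forall i, Pr i t.
Proof.
move=> H; have := @ae_foralln _ _ _ mu
  (fun k t => if choice.unpickle k is Some i then Pr i t else True).
have H' : forall k, \forall t \ae mu, if (choice.unpickle k : option I) is Some i then Pr i t else True.
  by move=> k; case: (choice.unpickle k) => [i|]; [exact: H|exact: ae_all].
by move=> /(_ H'); apply: ae_imp => t Ht i; have := Ht (choice.pickle i); rewrite choice.pickleK.
Qed.

Lemma ae_int_le0 (u : R -> R) : integ u -> (forall t, 0 <= u t) ->
  \int[mu]_t u t <= 0 -> \forall t \ae mu, u t = 0.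
Proof.
move=> iu u0 ule.
have /= := ae_eq_integral_abs mu measurableT (measurable_int _ iu).
have -> : (\int[mu]_x `|(u x)%:E|)%E = 0%E.
  transitivity (\int[mu]_x (u x)%:E)%E.
    by apply: eq_integral => t _ /=; rewrite ger0_norm.
  apply/eqP; rewrite eq_le; apply/andP; split; last first.
    by apply: integral_ge0 => t _; rewrite lee_fin.
  rewrite -(fineK (integrable_fin_num measurableT iu)) lee_fin; exact: ule.
by case=> + _ => /(_ erefl) /ae_eqE; apply: ae_imp => t [].
Qed.

(** The complement of the essential support is covered by countably many
    intervals with rational ends on which the function vanishes almost
    everywhere. *)
Lemma ess_supp_ae (f : R -> R[i]) : \forall t \ae mu, ~ ess_supp f t -> f t = 0.
Proof.
have : \forall t \ae mu, forall pq : rat * rat,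
    (\forall s \ae mu, ratr pq.1 < s < ratr pq.2 -> f s = 0) ->
    ratr pq.1 < t < ratr pq.2 -> f t = 0.
  apply: ae_forall => -[p q] /=.
  have [H|H] := pselect (\forall s \ae mu, ratr p < s < ratr q -> f s = 0).
    by apply: ae_imp H => t Ht _.
  by apply: ae_all => t.
apply: ae_imp => t Ht /existsNP [U] /not_implyP [Ut /contrapT fU].
move: Ut; rewrite -nbhs_ballE => -[e /= e0 eU].
have te1 : t - e < t by rewrite ltrBlDr ltrDl.
have [p] := rat_in_itvoo te1.
rewrite in_itv /= => /andP[p1 p2].
have te2 : t < t + e by rewrite ltrDl.
have [q] := rat_in_itvoo te2.
rewrite in_itv /= => /andP[q1 q2].
apply: (Ht (p, q)); last by rewrite /= p2 q1.
move: fU; apply: ae_imp => s fs /= /andP[ps sq]; apply: fs; apply: eU.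
by rewrite /ball /= ltr_distlC; apply/andP; split; lra.
Qed.

Lemma esum_slice (I1 I2 : choiceType) (j : I2) (u : I1 * I2 -> \bar R) : (forall p, 0 <= u p)%E ->
  (\esum_(i in [set: I1]) u (i, j) <= \esum_(p in [set: I1 * I2]) u p)%E.
Proof.
move=> u0; rewrite -(esum_image [set: I1] (fun i => (i, j)) u); last by move=> x y _ _ [].
by rewrite esum_mkcond; apply: le_esum => p _; case: ifP.
Qed.

(** Test the upper frame bound on the indicator f of the part of one period
    where b B < |g|^2 <= N. By Parseval's formula the unshifted window alone
    contributes h times the integral of |g|^2 over that set, and this is at
    most B times its measure only if the set is null. The bound N makes the
    product square integrable. *)
Lemma gabor_bounded (g : R -> R[i]) (a b B : R) : 0 < b -> L2 g ->
  (forall f, L2 f -> (\esum_(p in [set: int * int])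
     ((cmod (inner f (gabor g a b p))) ^+ 2)%:E <= B%:E * L2norm f ^+ 2)%E) ->
  \forall t \ae mu, sqc (g t) <= b * B.
Proof.
move=> b0 g2 gB; have mg := L2_meas g2.
pose E (k : int) (N : nat) : set R := J b (k%:~R * b^-1) `&`
  [set t | b * B < sqc (g t)] `&` [set t | sqc (g t) <= N%:R].
have mE k N : measurable (E k N).
  have m1 : measurable [set t | b * B < sqc (g t)].
    have := measurable_sqc mg; move=> /(_ measurableT _ (measurable_itv `]b * B, +oo[)).
    rewrite setTI (_ : _ @^-1` _ = [set t | b * B < sqc (g t)])//.
    by apply/seteqP; split=> t /=; rewrite in_itv/= andbT.
  have m2 : measurable [set t | sqc (g t) <= N%:R].
    have := measurable_sqc mg; move=> /(_ measurableT _ (measurable_itv `]-oo, N%:R])).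
    rewrite setTI (_ : _ @^-1` _ = [set t | sqc (g t) <= N%:R])//.
  by apply: measurableI => //; apply: measurableI => //; exact: measJ.
have Enull k N : \forall t \ae mu, ~ E k N t.
  have Efin : (mu (E k N) < +oo)%E.
    apply: le_lt_trans (muJ_fin (k%:~R * b^-1) b0).
    apply: le_measure; rewrite ?inE; [exact: mE|exact: measJ|by move=> t [[]]].
  pose f := ic (E k N); pose F t := f t * conjc (g t).
  have f2 : L2 f by apply: L2_ic; [exact: mE|exact: Efin].
  have F2 : L2 F.
    have : L2 (fun t => ic (E k N) t * (ic (E k N) t * conjc (g t))).
      apply: (L2_icb (C := N%:R)); [exact: mE|exact: Efin| |].
        by apply: cmeasM; [exact: cmeas_ic|exact: cmeasJ].
      move=> t; rewrite sqc_icM; case: ifP; last by rewrite ler0n.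
      by rewrite inE => -[_]; rewrite sqcJ.
    suff -> : F = fun t => ic (E k N) t * (ic (E k N) t * conjc (g t)) by [].
    by apply/funext => t; rewrite /F /f icE; case: ifP; rewrite ?mul1r ?mul0r.
  have bound : b^-1 * nrm F <= B * nrm f.
    have := gB f f2; rewrite L2normE// => fB.
    rewrite -lee_fin EFinM [leRHS]EFinM; apply: le_trans fB.
    have F0 t : ~ J b (k%:~R * b^-1) t -> F t = 0.
      by move=> nJ; rewrite /F /f icE memNset ?mul0r// => -[[]].
    rewrite -EFinM -(parseval_J b0 F2 F0).
    have -> : (\esum_(m in [set: int]) (sqc (inner F (ee b m)))%:E =
        \esum_(m in [set: int]) ((cmod (inner f (gabor g a b (m, 0%R)))) ^+ 2)%:E)%E.
      apply: eq_esum => m _; rewrite -sqcE; congr ((sqc _)%:E).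
      by rewrite /inner /cintegral; congr Complex; apply: eq_Rintegral => t _;
        rewrite /F /gabor /= mul0r subr0 conjcM mulrA.
    apply: (esum_slice 0%R) => p; by rewrite lee_fin sqr_ge0.
  pose u t := sqc (F t) - b * B * sqc (f t).
  have uE t : u t = if t \in E k N then sqc (g t) - b * B else 0.
    rewrite /u /F /f sqc_icM sqcJ sqc_ic indicE; case: (t \in E k N) => /=.
      by rewrite mulr1.
    by rewrite mulr0 subr0.
  have iu : integ u.
    apply: eq_integrable (integrableB measurableT (L2_sq F2) (integZ (b * B) (L2_sq f2))) => //.
  have u0 t : 0 <= u t.
    by rewrite uE; case: ifPn => //; rewrite inE => -[[_ /= ?] _]; rewrite subr_ge0 ltW.
  have ule : \int[mu]_t u t <= 0.
    rewrite RintegralB//; [|exact: L2_sq|by apply: integZ; exact: L2_sq].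
    rewrite RintegralZl//; last exact: L2_sq.
    rewrite subr_le0 -/(nrm F) -/(nrm f) -mulrA -ler_pdivrMl//.
  move: (ae_int_le0 iu u0 ule); apply: ae_imp => t; rewrite uE.
  move=> + Et; rewrite mem_set//; case: Et => -[_ /= H] _; lra.
have : \forall t \ae mu, forall kN : int * nat, ~ E kN.1 kN.2 t.
  by apply: ae_forall => -[k N]; exact: Enull.
apply: ae_imp => t H; rewrite leNgt; apply/negP => gt.
pose k := cell b^-1 0 t.
apply: (H (k, (Num.truncn (sqc (g t))).+1)); split; [split|] => //=.
  have := eqxx k; rewrite {1}/k cellP ?invr_gt0// !add0r intrD mulrDl mul1r.
  by rewrite /J /= in_itv.
by apply: ltW; exact: truncnS_gt.
Qed.

End Countable.

(** * Convergence of the frame series *)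

Section InnerL2.
Context {R : realType}.
Local Notation mu := (@lebesgue_measure R).
Implicit Types f g h k : R -> R[i].

Lemma dot_innerZ k g z : L2 k -> L2 g -> dot k (fun t => z * g t) = dotc (inner k g) z.
Proof.
move=> k2 g2; rewrite inner_dot /dotc /= [X in X + _]mulrC [X in _ + X]mulrC.
have ig2 := L2Z 'i%C g2.
rewrite -(dotZr _ g2 k2) -(dotZr _ ig2 k2) -dotDr//; try exact: L2Z.
by congr dot; apply/funext => t; rewrite {1}(complexE z); ring.
Qed.

Lemma innerBZl (s : R) f k g : L2 f -> L2 k -> L2 g ->
  inner (fun t => f t - s%:C%C * k t) g = inner f g - s%:C%C * inner k g.
Proof.
move=> f2 k2 g2; have ig2 := L2Z 'i%C g2; have sk2 := L2Z s%:C%C k2.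
by rewrite !inner_dot !dotBl// !dotZl//; apply: eqc; rewrite !cE /=; ring.
Qed.

Lemma eq_ae_inner f g1 g2 : cmeasurable f -> cmeasurable g1 -> cmeasurable g2 ->
  g1 = g2 %[ae mu] -> inner f g1 = inner f g2.
Proof.
move=> mf m1 m2 /ae_eqE g12; rewrite !inner_dot; congr Complex; rewrite !(dotC f).
  by apply: eq_ae_dotl => //; exact/ae_eqE.
apply: eq_ae_dotl => //.
- by apply: cmeasM => //; exact: cmeas_cst.
- by apply: cmeasM => //; exact: cmeas_cst.
- by apply/ae_eqE; apply: ae_imp g12 => t ->.
Qed.

Lemma eq_ae_nrm f g : cmeasurable f -> cmeasurable g -> f = g %[ae mu] -> nrm f = nrm g.
Proof.
move=> mf mg fg; rewrite /nrm (eq_ae_dotl mf mg mf fg) dotC.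
exact: (eq_ae_dotl mf mg mg fg).
Qed.

(** The triangle inequality along a common finite set of indices. *)
Lemma unconditional_sum_unique (I : choiceType) (L : set I) (u : I -> R -> R[i]) f g :
  (forall i, L2 (u i)) -> L2 f -> L2 g ->
  unconditional_sum L u f -> unconditional_sum L u g -> f = g %[ae mu].
Proof.
move=> u2 f2 g2 uf ug; apply/(ae_nrm f2 g2); apply/eqP; rewrite eq_le nrm_ge0 andbT.
apply/ler_addgt0Pr => e e0; rewrite add0r.
have d0 : 0 < Num.sqrt (e / 4) by rewrite sqrtr_gt0 divr_gt0.
have d2 : Num.sqrt (e / 4) ^+ 2 = e / 4 by rewrite sqr_sqrtr// divr_ge0// ltW.
have [A1 A1L H1] := uf _ d0; have [A2 A2L H2] := ug _ d0.
pose A := (A1 `|` A2)%fset.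
have S2 : L2 (fun t => \sum_(i <- A) u i t) by exact: L2_sum.
have AL : [set` A] `<=` L.
  by move=> i /=; rewrite inE => /orP[]; [exact: A1L|exact: A2L].
have /(L2norm_lt (L2B f2 S2) d0) : (L2norm (fun t => f t - \sum_(i <- A) u i t)%R < (Num.sqrt (e / 4))%:E)%E.
  by apply: H1 => // i /= iA; rewrite inE iA.
have /(L2norm_lt (L2B g2 S2) d0) : (L2norm (fun t => g t - \sum_(i <- A) u i t)%R < (Num.sqrt (e / 4))%:E)%E.
  by apply: H2 => // i /= iA; rewrite inE iA orbT.
rewrite !d2 => G F.
have -> : (fun t => f t - g t) = (fun t => (f t - \sum_(i <- A) u i t) + - (g t - \sum_(i <- A) u i t)).
  by apply/funext => t; ring.
apply: le_trans (nrmD_le (L2B f2 S2) (L2N (L2B g2 S2))) _.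
have -> : nrm (fun t => - (g t - \sum_(i <- A) u i t)) = nrm (fun t => g t - \sum_(i <- A) u i t).
  by apply: eq_Rintegral => t _; rewrite -!/(sqc _) sqcN.
lra.
Qed.

Variables (I : choiceType) (e : I -> R -> R[i]) (T : (R -> R[i]) -> R -> R[i])
  (form : (R -> R[i]) -> (R -> R[i]) -> R) (B : R).
Hypotheses (e2 : forall i, L2 (e i)) (B0 : 0 < B) (T2 : forall f, L2 f -> L2 (T f))
  (Tform : forall f k, L2 f -> L2 k -> dot (T f) k = form f k)
  (esumE : forall f, L2 f ->
     (\esum_(i in [set: I]) (sqc (inner f (e i)))%:E = (form f f)%:E)%E)
  (formB : forall f, L2 f -> form f f <= B * nrm f)
  (formC : forall f k, form f k = form k f).

Lemma bessel_partial f (A : {fset I}) : L2 f ->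
  \sum_(i <- A) sqc (inner f (e i)) <= form f f.
Proof.
move=> f2; rewrite -lee_fin -esumE// -sumEFin; apply: esum_ge.
exists [set` A]; first by split => //; exact: finite_fset.
by rewrite fsbig_finite//= set_fsetK.
Qed.

Lemma form_sub (s : R) f k : L2 f -> L2 k ->
  form (fun t => f t - s%:C%C * k t) (fun t => f t - s%:C%C * k t) =
  form f f - 2 * s * form f k + s ^+ 2 * form k k.
Proof.
move=> f2 k2; have sk2 := L2Z s%:C%C k2; have fk2 := L2B f2 sk2.
have H u : L2 u -> form u (fun t => f t - s%:C%C * k t) = form u f - s * form u k.
  by move=> u2; have Tu := T2 u2; rewrite -!Tform// dotBr// dotZr.
have Hf : form (fun t => f t - s%:C%C * k t) f = form f f - s * form f k.
  by rewrite formC H.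
have Hk : form (fun t => f t - s%:C%C * k t) k = form f k - s * form k k.
  by rewrite formC H// (formC k f).
by rewrite H// Hf Hk; ring.
Qed.

(** The frame series of a Bessel system converges unconditionally to the
    operator of its form. Let E be the form minus the finite sum over A. It is
    positive semidefinite (bessel_partial) and bounded by B, and with D = T f
    minus the partial sum one has E(f, D) = |D|^2. Positivity of E at f - B^-1
    D gives |D|^2 <= B E(f, f), and E(f, f) is a tail of a convergent
    series. *)
Lemma frame_series_cvg f : L2 f ->
  unconditional_sum [set: I] (fun i t => inner f (e i) * e i t) (T f).
Proof.
move=> f2 eps eps0.
have d0 : 0 < eps ^+ 2 / B / 2 by rewrite !divr_gt0// exprn_gt0.
have [A0 A0d] : exists A0 : {fset I}, form f f - eps ^+ 2 / B / 2 < \sum_(i <- A0) sqc (inner f (e i)).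
  have : ((form f f - eps ^+ 2 / B / 2)%:E < \esum_(i in [set: I]) (sqc (inner f (e i)))%:E)%E.
    by rewrite esumE// lte_fin ltrBlDr ltrDl.
  case/ereal_sup_gt => _ [X [finX _] <-]; rewrite fsbig_finite//= sumEFin lte_fin.
  by exists (fset_set X).
exists A0 => // A A0A _.
pose S t := \sum_(i <- A) inner f (e i) * e i t.
have S2 : L2 S by apply: L2_sum => i _; exact: L2Z.
pose D t := T f t - S t.
have D2 : L2 D by apply: L2B => //; exact: T2.
apply/(L2norm_lt D2 eps0).
have x_le : form f f - \sum_(i <- A) sqc (inner f (e i)) < eps ^+ 2 / B / 2.
  rewrite ltrBlDr -ltrBlDl; apply: lt_le_trans A0d _.
  have sub : {subset A0 <= A} by move=> i; exact: A0A.
  rewrite (big_fsetID _ (mem A0) A)/=.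
  rewrite (_ : [fset i in A | i \in A0]%fset = A0); last first.
    by apply/fsetP => i; rewrite !inE; case: (boolP (i \in A0)) => [/sub ->|]; rewrite ?andbF.
  by rewrite lerDl sumr_ge0// => i _; exact: sqc_ge0.
have y_eq : nrm D = form f D - \sum_(i <- A) dotc (inner f (e i)) (inner D (e i)).
  rewrite {1}/nrm {1}/D dotBl//; last exact: T2.
  rewrite Tform//; congr (_ - _); rewrite /S dot_suml//; last by move=> i; exact: L2Z.
  by apply: eq_bigr => i _; rewrite dotC dot_innerZ// dotcC.
have z_le : form D D - \sum_(i <- A) sqc (inner D (e i)) <= B * nrm D.
  rewrite lerBlDr; apply: le_trans (formB D2) _.
  by rewrite lerDl sumr_ge0// => i _; exact: sqc_ge0.
have psd := bessel_partial A (L2B f2 (L2Z (B^-1)%:C%C D2)).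
rewrite form_sub// in psd.
have sumE : \sum_(i <- A) sqc (inner (fun t => f t - (B^-1)%:C%C * D t) (e i)) =
    \sum_(i <- A) sqc (inner f (e i))
    - 2 * B^-1 * \sum_(i <- A) dotc (inner f (e i)) (inner D (e i))
    + B^-1 ^+ 2 * \sum_(i <- A) sqc (inner D (e i)).
  rewrite !mulr_sumr -sumrN -!big_split /=; apply: eq_bigr => i _.
  by rewrite innerBZl// /sqc /dotc !cE /=; ring.
rewrite sumE in psd.
set x := \sum_(i <- A) _ in x_le psd; set y := \sum_(i <- A) _ in y_eq psd.
set z := \sum_(i <- A) _ in z_le psd.
have Bv : 0 < B^-1 by rewrite invr_gt0.
have H1 : B^-1 ^+ 2 * (form D D - z) <= B^-1 * nrm D.
  apply: le_trans (_ : B^-1 ^+ 2 * (B * nrm D) <= _).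
    by rewrite ler_wpM2l// exprn_ge0// ltW.
  by rewrite expr2 mulrA -(mulrA B^-1) mulVf ?gt_eqF// mulr1.
have H2 : B^-1 * nrm D <= form f f - x.
  have E2 : B^-1 * nrm D = B^-1 * form f D - B^-1 * y by rewrite y_eq; ring.
  rewrite mulrBr in H1; rewrite E2; rewrite E2 in H1; lra.
have : nrm D <= B * (form f f - x) by rewrite -ler_pdivrMl.
move=> H3; apply: le_lt_trans H3 _.
apply: (@lt_le_trans _ _ (B * (eps ^+ 2 / B))).
  rewrite ltr_pM2l//; apply: lt_trans x_le _.
  by rewrite ltr_pdivrMr// ltr_pMr ?ltr1n// divr_gt0// exprn_gt0.
by rewrite mulrC divfK// gt_eqF.
Qed.

End InnerL2.

(** * Jacobi matrices and their finite windows *)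

Section Fiber.
Context {R : realType}.
Variables (h A : R) (p q s : int -> R[i]).
Implicit Types (u v f : int -> R[i]) (k l lo hi m : int).

Definition jacL u k := p k * u k + q k * u (k + 1).
Definition jacD k := h%:C%C * (conjc (p k) * p k + conjc (q (k - 1)) * q (k - 1) + conjc (s k) * s k).
Definition jacU k := h%:C%C * (conjc (p k) * q k).

(** The Jacobi (Hermitian tridiagonal) matrix h (L^* L + s^* s), where L u k =
    p k * u k + q k * u (k + 1). The diagonal is jacD and the entry that links
    k and k + 1 is jacU k. *)
Definition jac u k := jacD k * u k + jacU k * u (k + 1) + conjc (jacU (k - 1)) * u (k - 1).

Lemma jacE u k : jac u k = h%:C%C * (conjc (p k) * jacL u k
  + conjc (q (k - 1)) * jacL u (k - 1) + conjc (s k) * (s k * u k)).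
Proof.
rewrite /jac /jacD /jacU /jacL subrK !conjcM conjcK (_ : conjc h%:C%C = h%:C%C).
  by ring.
by apply: eqc; rewrite /= ?oppr0.
Qed.

(** Summation by parts; the boundary terms vanish because u vanishes at both
    ends. *)
Lemma jac_energy u m (N : nat) : u m = 0 -> u (m + N.+1%:Z) = 0 ->
  \sum_(j < N.+1) dotc (jac u (m + j%:Z)) (u (m + j%:Z)) =
  h * \sum_(j < N.+1) (sqc (jacL u (m + j%:Z)) + sqc (s (m + j%:Z) * u (m + j%:Z))).
Proof.
move=> um uN.
pose a k := dotc (jacL u k) (p k * u k).
pose a' k := dotc (jacL u k) (q k * u (k + 1)).
have E k : dotc (jac u k) (u k) = h * (a k + a' (k - 1) + sqc (s k * u k)).
  rewrite jacE /a /a' subrK; move: (jacL u k) (jacL u (k - 1)) => x y.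
  by rewrite /sqc /dotc !cE /=; ring.
have E2 k : sqc (jacL u k) = a k + a' k.
  by rewrite /a /a' /sqc {2 4}/jacL /dotc !cE; ring.
have Z1 : a' (m - 1) = 0.
  by rewrite /a' subrK um mulr0 dotcC dotc0l.
have Z2 : a' (m + N%:Z) = 0.
  by rewrite /a' -addrA -[N%:Z + 1](_ : N.+1%:Z = _) ?uN ?mulr0 1?dotcC ?dotc0l// -addn1 PoszD.
clearbody a a'.
under eq_bigr do rewrite E; under [in RHS]eq_bigr do rewrite E2.
rewrite -mulr_sumr !big_split /=; congr (_ * (_ + _ + _)).
rewrite big_ord_recl [RHS]big_ord_recr /= addr0 Z1 Z2 add0r addr0.
by apply: eq_bigr => i _; congr a'; rewrite /bump /= add1n -addn1 PoszD; ring.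
Qed.

(** The lower frame bound on one orbit, for sequences that vanish off a finite
    interval. Only the values at m, ..., m + N.+1 enter, and the two end
    values are zero. *)
Definition good := forall m (N : nat) u, u m = 0 -> u (m + N.+1%:Z) = 0 ->
  A * \sum_(j < N.+1) sqc (u (m + j%:Z)) <=
  h * \sum_(j < N.+1) (sqc (jacL u (m + j%:Z)) + sqc (s (m + j%:Z) * u (m + j%:Z))).

Lemma int_between lo hi k : lo <= k <= hi -> exists2 j : 'I_(`|hi - lo|%N.+2), k = lo - 1 + j%:Z & (0 < j)%N.
Proof.
move=> /andP[lk kh]; have H : (`|k - lo|%N.+1 < `|hi - lo|%N.+2)%N by lia.
by exists (Ordinal H) => //=; lia.
Qed.

Hypotheses (A0 : 0 < A) (hgood : good).

Lemma good_energy u m N : u m = 0 -> u (m + N.+1%:Z) = 0 ->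
  A * \sum_(j < N.+1) sqc (u (m + j%:Z)) <=
  \sum_(j < N.+1) dotc (jac u (m + j%:Z)) (u (m + j%:Z)).
Proof. by move=> um uN; rewrite jac_energy//; exact: hgood. Qed.

Lemma jac_uniq u lo hi : (forall k, ~~ (lo <= k <= hi) -> u k = 0) ->
  (forall k, lo <= k <= hi -> jac u k = 0) -> forall k, u k = 0.
Proof.
move=> u0 ju0 k; have [lkh|/u0//] := boolP (lo <= k <= hi).
pose N := `|hi - lo|%N.+1.
have um : u (lo - 1) = 0 by apply: u0; lia.
have uN : u (lo - 1 + N.+1%:Z) = 0 by apply: u0; rewrite /N; lia.
have := good_energy um uN.
rewrite [leRHS]big1; last first.
  move=> j _; have [/ju0 ->|/u0 ->] := boolP (lo <= lo - 1 + j%:Z <= hi).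
    by rewrite dotc0l.
  by rewrite dotcC dotc0l.
rewrite pmulr_rle0// => S0.
have [j kj _] := int_between lkh.
apply: sqc_eq0; apply/eqP; rewrite eq_le sqc_ge0 andbT; apply: le_trans S0.
rewrite kj (bigD1 j)//= lerDl sumr_ge0// => i _; exact: sqc_ge0.
Qed.

(** If the links to both sides of the block lo..hi vanish, the block decouples
    from the rest of the matrix, and coercivity makes it injective. *)
Lemma jac_block_eq u v lo hi : jacU (lo - 1) = 0 -> jacU hi = 0 ->
  (forall k, lo <= k <= hi -> jac u k = jac v k) ->
  forall k, lo <= k <= hi -> u k = v k.
Proof.
move=> Ulo Uhi juv k lkh.
pose w k := if lo <= k <= hi then u k - v k else 0.
have w0 : forall k, w k = 0.
  apply: (@jac_uniq w lo hi); first by move=> j /negPf H; rewrite /w H.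
  move=> j jlh; have := juv j jlh; rewrite /jac => E.
  have H1 : jacU j * w (j + 1) = jacU j * (u (j + 1) - v (j + 1)).
    rewrite /w; case: ifPn => // nj; have -> : j = hi by lia.
    by rewrite Uhi !mul0r.
  have H2 : conjc (jacU (j - 1)) * w (j - 1) = conjc (jacU (j - 1)) * (u (j - 1) - v (j - 1)).
    rewrite /w; case: ifPn => // nj; have -> : j = lo by lia.
    by rewrite Ulo conjc0E !mul0r.
  rewrite H1 H2 /w jlh !mulrBr.
  by move/eqP: E; rewrite -subr_eq0 => /eqP <-; ring.
by have := w0 k; rewrite /w lkh => /eqP; rewrite subr_eq0 => /eqP.
Qed.

End Fiber.

Section Window.
Context {R : realType}.
Variables (h A : R) (K : nat).
Local Notation n := (2 * K)%N.+1.
Implicit Types (u v f p q s : int -> R[i]) (k l lo hi m : int).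

Definition widx (i : 'I_n) : int := i%:Z - K%:Z.
Lemma widxP i : - K%:Z <= widx i <= K%:Z.
Proof. by have := ltn_ord i; rewrite /widx; lia. Qed.
Lemma widx_inj : injective widx.
Proof. by move=> i j; rewrite /widx => /addIr [] /val_inj. Qed.
Lemma widx_surj k : - K%:Z <= k <= K%:Z -> exists i, widx i = k.
Proof.
move=> kK; have H : (`|(k + K%:Z)%R|%N < n)%N by lia.
by exists (Ordinal H); rewrite /widx /=; lia.
Qed.

Definition jcoef p q s k l := jacD h p q s k * (l == k)%:R
  + jacU h p q k * (l == k + 1)%:R + conjc (jacU h p q (k - 1)) * (l == k - 1)%:R.

Definition winmx p q s : 'M[R[i]]_n := \matrix_(i, j) jcoef p q s (widx i) (widx j).

Lemma sum_window u k : (forall l, ~~ (- K%:Z <= l <= K%:Z) -> u l = 0) ->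
  \sum_(j < n) (widx j == k)%:R * u (widx j) = u k.
Proof.
move=> u0; have [/widx_surj [i <-]|kK] := boolP (- K%:Z <= k <= K%:Z).
  rewrite (bigD1 i)//= eqxx mul1r big1 ?addr0// => j ji.
  by rewrite (inj_eq widx_inj) (negPf ji) mul0r.
rewrite u0// big1// => j _; case: eqP => [E|_]; last by rewrite mul0r.
by move: kK; rewrite -E widxP.
Qed.

Lemma sum_jcoef p q s u k : (forall l, ~~ (- K%:Z <= l <= K%:Z) -> u l = 0) ->
  \sum_(j < n) jcoef p q s k (widx j) * u (widx j) = jac h p q s u k.
Proof.
move=> u0; have H l := sum_window l u0.
rewrite /jac -(H k) -(H (k + 1)) -(H (k - 1)) !mulr_sumr -!big_split /=.
by apply: eq_bigr => j _; rewrite /jcoef; ring.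
Qed.

Definition wext (x : 'cV[R[i]]_n) k : R[i] :=
  if - K%:Z <= k <= K%:Z then x (inord `|(k + K%:Z)%R|%N) 0 else 0.

Lemma wext_widx x i : wext x (widx i) = x i 0.
Proof.
rewrite /wext widxP (_ : inord _ = i)//; apply: val_inj => /=.
by rewrite inordK; have := ltn_ord i; rewrite /widx; lia.
Qed.

Lemma wext_out x k : ~~ (- K%:Z <= k <= K%:Z) -> wext x k = 0.
Proof. by rewrite /wext => /negPf ->. Qed.

Lemma winmx_mul p q s x i : (winmx p q s *m x) i 0 = jac h p q s (wext x) (widx i).
Proof.
rewrite mxE -sum_jcoef; last exact: wext_out.
by apply: eq_bigr => j _; rewrite mxE wext_widx.
Qed.

Definition wsolve p q s f : 'cV[R[i]]_n := invmx (winmx p q s) *m (\col_i f (widx i)).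

Definition wmid : 'I_n := inord K.
Lemma widx_mid : widx wmid = 0.
Proof. by rewrite /widx /wmid inordK; lia. Qed.

(** The middle row of the inverse of the window matrix. It computes the value
    at the centre of the solution on the window. *)
Definition winv p q s (j : 'I_n) : R[i] := invmx (winmx p q s) wmid j.

Lemma wext0 p q s f : wext (wsolve p q s f) 0 = \sum_(j < n) winv p q s j * f (widx j).
Proof.
rewrite -widx_mid wext_widx mxE; apply: eq_bigr => j _.
by rewrite mxE.
Qed.

Hypothesis A0 : 0 < A.

Lemma winmx_unit p q s : good h A p q s -> winmx p q s \in unitmx.
Proof.
move=> hg; rewrite unitmxE unitfE -det_tr; apply/negP => /det0P [v v0 vM].
have Mv : winmx p q s *m v^T = 0.
  by apply: trmx_inj; rewrite trmx_mul trmxK vM trmx0.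
move/negP: v0; apply; apply/eqP/rowP => i; rewrite mxE.
have <- : wext v^T (widx i) = v 0 i by rewrite wext_widx mxE.
apply: (jac_uniq A0 hg (lo := - K%:Z) (hi := K%:Z)); first exact: wext_out.
move=> k /widx_surj [j <-]; rewrite -winmx_mul Mv mxE //.
Qed.

Lemma wsolveP p q s f k : good h A p q s -> - K%:Z <= k <= K%:Z ->
  jac h p q s (wext (wsolve p q s f)) k = f k.
Proof.
move=> hg /widx_surj [i <-]; rewrite -winmx_mul /wsolve mulmxA mulmxV ?winmx_unit//.
by rewrite mul1mx mxE.
Qed.

Definition broken p q k := jacU h p q k = 0.

(** The solution on the window and the sequence f satisfy the same equations
    on the block of 0, so they agree there, although the window truncates
    f. *)
Lemma winv_left p q s f lo hi : good h A p q s ->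
  - K%:Z <= lo <= 0 -> 0 <= hi <= K%:Z -> broken p q (lo - 1) -> broken p q hi ->
  \sum_(j < n) winv p q s j * jac h p q s f (widx j) = f 0.
Proof.
move=> hg lo0 hi0 blo bhi; rewrite -wext0.
apply: (jac_block_eq A0 hg blo bhi); last lia.
by move=> k klh; rewrite wsolveP//; lia.
Qed.

(** Solve for a right-hand side concentrated at a point outside the block of
    0: on that block the solution satisfies the homogeneous equations. *)
Lemma winv_chain p q s lo hi i : good h A p q s ->
  - K%:Z <= lo <= 0 -> 0 <= hi <= K%:Z -> broken p q (lo - 1) -> broken p q hi ->
  ~~ (lo <= widx i <= hi) -> winv p q s i = 0.
Proof.
move=> hg lo0 hi0 blo bhi ni.
pose f k : R[i] := (k == widx i)%:R.
have -> : winv p q s i = wext (wsolve p q s f) 0.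
  rewrite wext0 (bigD1 i)//= /f eqxx mulr1 big1 ?addr0// => j ji.
  by rewrite (inj_eq widx_inj) (negPf ji) mulr0.
have jac0 k : jac h p q s (fun=> 0) k = 0 by rewrite /jac !mulr0 !addr0.
apply: (jac_block_eq A0 hg (v := fun=> 0) blo bhi); last lia.
move=> k klh; rewrite wsolveP ?jac0; [|exact: hg|lia].
by rewrite /f; case: eqP => // E; move: ni; rewrite -E klh.
Qed.

(** Let u solve the window system for a unit vector at index i, and let S be
    its squared norm. Coercivity gives A S <= Re (u i) <= sqrt S, hence S <=
    A^-2. *)
Lemma winv_bound p q s i : good h A p q s -> sqc (winv p q s i) <= A ^- 2.
Proof.
move=> hg; pose f k : R[i] := (k == widx i)%:R.
have -> : winv p q s i = wext (wsolve p q s f) 0.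
  rewrite wext0 (bigD1 i)//= /f eqxx mulr1 big1 ?addr0// => j ji.
  by rewrite (inj_eq widx_inj) (negPf ji) mulr0.
pose u := wext (wsolve p q s f).
(* The interval is one larger than the window on the left, so that u vanishes
   at both of its ends. *)
pose m := - K%:Z - 1.
have um : u m = 0 by apply: wext_out; rewrite /m; lia.
have uN : u (m + (2 * K)%N.+2%:Z) = 0 by apply: wext_out; rewrite /m; lia.
have := good_energy hg um uN.
set S := \sum_(j < _) sqc _.
have -> : \sum_(j < (2 * K)%N.+2) dotc (jac h p q s u (m + j%:Z)) (u (m + j%:Z)) =
    complex.Re (u (widx i)).
  rewrite big_ord_recl /= addr0 um dotcC dotc0l add0r (bigD1 i)//=.
  have E (j : 'I_n) : m + (bump 0 j)%:Z = widx j.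
    by rewrite /m /widx /bump; lia.
  rewrite [X in _ + X]big1; last first.
    move=> j ji; rewrite E wsolveP ?widxP// /f (inj_eq widx_inj) (negPf ji).
    by rewrite mulr0n dotc0l.
  by rewrite addr0 E wsolveP ?widxP// /f eqxx /dotc /= mul1r mul0r addr0.
have le_S k : - K%:Z <= k <= K%:Z -> sqc (u k) <= S.
  move=> kK; have H : (`|k - m|%N < (2 * K)%N.+2)%N by rewrite /m; lia.
  rewrite /S (bigD1 (Ordinal H))//=; have -> : m + `|k - m|%N%:Z = k by rewrite /m; lia.
  by rewrite lerDl sumr_ge0// => j _; exact: sqc_ge0.
move=> AS; apply: (@le_trans _ _ S); first by apply: le_S; lia.
have S0 : 0 <= S by apply: sumr_ge0 => j _; exact: sqc_ge0.
have := le_S _ (widxP i); rewrite {1}/sqc /dotc -!expr2 => uS.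
have uS' : complex.Re (u (widx i)) ^+ 2 <= S by apply: le_trans uS; rewrite lerDl sqr_ge0.
have : (A * S) ^+ 2 <= S.
  apply: le_trans uS'; rewrite lerXn2r// nnegrE ?mulr_ge0 ?(ltW A0)//.
  exact: le_trans (mulr_ge0 (ltW A0) S0) AS.
have [->|Sn0] := eqVneq S 0; first by rewrite invr_ge0 exprn_ge0// ltW.
have Sp : 0 < S by rewrite lt_def Sn0.
rewrite exprMn [S ^+ 2]expr2 mulrA -[leRHS]mul1r ler_pM2r// => AS1.
by rewrite -div1r ler_pdivlMr ?exprn_gt0// mulrC.
Qed.

End Window.

(** * Coercivity on almost every orbit *)

Section Tiling.
Context {R : realType}.
Local Notation mu := (@lebesgue_measure R).
Local Notation mfun := (measurable_fun [set: R]).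
Local Notation integ F := (mu.-integrable [set: R] (EFin \o F)).
Variables (b al : R) (E : set R) (m : int) (N : nat).
Hypotheses (b0 : 0 < b) (mE : measurable E) (EJ : E `<=` J b al).
Local Notation h := (b^-1).

Definition sh (j : nat) : R := (m + j%:Z)%:~R * h.

Lemma shS j : sh j.+1 = sh j + h.
Proof.
have jS : (m + j.+1%:Z)%:~R = (m + j%:Z)%:~R + 1 :> R.
  by rewrite (_ : m + j.+1%:Z = m + j%:Z + 1) ?[LHS]intrD//; lia.
by rewrite /sh jS mulrDl mul1r.
Qed.

Lemma tile_uniq (i j : nat) t : E (t - sh i) -> E (t - sh j) -> i = j.
Proof.
have h0 : 0 < h by rewrite invr_gt0.
move=> /EJ + /EJ; rewrite /J /= !in_itv /= => /andP[i1 i2] /andP[j1 j2].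
have lt1 (k l : nat) : sh k - sh l < h -> (k <= l)%N.
  rewrite /sh -mulrBl -[X in _ < X]mul1r ltr_pM2r// -intrB -[1]/(1%:~R) ltr_int; lia.
by apply/eqP; rewrite eqn_leq; apply/andP; split; apply: lt1; lra.
Qed.

Lemma tile_fin : (mu E < +oo)%E.
Proof.
apply: le_lt_trans (muJ_fin al b0).
by apply: le_measure; rewrite ?inE; [exact: mE|exact: measJ|].
Qed.

(** A function carried by translates of E by distinct multiples of h is
    integrated by summing along the orbits of the points of E. *)
Lemma integral_tile (Psi : R -> R) : integ Psi ->
  (forall t, Psi t != 0 -> exists2 j, (j < N)%N & E (t - sh j)) ->
  \int[mu]_t Psi t = \int[mu]_t (\1_E t * \sum_(j < N) Psi (t + sh j)).
Proof.
move=> iPsi Psi0.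
pose G (j : nat) t := \1_E (t - sh j) * Psi t.
have mPsi : mfun Psi by apply/measurable_EFinP; exact: measurable_int iPsi.
have m1E : mfun (\1_E : R -> R) by exact: measurable_indic.
have iG j : integ (G j).
  apply: (@integ_le _ (G j) (fun t => `|Psi t|)); last exact: integrable_norm iPsi.
    by apply: mfunM => //; exact: (measurableT_comp m1E (measurable_shift (- sh j))).
  move=> t; rewrite /G normrM ler_piMl// indicE.
  by case: (_ \in _) => /=; rewrite ?normr1 ?normr0.
have iG' j : integ (fun t => \1_E t * Psi (t + sh j)).
  have -> : (fun t => \1_E t * Psi (t + sh j)) = (fun t => G j (t + sh j)).
    by apply/funext => t; rewrite /G addrK.
  exact: integ_shift (iG j).
have PsiE t : Psi t = \sum_(j < N) G j t.
  have [P0|/Psi0 [j jN Ej]] := eqVneq (Psi t) 0.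
    by rewrite big1// => j _; rewrite /G P0 mulr0.
  rewrite (bigD1 (Ordinal jN))//= /G indicE mem_set// mul1r big1 ?addr0// => i ij.
  rewrite indicE memNset ?mul0r// => Ei; move/eqP: ij; apply; apply: val_inj => /=.
  exact: tile_uniq Ei Ej.
have sumint (n : nat) (H : nat -> R -> R) : (forall j, integ (H j)) ->
    integ (fun t => \sum_(j < n) H j t) /\
    \int[mu]_t (\sum_(j < n) H j t) = \sum_(j < n) \int[mu]_t H j t.
  move=> iH; elim: n => [|n [IH1 IH2]].
    split.
      by under eq_fun do rewrite big_ord0; exact: integrable0.
    rewrite (@eq_Rintegral _ _ _ _ _ (fun=> 0)); last by move=> t _; rewrite big_ord0.
    by rewrite big_ord0 /Rintegral integral0.
  split.
    by under eq_fun do rewrite big_ord_recr; exact: integD.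
  transitivity (\int[mu]_t (\sum_(j < n) H j t + H n t)).
    by apply: eq_Rintegral => t _; rewrite big_ord_recr.
  by rewrite RintegralD// IH2 big_ord_recr.
transitivity (\int[mu]_t (\sum_(j < N) G j t)).
  by apply: eq_Rintegral => t _; exact: PsiE.
transitivity (\int[mu]_t (\sum_(j < N) \1_E t * Psi (t + sh j))); last first.
  by apply: eq_Rintegral => t _; rewrite mulr_sumr.
rewrite (sumint N G iG).2 (sumint N (fun j t => \1_E t * Psi (t + sh j)) iG').2.
apply: eq_bigr => j _; rewrite -(Rintegral_shift (sh j) (iG j)).
by apply: eq_Rintegral => t _; rewrite /G addrK.
Qed.

Variable y : nat -> R[i].
Hypotheses (y0 : y 0%N = 0) (yN : y N = 0).

(** The test function with the values y on the successive translates of E: on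
    the orbit of a point of E it is the sequence y. *)
Definition tilef t := \sum_(j < N) y j * ic E (t - sh j).

Lemma L2_tilef : L2 tilef.
Proof.
apply: L2_sum => j _; apply: L2Z; apply: (L2_shift (- sh j)).
by apply: L2_ic => //; exact: tile_fin.
Qed.

Lemma tilef_in j t : (j <= N)%N -> E t -> tilef (t + sh j) = y j.
Proof.
move=> jN Et; have Ej i : E (t + sh j - sh i) -> j = i.
  by move=> Ei; apply: (@tile_uniq j i (t + sh j)); rewrite ?addrK.
rewrite /tilef; move: jN; rewrite leq_eqVlt => /orP[/eqP jN|jN].
  rewrite big1; first by rewrite jN yN.
  move=> i _; rewrite icE memNset ?mulr0// => Ei.
  by have := ltn_ord i; rewrite -(Ej _ Ei) jN ltnn.
rewrite (bigD1 (Ordinal jN))//= addrK icE mem_set// mulr1 big1 ?addr0// => i ij.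
rewrite icE memNset ?mulr0// => Ei; move/eqP: ij; apply; apply: val_inj.
exact: (esym (Ej _ Ei)).
Qed.

Lemma tilef_supp t : tilef t != 0 -> exists2 j, (0 < j < N)%N & E (t - sh j).
Proof.
move=> ft; apply: contrapT => nE; move/eqP: ft; apply.
rewrite /tilef big1// => -[j jN] _ /=; case: j jN => [|j] jN; first by rewrite y0 mul0r.
by rewrite icE memNset ?mulr0// => Ej; apply: nE; exists j.+1.
Qed.

Variables (P Q S : R -> R[i]) (C : R).
Hypotheses (mP : cmeasurable P) (mQ : cmeasurable Q) (mS : cmeasurable S).
Hypotheses (PC : forall t, sqc (P t) <= C) (QC : forall t, sqc (Q t) <= C)
  (SC : forall t, sqc (S t) <= C).

Definition fiber_form t : R := \sum_(j < N)
  (sqc (P (t + sh j) * y j + Q (t + sh j) * y j.+1) + sqc (S (t + sh j) * y j)).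

Lemma form_tilef : form h P Q S tilef tilef = \int[mu]_t (\1_E t * (h * fiber_form t)).
Proof.
have f2 := L2_tilef; have L2f := L2_opL h mP mQ PC QC f2.
have M2f := L2_opM mS SC f2.
have iLM : integ (fun t => sqc (opL h P Q tilef t) + sqc (opM S tilef t)).
  by apply: integD; exact: L2_sq.
have -> : form h P Q S tilef tilef =
    h * \int[mu]_t (sqc (opL h P Q tilef t) + sqc (opM S tilef t)).
  by rewrite /form RintegralD//; exact: L2_sq.
rewrite -RintegralZl// integral_tile; last 2 first.
- exact: integZ.
- move=> t Psi0.
  have : tilef t != 0 \/ tilef (t + h) != 0.
    have [t1|t1] := eqVneq (tilef t) 0; last by left.
    have [t2|t2] := eqVneq (tilef (t + h)) 0; last by right.
    by move: Psi0; rewrite /opL /opM t1 t2 !mulr0 addr0 sqc0 addr0 mulr0 eqxx.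
  case=> /tilef_supp [j /andP[j0 jN] Ej]; first by exists j.
  case: j j0 jN Ej => // j _ jN Ej; exists j; first exact: ltnW.
  by move: Ej; rewrite shS opprD addrACA [h - h]subrr addr0.
apply: eq_Rintegral => t _; rewrite indicE.
case: (boolP (t \in E)) => [|_] /=; last by rewrite !mul0r.
rewrite inE => Et; congr (_ * _); rewrite /fiber_form mulr_sumr.
apply: eq_bigr => j _; congr (_ * _).
have tS : t + sh j + h = t + sh j.+1 by rewrite shS addrA.
by rewrite /opL /opM (tilef_in (ltnW (ltn_ord j)) Et) tS (tilef_in (ltn_ord j) Et).
Qed.

Lemma nrm_tilef : nrm tilef = \int[mu]_t (\1_E t * \sum_(j < N) sqc (y j)).
Proof.
have f2 := L2_tilef.
rewrite /nrm /dot integral_tile; last 2 first.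
- exact: (L2_sq f2).
- move=> t ft; have [j /andP[_ jN] Ej] : exists2 j, (0 < j < N)%N & E (t - sh j).
    apply: tilef_supp; apply: contra ft => /eqP ->; rewrite -/(sqc _) sqc0 //.
  by exists j.
apply: eq_Rintegral => t _; rewrite indicE.
case: (boolP (t \in E)) => [|_] /=; last by rewrite !mul0r.
rewrite inE => Et; congr (_ * _).
by apply: eq_bigr => j _; rewrite -/(sqc _) (tilef_in (ltnW (ltn_ord j)) Et).
Qed.

Lemma measurable_fiber_form : mfun fiber_form.
Proof.
have mc (k : R -> R[i]) j : cmeasurable k -> cmeasurable (fun t => k (t + sh j)).
  by move=> mk; apply: cmeas_comp mk; exact: measurable_shift.
rewrite /fiber_form; elim: N => [|n IH].
  by under eq_fun do rewrite big_ord0; exact: measurable_cst.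
under eq_fun do rewrite big_ord_recr /=; apply: mfunD => //; apply: mfunD.
  apply: measurable_sqc; apply: cmeasD; apply: cmeasM; try exact: cmeas_cst; exact: mc.
by apply: measurable_sqc; apply: cmeasM; [exact: mc|exact: cmeas_cst].
Qed.

Lemma fiber_form_ge0 t : 0 <= fiber_form t.
Proof. by apply: sumr_ge0 => j _; rewrite addr_ge0// sqc_ge0. Qed.

End Tiling.

Section GoodFiber.
Context {R : realType}.
Local Notation mu := (@lebesgue_measure R).
Local Notation mfun := (measurable_fun [set: R]).
Local Notation integ F := (mu.-integrable [set: R] (EFin \o F)).
Variables (b A C : R) (P Q S : R -> R[i]).
Hypotheses (b0 : 0 < b) (A0 : 0 < A).
Hypotheses (mP : cmeasurable P) (mQ : cmeasurable Q) (mS : cmeasurable S).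
Hypotheses (PC : forall t, sqc (P t) <= C) (QC : forall t, sqc (Q t) <= C)
  (SC : forall t, sqc (S t) <= C).
Local Notation h := (b^-1).
Hypothesis lower : forall f, L2 f -> A * nrm f <= form h P Q S f f.

(** Let E be the part of one period where the inequality fails. On the test
    function tilef the lower frame bound is that inequality integrated over E,
    where it fails pointwise, so E is null. *)
Lemma fiber_ae m N (y : nat -> R[i]) : y 0%N = 0 -> y N = 0 ->
  \forall t \ae mu, A * \sum_(j < N) sqc (y j) <= h * fiber_form b m N y P Q S t.
Proof.
move=> y0 yN.
have h0 : 0 < h by rewrite invr_gt0.
pose w t := A * (\sum_(j < N) sqc (y j)) - h * fiber_form b m N y P Q S t.
have mw : mfun w.
  apply: measurable_funB; first exact: measurable_cst.
  apply: mfunM; [exact: measurable_cst|exact: measurable_fiber_form].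
have key (l : int) : \forall t \ae mu, J b (l%:~R * h) t -> w t <= 0.
  pose E := J b (l%:~R * h) `&` [set t | 0 < w t].
  have mE : measurable E.
    apply: measurableI; first exact: measJ.
    have := mw; move=> /(_ measurableT _ (measurable_itv `]0, +oo[)).
    rewrite setTI (_ : _ @^-1` _ = [set t | 0 < w t])//.
    by apply/seteqP; split=> t /=; rewrite in_itv/= andbT.
  have EJ : E `<=` J b (l%:~R * h) by move=> t [].
  have Efin := tile_fin b0 mE EJ.
  have f2 := L2_tilef m N b0 mE EJ y.
  have := lower f2.
  rewrite (nrm_tilef m b0 mE EJ y0 yN) (form_tilef m b0 mE EJ y0 yN mP mQ mS PC QC SC).
  have i1 := integ_ic mE Efin.
  pose k1 t := \1_E t * (\sum_(j < N) sqc (y j)).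
  pose k2 t := \1_E t * (h * fiber_form b m N y P Q S t).
  have S0 : 0 <= \sum_(j < N) sqc (y j) by apply: sumr_ge0 => j _; exact: sqc_ge0.
  have ik1 : integ k1.
    have := integZ (\sum_(j < N) sqc (y j)) i1.
    by apply: eq_integrable => // t _; rewrite /k1 /= mulrC.
  have ik2 : integ k2.
    apply: (@integ_le _ _ (fun t => A * k1 t)); last exact: integZ.
      apply: mfunM; first exact: measurable_indic.
      by apply: mfunM; [exact: measurable_cst|exact: measurable_fiber_form].
    move=> t; rewrite /k1 /k2 indicE; case: (boolP (t \in E)) => [|_] /=; last first.
      by rewrite !mul0r normr0 mulr0.
    rewrite inE => -[_ /=]; rewrite !mul1r ger0_norm; first by rewrite /w; lra.
    by rewrite mulr_ge0 ?(ltW h0)// fiber_form_ge0.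
  rewrite -RintegralZl// => Ele.
  have iv : integ (fun t => A * k1 t - k2 t).
    by have := integrableB measurableT (integZ A ik1) ik2; apply: eq_integrable.
  have vE t : A * k1 t - k2 t = if t \in E then w t else 0.
    rewrite /k1 /k2 indicE /w; case: (t \in E) => /=; first by rewrite !mul1r.
    by rewrite !mul0r mulr0 subr0.
  have v0 t : 0 <= A * k1 t - k2 t.
    by rewrite vE; case: ifPn => //; rewrite inE => -[_ /= /ltW].
  have vle : \int[mu]_t (A * k1 t - k2 t) <= 0.
    by rewrite RintegralB// ?subr_le0//; exact: integZ.
  move: (ae_int_le0 iv v0 vle); apply: ae_imp => t; rewrite vE => + Jt.
  case: ifPn => [_ ->//|]; rewrite notin_setE => nE _.
  by rewrite leNgt; apply/negP => wt; apply: nE.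
have : \forall t \ae mu, forall l : int, J b (l%:~R * h) t -> w t <= 0 by exact: ae_forall.
apply: ae_imp => t Ht; rewrite -subr_le0.
apply: (Ht (cell h 0 t)).
have := eqxx (cell h 0 t); rewrite cellP// !add0r intrD mulrDl mul1r.
by rewrite /J /= in_itv.
Qed.

Definition cvgc (z : nat -> R[i]) (w : R[i]) :=
  (fun n => complex.Re (z n)) @ \oo --> complex.Re w /\
  (fun n => complex.Im (z n)) @ \oo --> complex.Im w.

Lemma cvgc_cst w : cvgc (fun=> w) w.
Proof. by split; exact: cvg_cst. Qed.

Lemma cvgcD z1 z2 w1 w2 : cvgc z1 w1 -> cvgc z2 w2 -> cvgc (fun n => z1 n + z2 n) (w1 + w2).
Proof.
move=> [a1 b1] [a2 b2]; split; rewrite ?cReD ?cImD.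
  by under eq_fun do rewrite cReD; apply: cvgD.
by under eq_fun do rewrite cImD; apply: cvgD.
Qed.

Lemma cvgcM z1 z2 w1 w2 : cvgc z1 w1 -> cvgc z2 w2 -> cvgc (fun n => z1 n * z2 n) (w1 * w2).
Proof.
move=> [a1 b1] [a2 b2]; split; rewrite ?cReM ?cImM.
  by under eq_fun do rewrite cReM; apply: cvgB; apply: cvgM.
by under eq_fun do rewrite cImM; apply: cvgD; apply: cvgM.
Qed.

Lemma cvg_sqc z w : cvgc z w -> (fun n => sqc (z n)) @ \oo --> sqc w.
Proof. by move=> [a1 b1]; apply: cvgD; apply: cvgM. Qed.

Lemma rat_seq (x : R) : exists r : nat -> rat, (fun n => ratr (r n) : R) @ \oo --> x.
Proof.
have H (n : nat) : exists r : rat, x < ratr r < x + n.+1%:R^-1.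
  have xn : x < x + n.+1%:R^-1 by rewrite ltrDl invr_gt0.
  by have [r] := rat_in_itvoo xn; rewrite in_itv /=; exists r.
have [r rP] := choice H; exists r.
apply: (@squeeze_cvgr _ _ _ _ (cst x) (fun n => x + n.+1%:R^-1)).
- by apply: nearW => n; have /andP[r1 r2] := rP n; rewrite !ltW.
- exact: cvg_cst.
- have := cvgD (cvg_cst x) (@cvg_harmonic R); rewrite addr0; apply.
Qed.

(** For each of the countably many sequences with rational coordinates the
    inequality holds off a null set; off the union of these sets it passes to
    all sequences by continuity in the finitely many entries. *)
Lemma good_ae : \forall t \ae mu, good h A (fun k => P (t + k%:~R * h))
  (fun k => Q (t + k%:~R * h)) (fun k => S (t + k%:~R * h)).
Proof.
pose qc (x : rat * rat) : R[i] := Complex (ratr x.1) (ratr x.2).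
pose ys (N : nat) (s : seq (rat * rat)) (j : nat) : R[i] :=
  if (0 < j < N)%N then qc (nth (0, 0) s j) else 0.
have ys0 N s : ys N s 0%N = 0 by [].
have ysN N s : ys N s N = 0 by rewrite /ys ltnn andbF.
have : \forall t \ae mu, forall I : int * nat * seq (rat * rat),
    A * \sum_(j < I.1.2) sqc (ys I.1.2 I.2 j) <=
    h * fiber_form b I.1.1 I.1.2 (ys I.1.2 I.2) P Q S t.
  by apply: ae_forall => -[[m N] s]; exact: fiber_ae.
apply: ae_imp => t Ht m N u um uN.
pose y j := u (m + j%:Z).
have yN : y N.+1 = 0 by [].
have zex (j : nat) : exists z : nat -> rat * rat, cvgc (fun n => qc (z n)) (y j).
  have [r1 c1] := rat_seq (complex.Re (y j)); have [r2 c2] := rat_seq (complex.Im (y j)).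
  by exists (fun n => (r1 n, r2 n)); split.
have [z zP] := choice zex.
pose s n := mkseq (fun j => z j n) N.+1.
have ycv j : (j <= N.+1)%N -> cvgc (fun n => ys N.+1 (s n) j) (y j).
  move=> jN; rewrite /ys; have [j0|j0] := posnP j.
    by rewrite j0 /= /y addr0 um; exact: cvgc_cst.
  move: jN; rewrite leq_eqVlt => /orP[/eqP ->|jN].
    by rewrite ltnn andbF yN; exact: cvgc_cst.
  rewrite jN /=; under eq_fun do rewrite nth_mkseq//.
  exact: zP.
have cvg_bigsum (M : nat) (G : nat -> nat -> R) (g : nat -> R) :
    (forall j, (j < M)%N -> (fun n => G j n) @ \oo --> g j) ->
    (fun n => \sum_(j < M) G j n) @ \oo --> \sum_(j < M) g j.
  elim: M => [|M IH] H.
    by rewrite big_ord0; under eq_fun do rewrite big_ord0; exact: cvg_cst.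
  rewrite big_ord_recr /=; under eq_fun do rewrite big_ord_recr /=.
  by apply: cvgD; [apply: IH => j jM; apply: H; exact: ltnW|exact: H].
have lhs : (fun n => A * \sum_(j < N.+1) sqc (ys N.+1 (s n) j)) @ \oo -->
    A * \sum_(j < N.+1) sqc (y j).
  apply: cvgM; first exact: cvg_cst.
  apply: (cvg_bigsum _ (fun j n => sqc (ys N.+1 (s n) j)) (fun j => sqc (y j))).
  by move=> j jN; apply: cvg_sqc; apply: ycv; exact: ltnW.
have rhs : (fun n => h * fiber_form b m N.+1 (ys N.+1 (s n)) P Q S t) @ \oo -->
    h * fiber_form b m N.+1 y P Q S t.
  apply: cvgM; first exact: cvg_cst.
  apply: (cvg_bigsum _ (fun j n => sqc (P (t + sh b m j) * ys N.+1 (s n) j +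
     Q (t + sh b m j) * ys N.+1 (s n) j.+1) + sqc (S (t + sh b m j) * ys N.+1 (s n) j))
    (fun j => sqc (P (t + sh b m j) * y j +
     Q (t + sh b m j) * y j.+1) + sqc (S (t + sh b m j) * y j))).
  move=> j jN; apply: cvgD; apply: cvg_sqc.
    apply: cvgcD; apply: cvgcM; try exact: cvgc_cst; apply: ycv => //; exact: ltnW.
  by apply: cvgcM; [exact: cvgc_cst|apply: ycv; exact: ltnW].
have := ler_cvg_to lhs rhs; move=> H.
have {}H : A * \sum_(j < N.+1) sqc (y j) <= h * fiber_form b m N.+1 y P Q S t.
  by apply: H; apply: nearW => n; exact: (Ht (m, N.+1, s n)).
apply: le_trans H _; rewrite ler_wpM2l ?invr_ge0 ?(ltW b0)//.
apply: ler_sum => j _; rewrite /jacL /sh /y.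
by rewrite (_ : m + j.+1%:Z = m + j%:Z + 1) //; lia.
Qed.

End GoodFiber.

(** * The inverse as a finite sum of weighted translates *)

Section MeasurableInverse.
Context {R : realType}.

Lemma cmeas_prod (I : Type) (s : seq I) (F : I -> R -> R[i]) :
  (forall i, cmeasurable (F i)) -> cmeasurable (fun t => \prod_(i <- s) F i t).
Proof.
move=> mF; elim: s => [|i s IH].
  by under eq_fun do rewrite big_nil; exact: cmeas_cst.
by under eq_fun do rewrite big_cons; exact: cmeasM.
Qed.

Lemma cmeas_inv (f : R -> R[i]) : cmeasurable f -> cmeasurable (fun t => (f t)^-1).
Proof.
move=> mf.
(* 1 / x is expR (- ln x) for x > 0, a composition of measurable functions. *)
have E t : (f t)^-1 = conjc (f t) * (if 0 < sqc (f t) then expR (- ln (sqc (f t))) else 0)%:C%C.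
  have [f0|f0] := eqVneq (f t) 0; first by rewrite f0 sqc0 ltxx invr0 mulr0.
  have sf : 0 < sqc (f t).
    rewrite lt_def sqc_ge0 andbT; apply: contra f0 => /eqP/sqc_eq0 ->; exact: eqxx.
  rewrite sf expRN lnK ?posrE//; apply: (mulfI f0); rewrite mulfV// mulrA.
  have -> : f t * conjc (f t) = (sqc (f t))%:C%C.
    by apply: eqc; rewrite /sqc /dotc !cE /=; ring.
  by rewrite -rmorphM divff ?gt_eqF.
under eq_fun do rewrite E.
apply: cmeasM; first exact: cmeasJ.
have ms := measurable_sqc mf.
apply: cmeas_real; apply: measurable_fun_ifT.
- by apply: measurable_fun_ltr => //; exact: measurable_cst.
- apply: measurableT_comp (@measurable_expR R) _; apply: measurable_funN.
  exact: measurableT_comp (@measurable_ln R) ms.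
- exact: measurable_cst.
Qed.

Lemma cmeas_det n (M : R -> 'M[R[i]]_n) :
  (forall i j, cmeasurable (fun t => M t i j)) -> cmeasurable (fun t => \det (M t)).
Proof.
move=> mM; rewrite /determinant; apply: cmeas_sum => s.
by apply: cmeasM; [exact: cmeas_cst|apply: cmeas_prod => i; exact: mM].
Qed.

(** Cramer's rule: the entries of the inverse are rational functions of the
    entries of the matrix. *)
Lemma cmeas_invmx n (M : R -> 'M[R[i]]_n) i j :
  (forall i j, cmeasurable (fun t => M t i j)) ->
  cmeasurable (fun t => if M t \in unitmx then invmx (M t) i j else 0).
Proof.
move=> mM.
rewrite (_ : (fun t => _) = (fun t => (\det (M t))^-1 * ((-1) ^+ (j + i) * \det (row' j (col' i (M t)))))).
  apply: cmeasM; first by apply: cmeas_inv; exact: cmeas_det.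
  apply: cmeasM; first exact: cmeas_cst.
  apply: cmeas_det => k l.
  by under eq_fun do rewrite !mxE; exact: mM.
apply/funext => t; case: ifPn => [Mu|].
  by rewrite /invmx Mu !mxE.
by rewrite unitmxE unitfE negbK => /eqP ->; rewrite invr0 mul0r.
Qed.

Lemma cmeas_trunc (B : R) (f : R -> R[i]) : cmeasurable f ->
  cmeasurable (fun t => if sqc (f t) <= B then f t else 0).
Proof.
move=> mf; apply: cmeas_if => //.
by apply: measurable_fun_ler; [exact: measurable_sqc|exact: measurable_cst].
Qed.

End MeasurableInverse.

Section Inverse.
Context {R : realType}.
Variables (a b c d C A : R) (g : R -> R[i]) (K : nat).
Hypotheses (a0 : 0 < a) (b0 : 0 < b) (ab : a < b^-1) (cd2 : d <= c + 2 * a).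
Hypotheses (mg : cmeasurable g) (gC : forall t, sqc (g t) <= C)
  (g0 : forall t, ~ (c <= t < d) -> g t = 0).
Local Notation h := (b^-1).
Hypothesis KE : forall j : nat, j%:R * (h - a) < d - c - a -> (j <= K)%N.
Local Notation cell := (cell a c).
Local Notation pos := (pos a c).
Local Notation gP := (gP a c g).
Local Notation gQ := (gQ a c g b).
Local Notation gS := (gS a c g b).

Definition orb (k : R -> R[i]) (t : R) (n : int) : R[i] := k (t + n%:~R * h).

Lemma orb_shift k t (e n : int) : orb k (t + e%:~R * h) n = orb k t (n + e).
Proof. by rewrite /orb; congr k; rewrite intrD; ring. Qed.

Lemma orb0 k t : orb k t 0 = k t.
Proof. by rewrite /orb mulr0z mul0r addr0. Qed.

Lemma gQ_pos t : gQ t != 0 -> pos t + h < d.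
Proof.
move=> gQ0; rewrite ltNge; apply/negP => H; move/eqP: gQ0; apply.
by rewrite /gQ g0 ?conjc0E//; move=> /andP[_]; rewrite ltNge H.
Qed.

(** The window vanishes from d on, so if Q t is nonzero then pos t + h < d <=
    c + 2 a, and pos t + h falls into [c + a, c + 2 a): the next point of the
    orbit lies in the next cell. *)
Lemma gQ_step t : gQ t != 0 -> cell (t + h) = cell t + 1 /\ pos (t + h) = pos t + (h - a).
Proof.
have abh := ab; have cd2a := cd2.
move=> /gQ_pos gQ0; have /andP[p1 p2] := pos_itv c a0 t.
have tE : t = pos t + (cell t)%:~R * a by rewrite /pos subrK.
have cE' : cell (t + h) = cell t + 1.
  apply: cell_eq => //; rewrite !intrD !mulrDl !mul1r; lra.
by split => //; rewrite {1}/pos cE' {1}tE intrD; ring.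
Qed.

Lemma chain_pos t (j : nat) : (forall i : nat, (i < j)%N -> gQ (t + i%:R * h) != 0) ->
  cell (t + j%:R * h) = cell t + j%:Z /\ pos (t + j%:R * h) = pos t + j%:R * (h - a).
Proof.
elim: j => [|j IH] H; first by rewrite !mul0r !addr0.
have [IH1 IH2] := IH (fun i ij => H i (ltnW ij)).
have [s1 s2] := gQ_step (H j (ltnSn j)).
have E : t + j.+1%:R * h = t + j%:R * h + h by rewrite -natr1; ring.
rewrite E s1 s2 IH1 IH2; split; first lia.
by rewrite -natr1; ring.
Qed.

Lemma chain_lt t (j : nat) : (forall i : nat, (i <= j)%N -> gQ (t + i%:R * h) != 0) ->
  pos t + j%:R * (h - a) + h < d.
Proof.
move=> H; have [_ <-] := @chain_pos t j (fun i ij => H i (ltnW ij)).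
by apply: gQ_pos; exact: H.
Qed.

(** Along j consecutive nonzero links the position increases by h - a at each
    step but must stay below d; this leaves room for at most K links. *)
Lemma chain_le t (j : nat) : (forall i : nat, (i < j)%N -> gQ (t + i%:R * h) != 0) -> (j <= K)%N.
Proof.
case: j => // j H; apply: KE.
have := @chain_lt t j H; have /andP[p1 p2] := pos_itv c a0 t.
rewrite -natr1 mulrDl mul1r; lra.
Qed.

Local Notation jU t := (jacU h (orb gP t) (orb gQ t)).
Local Notation brk t := (broken h (orb gP t) (orb gQ t)).

Lemma broken_gQ t n : gQ (t + n%:~R * h) = 0 -> brk t n.
Proof. by rewrite /broken /jacU /orb => ->; rewrite !mulr0. Qed.

(** Among K + 1 consecutive links one vanishes, so the blocks of the Jacobi
    matrix have size at most K + 1. *)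
Lemma exists_broken t (n : int) : exists j : nat, (j <= K)%N /\ brk t (n + j%:Z).
Proof.
apply: contrapT => nE.
have : (K.+1 <= K)%N; last by rewrite ltnn.
apply: (@chain_le (t + n%:~R * h)) => i iK; apply/eqP => gi; apply: nE.
exists i; split => //; apply: broken_gQ; rewrite -gi; congr gQ.
by rewrite intrD; ring.
Qed.

Lemma broken_left t : exists lo : int, - K%:Z <= lo <= 0 /\ brk t (lo - 1).
Proof.
have [j [jK bj]] := exists_broken t (- K%:Z - 1).
by exists (- K%:Z + j%:Z); split; [lia|rewrite (_ : _ - 1 = - K%:Z - 1 + j%:Z)//; ring].
Qed.

Lemma broken_right t : exists hi : int, 0 <= hi <= K%:Z /\ brk t hi.
Proof.
have [j [jK bj]] := exists_broken t 0.
by exists j%:Z; split; [lia|rewrite add0r in bj].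
Qed.

Local Notation T := (opT h gP gQ gS).
Local Notation jact t := (jac h (orb gP t) (orb gQ t) (orb gS t)).

Lemma opT_orb f t n : T f (t + n%:~R * h) = jact t (orb f t) n.
Proof.
rewrite jacE /opT /jacL /opL /opM /orb subrK intrB intrD.
have -> : t + (n%:~R + 1%:~R) * h = t + n%:~R * h + h by ring.
have -> : t + (n%:~R - 1%:~R) * h = t + n%:~R * h - h by ring.
by rewrite subrK.
Qed.

Hypothesis A0 : 0 < A.
Local Notation goodt t := (good h A (orb gP t) (orb gQ t) (orb gS t)).
Local Notation solve t f := (wext (wsolve h K (orb gP t) (orb gQ t) (orb gS t) f)).

(** The weights are entries of inverse window matrices. The two tests make
    them measurable and bounded everywhere; on a good orbit both succeed
    (wgt_good). *)
Definition wgt (j : 'I_(2 * K).+1) (t : R) : R[i] :=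
  let M := winmx h K (orb gP t) (orb gQ t) (orb gS t) in
  let z := if M \in unitmx then invmx M (wmid K) j else 0 in
  if sqc z <= A ^- 2 then z else 0.

Lemma wgt_good j t : goodt t -> wgt j t = winv h (orb gP t) (orb gQ t) (orb gS t) j.
Proof.
have h0 : 0 < h by rewrite invr_gt0.
by move=> gt; rewrite /wgt (winmx_unit K A0 gt) (winv_bound A0 j gt).
Qed.

Lemma wgt_le j t : sqc (wgt j t) <= A ^- 2.
Proof. by rewrite /wgt; case: ifP => // _; rewrite sqc0 invr_ge0 exprn_ge0// ltW. Qed.

Lemma cmeas_wgt j : cmeasurable (wgt j).
Proof.
have mP : cmeasurable gP by exact: cmeas_gP.
have mQ : cmeasurable gQ by exact: cmeas_gQ.
have mS : cmeasurable gS by exact: cmeas_gS.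
have mo (k : R -> R[i]) n : cmeasurable k -> cmeasurable (fun t => orb k t n).
  by move=> mk; apply: cmeas_comp mk; exact: measurable_shift.
apply: (cmeas_trunc (A ^- 2)); apply: cmeas_invmx => i k.
under eq_fun do rewrite mxE /jcoef /jacD /jacU.
have mu' n : cmeasurable (fun t => h%:C%C * (conjc (orb gP t n) * orb gQ t n)).
  apply: cmeasM; first exact: cmeas_cst.
  by apply: cmeasM; [apply: cmeasJ|]; exact: mo.
have msq (k' : R -> R[i]) n : cmeasurable k' -> cmeasurable (fun t => conjc (orb k' t n) * orb k' t n).
  by move=> mk; apply: cmeasM; [apply: cmeasJ|]; exact: mo.
apply: cmeasD; [apply: cmeasD|]; (apply: cmeasM; last exact: cmeas_cst).
- apply: cmeasM; first exact: cmeas_cst.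
  by apply: cmeasD; [apply: cmeasD|]; exact: msq.
- exact: mu'.
- by apply: cmeasJ; exact: mu'.
Qed.

Definition opV (f : R -> R[i]) t : R[i] :=
  \sum_(j < (2 * K).+1) wgt j t * f (t + (widx j)%:~R * h).

Lemma opV_good f t : goodt t -> opV f t = solve t (orb f t) 0.
Proof.
by move=> gt; rewrite wext0; apply: eq_bigr => j _; rewrite wgt_good.
Qed.

(** Left inverse, pointwise: the block of t fits into the window centred at t,
    so winv_left applies to the orbit. *)
Lemma opVT f t : goodt t -> opV (T f) t = f t.
Proof.
move=> gt; have h0 : 0 < h by rewrite invr_gt0.
have [lo [lo0 blo]] := broken_left t; have [hi [hi0 bhi]] := broken_right t.
have := winv_left A0 (orb f t) gt lo0 hi0 blo bhi.
rewrite orb0 => <-; apply: eq_bigr => j _.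
by rewrite wgt_good// opT_orb.
Qed.

Lemma jac_shift p q s u (e n : int) :
  jac h (fun k => p (k + e)) (fun k => q (k + e)) (fun k => s (k + e)) u (n - e) =
  jac h p q s (fun k => u (k - e)) n.
Proof.
have e1 : n - e - 1 + e = n - 1 by lia.
have e2 : n - e + 1 = n + 1 - e by lia.
have e3 : n - e - 1 = n - 1 - e by lia.
by rewrite /jac /jacD /jacU subrK e1 e2 e3.
Qed.

(** The windows centred at two points of an orbit give the same solution on a
    block that is contained in both of them. *)
Lemma solve_shift f t (e : int) (lo hi : int) n : goodt t -> goodt (t + e%:~R * h) ->
  - K%:Z <= lo -> hi <= K%:Z -> - K%:Z + e <= lo -> hi <= K%:Z + e ->
  brk t (lo - 1) -> brk t hi -> lo <= n <= hi ->
  solve (t + e%:~R * h) (orb f (t + e%:~R * h)) (n - e) = solve t (orb f t) n.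
Proof.
have h0 : 0 < h by rewrite invr_gt0.
move=> gt gte l1 h1 l2 h2 blo bhi.
move: n; apply: (jac_block_eq A0 gt blo bhi) => k klh.
rewrite (wsolveP A0 _ gt); last lia.
have oE F : orb F (t + e%:~R * h) = fun k => orb F t (k + e).
  by apply/funext => n; exact: orb_shift.
rewrite -(jac_shift (orb gP t) (orb gQ t) (orb gS t)).
rewrite -!oE (wsolveP A0 _ gte); last lia.
by rewrite orb_shift subrK.
Qed.

(** Right inverse, pointwise. The equation at t involves V f at t and at its
    two neighbours. If the link to a neighbour is nonzero, the neighbour
    belongs to the block of t, and the solutions on the two windows agree
    there (solve_shift); otherwise the value at the neighbour is multiplied by
    zero. Hence V f may be replaced by the solution on the window centred at
    t. *)
Lemma opTV f t : goodt t -> goodt (t + h) -> goodt (t - h) -> T (opV f) t = f t.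
Proof.
have h0 : 0 < h by rewrite invr_gt0.
move=> g0t g1 g2.
have e1 : t + h = t + (1 : int)%:~R * h by rewrite mul1r.
have e2 : t - h = t + (- 1 : int)%:~R * h by rewrite mulrNz mulN1r.
have -> : T (opV f) t = jact t (orb (opV f) t) 0.
  by rewrite -opT_orb mulr0z mul0r addr0.
have fE : f t = jact t (solve t (orb f t)) 0.
  by rewrite (wsolveP A0 _ g0t); [rewrite orb0|lia].
rewrite fE /jac; congr (_ + _ + _).
- by rewrite orb0 opV_good.
- have [U0|U0] := eqVneq (jU t 0) 0; first by rewrite U0 !mul0r.
  congr (_ * _); rewrite add0r {1}/orb -e1 opV_good// e1.
  have [i [iK bi]] := exists_broken t (- K%:Z).
  have [j [jK bj]] := exists_broken t 0.
  have i0 : i != K.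
    by apply/eqP => iE; move/eqP: U0; apply; move: bi; rewrite iE addNr.
  have j0 : j != 0%N.
    by apply/eqP => jE; move/eqP: U0; apply; move: bj; rewrite jE addr0.
  rewrite add0r in bj.
  rewrite -[X in solve _ _ X = _](subrr (1 : int)).
  apply: (@solve_shift _ _ _ (- K%:Z + i%:Z + 1) j%:Z) => //; rewrite -?e1//; try lia.
  by rewrite addrK.
- have [U0|U0] := eqVneq (jU t (0 - 1)) 0; first by rewrite U0 conjc0E !mul0r.
  congr (_ * _); rewrite {1}/orb sub0r -e2 opV_good// e2.
  have [i [iK bi]] := exists_broken t (- K%:Z - 1).
  have [j [jK bj]] := exists_broken t (- 1).
  have i0 : i != K.
    apply/eqP => iE; move/eqP: U0; apply; move: bi; rewrite iE.
    by rewrite (_ : - K%:Z - 1 + K%:Z = 0 - 1)//; ring.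
  have j0 : j != 0%N.
    by apply/eqP => jE; move/eqP: U0; apply; move: bj; rewrite jE addr0.
  rewrite -[X in solve _ _ X = _](subrr (- 1 : int)).
  apply: (@solve_shift _ _ _ (- K%:Z + i%:Z) (-1 + j%:Z)) => //; rewrite -?e2//; try lia.
  by rewrite (_ : - K%:Z + i%:Z - 1 = - K%:Z - 1 + i%:Z)//; ring.
Qed.

(** A nonzero weight requires that the two points of the orbit lie in one
    block (winv_chain), so no link between them vanishes. *)
Lemma wgt_right j t (k : nat) : goodt t -> widx j = k.+1%:Z -> wgt j t != 0 ->
  forall i : nat, (i <= k)%N -> gQ (t + i%:R * h) != 0.
Proof.
have h0 : 0 < h by rewrite invr_gt0.
move=> gt jk wn i ik; apply/eqP => gi; move/eqP: wn; apply; rewrite wgt_good//.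
have [lo [lo0 blo]] := broken_left t.
have bhi : brk t i%:Z by apply: broken_gQ.
have jK := widxP j.
by apply: (winv_chain A0 gt lo0 _ blo bhi); lia.
Qed.

Lemma wgt_left j t (k : nat) : goodt t -> widx j = - k.+1%:Z -> wgt j t != 0 ->
  forall i : nat, (i <= k)%N -> gQ (t - k.+1%:R * h + i%:R * h) != 0.
Proof.
have h0 : 0 < h by rewrite invr_gt0.
move=> gt jk wn i ik; apply/eqP => gi; move/eqP: wn; apply; rewrite wgt_good//.
have [hi [hi0 bhi]] := broken_right t.
have blo : brk t (- k.+1%:Z + i%:Z + 1 - 1).
  rewrite addrK; apply: broken_gQ; rewrite -gi; congr gQ.
  by rewrite intrD mulrNz; ring.
have jK := widxP j.
by apply: (winv_chain A0 gt _ hi0 blo bhi); lia.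
Qed.

End Inverse.

(** * Supports of the weights and of the dual window *)

Section Supports.
Context {R : realType}.
Local Notation mu := (@lebesgue_measure R).
Implicit Types (f : R -> R[i]).

Lemma ess_supp_sub f (Cl : set R) : (forall x, ~ Cl x -> nbhs x (~` Cl)) ->
  (\forall t \ae mu, ~ Cl t -> f t = 0) -> ess_supp f `<=` Cl.
Proof.
move=> clCl f0 x xf; apply: contrapT => /clCl /xf; apply; exact: f0.
Qed.

(** The translates of an interval by multiples of a form a locally finite
    family. A point x off the union lies in some [al + n a, al + (n + 1) a);
    to the right of be + n a and before the next left end, no translate is
    met. *)
Lemma closed_translates (a al be : R) x : 0 < a ->
  ~ (\bigcup_(n in [set: int]) [set` `[al + n%:~R * a, be + n%:~R * a]]) x ->
  nbhs x (~` (\bigcup_(n in [set: int]) [set` `[al + n%:~R * a, be + n%:~R * a]])).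
Proof.
move=> a0 nx; pose n1 := cell a al x.
have := eqxx n1; rewrite {1}/n1 cellP// => /andP[x1 x2].
have x3 : be + n1%:~R * a < x.
  rewrite ltNge; apply/negP => xbe; apply: nx; exists n1 => //=.
  by rewrite in_itv /= x1 xbe.
have : nbhs x [set` `]be + n1%:~R * a, al + (n1 + 1)%:~R * a[].
  by apply: near_in_itvoo; rewrite in_itv /= x3 x2.
apply: filterS => y /=; rewrite in_itv /= => /andP[y1 y2] [n _] /=.
rewrite in_itv /= => /andP[z1 z2].
have [nn|nn] := lerP n n1.
  have : n%:~R * a <= n1%:~R * a by rewrite ler_pM2r// ler_int.
  lra.
have : (n1 + 1)%:~R * a <= n%:~R * a by rewrite ler_pM2r// ler_int; lia.
lra.
Qed.

Lemma closed_nbhsC (Cl : set R) : closed Cl -> forall x, ~ Cl x -> nbhs x (~` Cl).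
Proof. by move=> /closed_openC oC x nx; exact: open_nbhs_nbhs. Qed.

Variables (a b c d C A : R) (g : R -> R[i]) (K : nat).
Hypotheses (a0 : 0 < a) (b0 : 0 < b) (ab : a < b^-1) (cd2 : d <= c + 2 * a) (A0 : 0 < A).
Hypotheses (mg : cmeasurable g) (gC : forall t, sqc (g t) <= C)
  (g0 : forall t, ~ (c <= t < d) -> g t = 0).
Local Notation h := (b^-1).
Hypothesis KE : forall j : nat, j%:R * (h - a) < d - c - a -> (j <= K)%N.
Local Notation cell := (cell a c).
Local Notation pos := (pos a c).
Local Notation gP := (gP a c g).
Local Notation gQ := (gQ a c g b).
Local Notation gS := (gS a c g b).
Local Notation goodt t := (good h A (orb b gP t) (orb b gQ t) (orb b gS t)).
Local Notation wgt := (wgt a b c A g (K := K)).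

(** All links from t to the point that the weight refers to are nonzero, and
    chain_lt bounds the position of t. This inequality is the right end of the
    interval I^- up to the translation by the cell of t; for negative shifts
    the same holds with the other end of the chain. *)
Lemma wgt_rightP j t (k : nat) : goodt t -> widx j = k.+1%:Z -> wgt j t != 0 ->
  pos t + k%:R * (h - a) + h < d.
Proof.
move=> gt jk wn.
apply: (chain_lt a0 b0 ab cd2 g0); exact: (wgt_right a0 b0 ab cd2 g0 KE A0 gt jk wn).
Qed.

Lemma wgt_leftP j t (k : nat) : goodt t -> widx j = - k.+1%:Z -> wgt j t != 0 ->
  pos (t - k.+1%:R * h) + k%:R * (h - a) + h < d.
Proof.
move=> gt jk wn.
apply: (chain_lt a0 b0 ab cd2 g0); exact: (wgt_left a0 b0 ab cd2 g0 KE A0 gt jk wn).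
Qed.

Lemma posE t : t = pos t + (cell t)%:~R * a.
Proof. by rewrite /pos subrK. Qed.

Lemma wgt_I_minus j t (k : nat) : goodt t -> widx j = k.+1%:Z -> wgt j t != 0 ->
  I_minus a b c d (cell t) k.+1 t.
Proof.
move=> gt jk wn; have H := wgt_rightP gt jk wn.
have /andP[p1 p2] := pos_itv c a0 t; have tE := posE t.
rewrite /I_minus /= in_itv /= -natr1; apply/andP; split; lra.
Qed.

Lemma wgt_I_plus j t (k : nat) : goodt t -> widx j = - k.+1%:Z -> wgt j t != 0 ->
  I_plus a b c d (cell (t - k.+1%:R * h) + k%:Z) k.+1 t.
Proof.
move=> gt jk wn; have H := wgt_leftP gt jk wn.
have /andP[p1 p2] := pos_itv c a0 (t - k.+1%:R * h).
have tE := posE (t - k.+1%:R * h).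
rewrite /I_plus /= in_itv /= intrD.
move: H p1 p2 tE; set s := t - _; rewrite -natr1.
move=> H p1 p2 tE; have {}tE : t = pos s + (cell s)%:~R * a + (k%:R + 1) * h.
  by rewrite -tE /s -natr1; ring.
have -> : k%:Z%:~R = k%:R :> R by [].
apply/andP; split; lra.
Qed.

Lemma int_two_cases (n k : int) : n < 1 - k -> - k - 2 < n -> n = - k - 1 \/ n = - k.
Proof. by lia. Qed.

Lemma widx_le (j : 'I_(2 * K).+1) (k : nat) :
  widx j = k.+1%:Z \/ widx j = - k.+1%:Z -> (k.+1 <= K)%N.
Proof. by have := widxP j; lia. Qed.

(** A nonzero term of the dual window at t comes from a chain of nonzero links
    that joins t to a point of the orbit where the window does not vanish, a
    point of [c, d). Comparing the two bounds leaves two possible cells for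
    the lower end of the chain. One of them gives the interval of index k, the
    other that of index k - 1, where index 0 stands for the support of the
    window itself. *)
Lemma dual_support j t : goodt t -> wgt j t * g (t + (widx j)%:~R * h) != 0 ->
  (I_zero a c d 0 `|` \bigcup_(k in [set k : nat | (1 <= k)%N /\ (k <= K)%N])
     (I_minus a b c d (- k%:Z) k `|` I_plus a b c d k%:Z k)) t.
Proof.
have abh := ab; have cd2a := cd2; have a_gt0 := a0.
move=> gt; rewrite mulf_eq0 negb_or => /andP[wn gn].
have sg : c <= t + (widx j)%:~R * h < d.
  by apply: contrapT => /g0 H; rewrite H eqxx in gn.
have kx : (exists k : nat, widx j = k.+1%:Z) \/ widx j = 0 \/ (exists k : nat, widx j = - k.+1%:Z).
  case: (widx j) => [[|k]|k]; first by right; left.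
    by left; exists k.
  by right; right; exists k; rewrite NegzE.
have intlt (n m : int) : n%:~R * a < m%:~R * a -> n < m by rewrite ltr_pM2r// ltr_int.
case: kx => [[k kE]|[kE|[k kE]]].
- have H := wgt_rightP gt kE wn.
  have kK := widx_le (or_introl kE).
  have /andP[p1 p2] := pos_itv c a0 t; have tE := posE t.
  rewrite kE in sg; have kR : k.+1%:Z%:~R = k%:R + 1 :> R by rewrite natr1.
  rewrite kR in sg; move: sg => /andP[s1 s2].
  have kh : k%:R * a <= k%:R * h by rewrite ler_wpM2l// ltW.
  have n1 : cell t < 1 - k%:Z.
    apply: intlt; rewrite intrB mulrBl mul1r (_ : k%:Z%:~R = k%:R)//; lra.
  have n2 : - k%:Z - 2 < cell t.
    apply: intlt; rewrite intrB mulrNz mulrBl mulNr (_ : k%:Z%:~R = k%:R)// (_ : 2%:~R = 2)//; lra.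
  have [nE|nE] := int_two_cases n1 n2.
    have {}nE : cell t = - k.+1%:Z by rewrite nE -opprD -PoszD addn1.
    right; exists k.+1; first by split.
    by left; rewrite -nE; exact: wgt_I_minus gt kE wn.
  have tE' : t = pos t - k%:R * a by rewrite {1}tE nE mulrNz mulNr.
  case: k kE kK H kR s1 s2 kh n1 n2 nE tE' => [|k] kE kK H kR s1 s2 kh n1 n2 nE tE'.
    left; rewrite /I_zero /= in_itv /= !mul0r; apply/andP; split; lra.
  right; exists k.+1; first by split => //; exact: ltnW.
  left; rewrite /I_minus /= in_itv /= mulrNz (_ : k.+1%:Z%:~R = k.+1%:R)//.
  rewrite -natr1 in H tE' *; apply/andP; split; lra.
- left; rewrite kE mul0r addr0 in sg; rewrite /I_zero /= in_itv /= !mul0r !addr0.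
  by move: sg => /andP[-> /ltW ->].
- have H := wgt_leftP gt kE wn.
  have kK := widx_le (or_intror kE).
  have /andP[p1 p2] := pos_itv c a0 (t - k.+1%:R * h).
  have tE := posE (t - k.+1%:R * h).
  rewrite kE mulrNz mulNr (_ : k.+1%:Z%:~R = k.+1%:R)// in sg.
  move: H p1 p2 tE sg; set s := t - _ => H p1 p2 tE /andP[s1 s2].
  have {}tE' : t = pos s + (cell s)%:~R * a + (k%:R + 1) * h.
    by rewrite -tE /s -natr1; ring.
  have n1 : cell s < 2.
    by apply: intlt; rewrite (_ : 2%:~R = 2)//; lra.
  have n2 : -1 < cell s.
    by apply: intlt; rewrite (_ : (-1)%:~R = -1)//; lra.
  have [nE|nE] : cell s = 1 \/ cell s = 0.
    by move: n1 n2; clear; move: (cell s) => n; lia.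
    rewrite nE mul1r in tE'.
    right; exists k.+1; first by split.
    right; rewrite /I_plus /= in_itv /= (_ : k.+1%:Z%:~R = k.+1%:R)//.
    move: H tE'; rewrite -!natr1 => H tE'; apply/andP; split; lra.
  rewrite nE mul0r addr0 in tE'.
  case: k kE kK @s H p1 p2 tE s1 s2 tE' n1 n2 nE => [|k] kE kK s H p1 p2 tE s1 s2 tE' n1 n2 nE.
    left; rewrite /I_zero /= in_itv /= !mul0r; apply/andP; split; lra.
  right; exists k.+1; first by split => //; exact: ltnW.
  right; rewrite /I_plus /= in_itv /= (_ : k.+1%:Z%:~R = k.+1%:R)//.
  move: H tE'; rewrite -!natr1 => H tE'; apply/andP; split; lra.
Qed.

End Supports.

(** * The inverse frame operator *)

Section Bounds.
Context {R : realType}.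
Local Notation mu := (@lebesgue_measure R).
Implicit Types (f : R -> R[i]).

Lemma L2norm_sqrt f : L2 f -> L2norm f = (Num.sqrt (nrm f))%:E.
Proof.
move=> f2; have := L2normE f2.
have : (0 <= L2norm f)%E by exact: Lnorm_ge0.
case: (L2norm f) => [r| |]//.
by rewrite lee_fin -EFin_expe => r0 [<-]; rewrite sqrtr_sqr ger0_norm.
Qed.

(** The constant is crude; any bound independent of F suffices for boundedness
    of the operator. *)
Lemma nrm_sum_le (n : nat) (F : 'I_n -> R -> R[i]) (B : R) :
  (forall j, L2 (F j)) -> (forall j, nrm (F j) <= B) ->
  nrm (fun t => \sum_(j < n) F j t) <= 2 ^+ n * n%:R * B.
Proof.
elim: n F => [|n IH] F F2 FB.
  rewrite mulr0 mul0r (_ : (fun t => _) = fun=> 0); last by apply/funext => t; rewrite big_ord0.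
  by rewrite /nrm dot0l.
rewrite (_ : (fun t => _) = (fun t => F ord0 t + \sum_(j < n) F (lift ord0 j) t)); last first.
  by apply/funext => t; rewrite big_ord_recl.
apply: le_trans (nrmD_le (F2 _) (L2_sum _ (fun j _ => F2 _))) _.
have h1 := FB ord0; have h2 := IH (fun j => F (lift ord0 j)) (fun j => F2 _) (fun j => FB _).
have B0 : 0 <= B := le_trans (nrm_ge0 _) (FB ord0).
have p1 : 1 <= 2 ^+ n :> R by rewrite exprn_ege1// ler1n.
have p2 : B <= 2 ^+ n * B by rewrite ler_peMl.
rewrite exprS -natr1; move: h2 p2; set X := 2 ^+ n => h2 p2; lra.
Qed.

Lemma Linf_bounded f (M : R) : cmeasurable f -> (forall t, sqc (f t) <= M) -> Linf f.
Proof.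
move=> mf fM; split => //; rewrite /cLnorm unlock; case: ifP => // _.
apply: (@le_lt_trans _ _ (Num.sqrt M)%:E); last exact: ltry.
apply/ess_supP; apply: ae_all => t /=; rewrite lee_fin.
have c0 : 0 <= cmod (f t) by case: (f t) => x y; exact: sqrtr_ge0.
by rewrite ger0_norm// -(ger0_norm c0) -sqrtr_sqr -sqcE ler_wsqrtr.
Qed.

Lemma cmeas_gabor (g : R -> R[i]) a b p : cmeasurable g -> cmeasurable (gabor g a b p).
Proof.
move=> mg; apply: cmeasM; last exact: cmeas_cis.
by apply: cmeas_comp mg; exact: (measurable_shift (- (p.2%:~R * a))).
Qed.

Lemma L2_gabor (g : R -> R[i]) a b p : L2 g -> L2 (gabor g a b p).
Proof.
move=> g2; rewrite /gabor; under eq_fun do rewrite mulrC.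
apply: (L2Mb (C := 1)); [exact: cmeas_cis|by move=> t; rewrite sqc_cis|].
exact: (L2_shift (- (p.2%:~R * a))).
Qed.

Lemma ae_gabor (g1 g2 : R -> R[i]) a b p :
  g1 = g2 %[ae mu] -> gabor g1 a b p = gabor g2 a b p %[ae mu].
Proof.
move=> /ae_eqE g12; apply/ae_eqE.
by move: (ae_shift (- (p.2%:~R * a)) g12); apply: ae_imp => t; rewrite /gabor => ->.
Qed.

End Bounds.

Section FrameInverse.
Context {R : realType}.
Local Notation mu := (@lebesgue_measure R).
Variables (a b c d C A B : R) (g g1 : R -> R[i]) (K : nat).
Hypotheses (a0 : 0 < a) (b0 : 0 < b) (ab : a < b^-1) (cd2 : d <= c + 2 * a)
  (A0 : 0 < A) (B0 : 0 < B).
Hypotheses (mg : cmeasurable g) (gC : forall t, sqc (g t) <= C)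
  (g0 : forall t, ~ (c <= t < d) -> g t = 0).
Hypotheses (g1L2 : L2 g1) (gg1 : g1 = g %[ae mu]).
Local Notation h := (b^-1).
Hypothesis KE : forall j : nat, j%:R * (h - a) < d - c - a -> (j <= K)%N.
Hypothesis frame : forall f, L2 f ->
  let s := (\esum_(p in [set: int * int]) ((cmod (inner f (gabor g1 a b p))) ^+ 2)%:E)%E in
  (A%:E * L2norm f ^+ 2 <= s /\ s <= B%:E * L2norm f ^+ 2)%E.
Local Notation gP := (gP a c g).
Local Notation gQ := (gQ a c g b).
Local Notation gS := (gS a c g b).
Local Notation goodt t := (good h A (orb b gP t) (orb b gQ t) (orb b gS t)).
Local Notation wgt := (wgt a b c A g (K := K)).
Local Notation T := (opT h gP gQ gS).
Local Notation V := (opV a b c A g K).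
Local Notation frm := (form h gP gQ gS).

Let mP : cmeasurable gP. Proof. exact: cmeas_gP. Qed.
Let mQ : cmeasurable gQ. Proof. exact: cmeas_gQ. Qed.
Let mS : cmeasurable gS. Proof. exact: cmeas_gS. Qed.
Let PC t : sqc (gP t) <= C. Proof. exact: gP_le. Qed.
Let QC t : sqc (gQ t) <= C. Proof. exact: gQ_le. Qed.
Let SC t : sqc (gS t) <= C. Proof. exact: gS_le. Qed.

Lemma esum_frame f : L2 f ->
  (\esum_(p in [set: int * int]) (sqc (inner f (gabor g1 a b p)))%:E = (frm f f)%:E)%E.
Proof.
move=> f2; rewrite -(esum_gabor a0 b0 ab cd2 mg gC g0 f2); apply: eq_esum => p _.
rewrite -sqcE; congr ((sqc _)%:E); apply: eq_ae_inner.
- exact: L2_meas.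
- by apply: cmeas_gabor; exact: L2_meas.
- exact: cmeas_gabor.
- exact: ae_gabor.
Qed.

Lemma frame_bounds f : L2 f -> A * nrm f <= frm f f /\ frm f f <= B * nrm f.
Proof.
move=> f2; have [] := frame f2; rewrite L2normE//.
have -> : (\esum_(p in [set: int * int]) ((cmod (inner f (gabor g1 a b p))) ^+ 2)%:E
    = (frm f f)%:E)%E.
  by rewrite -esum_frame//; apply: eq_esum => p _; rewrite sqcE.
by rewrite -!EFinM !lee_fin.
Qed.

(** The frame series converges to T f, and unconditional limits are unique
    almost everywhere, so the chosen limit is T f. *)
Lemma frame_operatorE f : L2 f ->
  L2 (frame_operator g1 a b f) /\ frame_operator g1 a b f = T f %[ae mu].
Proof.
move=> f2; have T2 k : L2 k -> L2 (T k) by exact: (L2_opT h mP mQ mS PC QC SC).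
have cvg := frame_series_cvg (e := gabor g1 a b) (T := T) (form := frm)
  (fun p => L2_gabor a b p g1L2) B0 T2 (dot_opT h mP mQ mS PC QC SC)
  esum_frame (fun f f2 => (frame_bounds f2).2) (formC h gP gQ gS) f2.
rewrite /frame_operator; set D := [set _ | _]; case: (xgetP (fun=> 0) D) => [k _ [k2 ks]|].
  split => //; apply: unconditional_sum_unique k2 (T2 _ f2) ks cvg.
  by move=> p; apply: L2Z; exact: L2_gabor.
by move=> /(_ (T f)) []; split => //; exact: T2.
Qed.

Lemma goodt_ae : \forall t \ae mu, goodt t /\ goodt (t + h) /\ goodt (t - h).
Proof.
have H : \forall t \ae mu, goodt t.
  exact: (good_ae b0 A0 mP mQ mS PC QC SC (fun f f2 => (frame_bounds f2).1)).
exact: (ae_and H (ae_and (ae_shift h H) (ae_shift (- h) H))).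
Qed.

Lemma wgt_term_L2 f j : L2 f -> L2 (fun t => wgt j t * f (t + (widx j)%:~R * h)).
Proof.
move=> f2; apply: (L2Mb (C := A ^- 2)); [exact: cmeas_wgt|exact: wgt_le|exact: L2_shift].
Qed.

Lemma L2_opV f : L2 f -> L2 (V f).
Proof. by move=> f2; apply: L2_sum => j _; exact: wgt_term_L2. Qed.

Lemma opV_linear z f k t : V (fun t => z * f t + k t) t = z * V f t + V k t.
Proof.
by rewrite /opV mulr_sumr -big_split; apply: eq_bigr => j _ /=; ring.
Qed.

Lemma ae_opV f k : f = k %[ae mu] -> V f = V k %[ae mu].
Proof.
move=> /ae_eqE fk; apply/ae_eqE.
have : \forall t \ae mu, forall j : 'I_(2 * K).+1,
    f (t + (widx j)%:~R * h) = k (t + (widx j)%:~R * h).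
  by apply: ae_forall => j; exact: (ae_shift _ fk).
by apply: ae_imp => t H; apply: eq_bigr => j _; rewrite H.
Qed.

Lemma nrm_opV f : L2 f ->
  nrm (V f) <= 2 ^+ (2 * K).+1 * (2 * K).+1%:R * (A ^- 2 * nrm f).
Proof.
move=> f2; apply: nrm_sum_le => j; first exact: wgt_term_L2.
have fs := L2_shift ((widx j)%:~R * h) f2.
by rewrite -(nrm_shift ((widx j)%:~R * h) f2); apply: nrmMb => //; [exact: cmeas_wgt|exact: wgt_le].
Qed.

Local Notation Sinv := (inverse_op (frame_operator g1 a b)).

(** T V f = f shows that f has a preimage, and V T k = k shows that it is
    unique almost everywhere. *)
Lemma inverseE f : L2 f -> L2 (Sinv f) /\ Sinv f = V f %[ae mu].
Proof.
move=> f2; have Vf2 := L2_opV f2.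
have TV : T (V f) = f %[ae mu].
  apply/ae_eqE; apply: ae_imp goodt_ae => t [t1 [t2 t3]].
  exact: (opTV a0 b0 ab cd2 g0 KE A0 f t1 t2 t3).
rewrite /inverse_op; set D := [set _ | _]; case: (xgetP (fun=> 0) D) => [k _ [k2 kf]|].
  split => //; have [_ Fk] := frame_operatorE k2.
  have Tk : T k = f %[ae mu] by exact: ae_eq_trans (ae_eq_sym Fk) kf.
  apply: ae_eq_trans (ae_opV Tk).
  apply/ae_eqE; apply: ae_imp goodt_ae => t [t1 _].
  by rewrite (opVT a0 b0 ab cd2 g0 KE A0).
move=> /(_ (V f)) []; split => //.
have [_ FV] := frame_operatorE Vf2; exact: ae_eq_trans FV TV.
Qed.

Definition weight (k : int) : R -> R[i] :=
  if - K%:Z <= k <= K%:Z then wgt (inord `|(k + K%:Z)%R|%N) else (fun=> 0).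

Lemma weight_widx j : weight (widx j) = wgt j.
Proof.
rewrite /weight widxP (_ : inord _ = j)//; apply: val_inj => /=.
by rewrite inordK; have := ltn_ord j; rewrite /widx; lia.
Qed.

Lemma opV_sum f t (X : {fset int}) : (forall k, (k \in X) = (- K%:Z <= k <= K%:Z)) ->
  V f t = \sum_(k <- X) weight k t * translate (- (k%:~R * h)) f t.
Proof.
move=> XE; rewrite (perm_big [seq widx j | j <- enum 'I_(2 * K).+1]) /=; last first.
  apply: uniq_perm; first exact: fset_uniq.
    by rewrite map_inj_uniq ?enum_uniq//; exact: widx_inj.
  move=> k; rewrite XE; apply/idP/mapP => [/widx_surj [j <-]|[j _ ->]].
    by exists j => //; rewrite mem_enum.
  exact: widxP.
rewrite big_map big_enum /=; apply: eq_bigr => j _.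
by rewrite weight_widx /translate opprK.
Qed.

(** The sum is finite, so the dense subspace is the whole of L2 and the net of
    finite partial sums is constant from the full index set on. *)
Lemma inverse_walnut :
  walnut_like [set k : int | - K%:Z <= k <= K%:Z] Sinv weight (fun k => - (k%:~R * b^-1)).
Proof.
split.
- split.
  + by move=> f /inverseE [].
  + move=> z f k f2 k2; have zk2 := L2D (L2Z z f2) k2.
    have [_ /ae_eqE e1] := inverseE zk2; have [_ /ae_eqE e2] := inverseE f2.
    have [_ /ae_eqE e3] := inverseE k2; apply/ae_eqE.
    apply: ae_imp (ae_and e1 (ae_and e2 e3)) => t [-> [-> ->]].
    exact: opV_linear.
  + pose M := 2 ^+ (2 * K).+1 * (2 * K).+1%:R * A ^- 2 : R.
    have M0 : 0 <= M by rewrite !mulr_ge0 ?exprn_ge0 ?invr_ge0 ?exprn_ge0// ltW.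
    exists (Num.sqrt M) => f f2; have [S2 SV] := inverseE f2.
    rewrite !L2norm_sqrt// -EFinM lee_fin -sqrtrM// ler_wsqrtr//.
    rewrite (eq_ae_nrm (L2_meas S2) (L2_meas (L2_opV f2)) SV).
    by apply: le_trans (nrm_opV f2) _; rewrite mulrA.
- exact: countableP.
- move=> k /widx_surj [j <-]; rewrite weight_widx.
  by apply: (Linf_bounded (M := A ^- 2)); [exact: cmeas_wgt|exact: wgt_le].
- exists (@L2 R).
    split => //.
    + by move=> z f k f2 k2; apply: L2D => //; exact: L2Z.
    + move=> f f2 e e0; exists f => //.
      rewrite (_ : (fun t => _) = fun=> 0); last by apply/funext => t; rewrite subrr.
      by apply/(L2norm_lt L2_0 e0); rewrite /nrm dot0l exprn_gt0.
  move=> f f2 e e0; have [S2 SV] := inverseE f2.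
  pose X0 := [fset k | k in [seq widx j | j <- enum 'I_(2 * K).+1]]%fset.
  have X0E k : (k \in X0) = (- K%:Z <= k <= K%:Z).
    rewrite /X0 !inE /=; apply/mapP/idP => [[j _ ->]|/widx_surj [j <-]].
      exact: widxP.
    by exists j => //; rewrite mem_enum.
  exists X0; first by move=> k /=; rewrite X0E.
  move=> X X0X XL.
  have XE k : (k \in X) = (- K%:Z <= k <= K%:Z).
    by apply/idP/idP => [/XL//|kK]; apply: X0X; rewrite /= X0E.
  have -> : (fun t => Sinv f t - \sum_(i <- X) weight i t * translate (- (i%:~R * h)) f t) =
      (fun t => Sinv f t - V f t).
    by apply/funext => t; rewrite (opV_sum f t XE).
  have V2 := L2_opV f2.
  apply/(L2norm_lt (L2B S2 V2) e0).
  by move/(ae_nrm S2 V2): SV => ->; rewrite exprn_gt0.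
Qed.

Lemma weight_support k : - K%:Z <= k <= K%:Z -> k != 0 ->
  ess_supp (weight k) `<=` \bigcup_(n in [set: int]) I_opp_sgn a b c d n k.
Proof.
move=> /widx_surj [j <-]; rewrite weight_widx => k0.
have good1 : \forall t \ae mu, goodt t by apply: ae_imp goodt_ae => t [].
apply: ess_supp_sub.
  move=> x; have [k1|/negPf k1] := boolP (0 < widx j); rewrite /I_opp_sgn k1.
    have E n : I_minus a b c d n `|widx j|%N = [set` `[c + n%:~R * a,
        d + (`|widx j|%:R - 1) * a - `|widx j|%:R * b^-1 + n%:~R * a]] by [].
    exact: closed_translates.
  exact: closed_translates.
apply: ae_imp good1 => t gt nI; apply: contrapT => /eqP wn; apply: nI.
have : (exists k : nat, widx j = k.+1%:Z) \/ (exists k : nat, widx j = - k.+1%:Z).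
  case: (widx j) k0 => [[|m]|m] // _; first by left; exists m.
  by right; exists m; rewrite NegzE.
case=> -[m kE].
  exists (cell a c t) => //; rewrite /I_opp_sgn kE /=.
  exact: (wgt_I_minus a0 b0 ab cd2 A0 g0 KE gt kE wn).
exists (cell a c (t - m.+1%:R * h) + m%:Z) => //; rewrite /I_opp_sgn kE abszN /=.
exact: (wgt_I_plus a0 b0 ab cd2 A0 g0 KE gt kE wn).
Qed.

Lemma dual_window_support : L2 (Sinv g1) /\
   ess_supp (Sinv g1) `<=`
     I_zero a c d 0 `|`
     \bigcup_(k in [set k : nat | (1 <= k)%N /\ (k <= K)%N])
       (I_minus a b c d (- k%:Z) k `|` I_plus a b c d k%:Z k).
Proof.
have [S2 /ae_eqE SV] := inverseE g1L2; split => //.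
apply: ess_supp_sub.
  apply: closed_nbhsC; apply: closedU; first exact: itv_closed.
  apply: closed_bigcup.
    apply: (@sub_finite_set _ _ `I_K.+1); last exact: finite_II.
    by move=> k [_ kK].
  by move=> k _; apply: closedU; exact: itv_closed.
have /ae_eqE VV := ae_opV gg1.
have good1 : \forall t \ae mu, goodt t by apply: ae_imp goodt_ae => t [].
apply: ae_imp (ae_and good1 (ae_and SV VV)) => t [gt [-> ->]] nI.
rewrite /opV big1// => j _; apply: contrapT => /eqP wn; apply: nI.
exact: (dual_support a0 b0 ab cd2 A0 g0 KE gt wn).
Qed.

End FrameInverse.

(** * Passage to a bounded window *)

Section CutWindow.
Context {R : realType}.
Local Notation mu := (@lebesgue_measure R).

(** Changing the window on a null set yields everywhere the bounds that hold
    almost everywhere. The end point d is removed so that the support is a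
    half-open interval, which fits the half-open cells. *)
Lemma bounded_window (g : R -> R[i]) (c d C : R) : 0 <= C -> cmeasurable g ->
  ess_supp g `<=` [set` `[c, d]] -> (\forall t \ae mu, sqc (g t) <= C) ->
  exists k : R -> R[i], [/\ cmeasurable k, forall t, sqc (k t) <= C,
    forall t, ~ (c <= t < d) -> k t = 0 & g = k %[ae mu]].
Proof.
move=> C0 mg gcd gC.
exists (fun t => ic `[c, d[%classic t * (if sqc (g t) <= C then g t else 0)); split.
- by apply: cmeasM; [exact: cmeas_ic|exact: cmeas_trunc].
- move=> t; rewrite sqc_icM; case: ifP => // _; case: ifP => //.
  by rewrite sqc0.
- move=> t nt; rewrite icE ifF ?mul0r//; apply/negbTE/negP.
  by rewrite inE /= in_itv.
apply/ae_eqE; apply: ae_imp (ae_and gC (ae_and (ess_supp_ae g) (ae_notin [:: d]))).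
move=> t [-> [g0]]; rewrite inE => td; rewrite icE.
case: ifPn => [_|tI]; first by rewrite mul1r.
rewrite mul0r; apply: g0 => /gcd /=; rewrite in_itv /= => /andP[ct td'].
by move: tI; rewrite notin_setE /= in_itv /= ct lt_neqAle td td'.
Qed.

End CutWindow.

Theorem theorem2 (R : realType) (g : R -> R[i]) (a b c d : R)
  (gL2 : L2 g) (cd : c < d) (supp_g : ess_supp g `<=` [set` `[c, d]])
  (a_ge : (d - c) / 2 <= a) (a_lt : a < d - c)
  (b_gt0 : 0 < b) (b_lt : b < 1 / a)
  (frame_g : gabor_frame g a b) :
  let K : int := Num.floor ((d - c - a) * b / (1 - a * b)) in
  let Sinv := inverse_op (frame_operator g a b) in
  (exists w : int -> R -> R[i],
     walnut_like [set k : int | - K <= k <= K] Sinv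
       w (fun k => - (k%:~R * b^-1)) /\
     forall k : int, - K <= k <= K -> k != 0 ->
       ess_supp (w k) `<=` \bigcup_(n in [set: int]) I_opp_sgn a b c d n k) /\
  (L2 (Sinv g) /\
   ess_supp (Sinv g) `<=`
     I_zero a c d 0 `|`
     \bigcup_(k in [set k : nat | (1 <= k)%N /\ k%:Z <= K])
       (I_minus a b c d (- k%:Z) k `|` I_plus a b c d k%:Z k)).
Proof.
move=> Kf Sinv; have [A [B [A0 AB frm]]] := frame_g.
have a0 : 0 < a by lra.
have ab1 : a * b < 1 by move: b_lt; rewrite ltr_pdivlMr// mulrC.
have ab : a < b^-1 by rewrite -[b^-1]mul1r ltr_pdivlMr.
have cd2 : d <= c + 2 * a by lra.
have B0 : 0 < B by lra.
have [k [mk kC k0 gk]] := bounded_window (mulr_ge0 (ltW b_gt0) (ltW B0)) (L2_meas gL2)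
  supp_g (gabor_bounded b_gt0 gL2 (fun f f2 => (frm f f2).2)).
have Kf0 : 0 <= Kf.
  by rewrite floor_ge_int divr_ge0 ?mulr_ge0//; lra.
have KfE : Kf = `|Kf|%N by rewrite gez0_abs.
(* Clearing denominators: (d - c - a) b / (1 - a b) = (d - c - a) / (h - a)
   with h = b^-1. *)
have KE (j : nat) : j%:R * (b^-1 - a) < d - c - a -> (j <= `|Kf|)%N.
  move=> jlt; rewrite -lez_nat -KfE floor_ge_int ler_pdivlMr ?subr_gt0//.
  have -> : j%:R * (1 - a * b) = j%:R * (b^-1 - a) * b.
    by rewrite -mulrA mulrBl mulVf ?gt_eqF.
  by rewrite ler_pM2r// ltW.
rewrite {}KfE in Sinv *; split.
  exists (weight a b c A k `|Kf|%N); split.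
    exact: (inverse_walnut a0 b_gt0 ab cd2 A0 B0 mk kC k0 gL2 gk KE frm).
  exact: (weight_support a0 b_gt0 ab cd2 A0 B0 mk kC k0 gL2 gk KE frm).
exact: (dual_window_support a0 b_gt0 ab cd2 A0 B0 mk kC k0 gL2 gk KE frm).
Qed.
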